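(* Let $n$ and $k$ be integers satisfying $n>k\ge2$. Then, for each $L>0$, there exists an $n$-dimensional polynomial vector field of degree $9\cdot2^{\,n-k-1}-2$ for which the number of attracting normally hyperbolic codimension-$k$ invariant tori is greater than $L$.
   Context: The degree of a polynomial vector field $\mathbf{P}=(P_1,\dots,P_n):\mathbb{R}^n\to\mathbb{R}^n$ is $\max_i\deg P_i$. A codimension-$k$ invariant torus is an invariant $(n-k)$-torus of $\dot{\mathbf{x}}=\mathbf{P}(\mathbf{x})$, i.e. an invariant embedded submanifold that is the image of an embedding of $(\mathbb{R}/\mathbb{Z})^{n-k}$ in $\mathbb{R}^n$. Normal hyperbolicity: let $\phi_t$ be the flow of $\dot x=F(x)$ in $\mathbb{R}^n$ and let $M$ be a compact connected invariant manifold of class $C^1$. Let $N$ be the normal bundle of $M$ with respect to the standard metric and $\Pi$ the orthogonal projection of $T\mathbb{R}^n|_M$ onto $N$. For $t\in\mathbb{R}$ and $p\in M$ put $$A_t(p)=D(\phi_{-t}|_M)(p):T_pM\to T_{\phi_{-t}(p)}M,\qquad B_t(p)=\Pi\cdot D\phi_t(\phi_{-t}(p))|_N:N_{\phi_{-t}(p)}\to N_p.$$ For an integer $r\ge1$, $M$ is attracting $r$-normally hyperbolic (in the absolute sense) if there are $K_A,K_B>1$ and $\rho_M,\rho_N>0$ with $\|A_t(p)\|\le K_Ae^{\rho_M|t|}$ for all $t\in\mathbb{R}$, $p\in M$; $\|B_t(p)\|\le K_Be^{-\rho_Nt}$ for all $t\ge0$, $p\in M$; and $\rho_N>r\,\rho_M$.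 Attracting normally hyperbolic, without a specified degree, means attracting $r$-normally hyperbolic for some integer $r\ge1$. *)

(* Defs.v *)
(* R^n is the space of row vectors ['rV[R]_n].  Its library norm is the sup norm;
   it is used for topology and differentiation only, all quantitative bounds being
   stated with the Euclidean norm [enorm].
   The notations of [mpoly] clash with those of MathComp-Analysis and are not
   Imported: [mpoly.mpoly n R] is [{mpoly R[n]}]. *)
From HB Require Import structures.
From mathcomp Require Import all_boot all_order all_algebra.
From mathcomp Require Import all_classical all_reals all_analysis.
From mathcomp Require mpoly.
Import (canonicals, coercions) mpoly.

Set Implicit Arguments.
Unset Strict Implicit.
Unset Printing Implicit Defensive.

Import Order.TTheory GRing.Theory Num.Theory.
Import numFieldNormedType.Exports.

Local Open Scope classical_set_scope.
Local Open Scope ring_scope.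

Section Euclidean.
Context {R : realType} {n : nat}.

Definition edot (v w : 'rV[R]_n) : R := \sum_(i < n) v 0 i * w 0 i.

Definition enorm (v : 'rV[R]_n) : R := Num.sqrt (edot v v).

End Euclidean.

Section PolynomialVectorFields.
Context {R : realType} {n : nat}.

Definition polyfield (P : 'I_n -> mpoly.mpoly n R) (x : 'rV[R]_n) : 'rV[R]_n :=
  \row_i mpoly.meval (fun j => x 0 j) (P i).

(* [mmeasure mdeg] is [msize], the total degree plus one (0 for the zero
   polynomial). *)
Definition polyfield_degree (P : 'I_n -> mpoly.mpoly n R) : nat :=
  \max_(i < n) (mpoly.mmeasure mpoly.mdeg (P i)).-1.

End PolynomialVectorFields.

Section Flow.
Context {R : realType} {n : nat}.
Implicit Types (F : 'rV[R]_n -> 'rV[R]_n) (M : set 'rV[R]_n).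

Definition flow_rel F (t : R) (x y : 'rV[R]_n) : Prop :=
  exists (a b : R) (g : R -> 'rV[R]_n),
    [/\ a < 0 < b, a < t < b, g 0 = x, g t = y &
        forall s : R, a < s < b -> is_derive s 1 g (F (g s))].

(* The flow of a vector field is only locally defined.  For F of class C^1,
   [flow_rel F t x] has at most one point and is nonempty for an open set of
   x, on which [flow F t] is the usual (C^1) time-t map; the value 0 elsewhere
   is a dummy. *)
Definition flow F (t : R) (x : 'rV[R]_n) : 'rV[R]_n := xget 0 (flow_rel F t x).

(* Invariance includes the existence for all times of the orbits in M. *)
Definition flow_invariant F M : Prop :=
  forall (t : R) (p : 'rV[R]_n), M p -> exists2 q, flow_rel F t p q & M q.

End Flow.

(* An embedding of (R/Z)^m, given by its Z^m-periodic lift u to R^m: a C^1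
   immersion, injective modulo Z^m, whose inverse from the image (with the
   subspace topology) to R^m/Z^m is continuous. *)
Section Tori.
Context {R : realType}.

Definition int_vec {m : nat} (z : 'rV[R]_m) : Prop :=
  forall i, z 0 i \is a Num.int.

Definition C1_map {m n : nat} (u : 'rV[R]_m -> 'rV[R]_n) : Prop :=
  (forall x, differentiable u x) /\
  (forall v, continuous (fun x => 'd u x v)).

Definition torus_embedding {m n : nat} (u : 'rV[R]_m -> 'rV[R]_n) : Prop :=
  [/\ C1_map u,
      forall x z, int_vec z -> u (x + z) = u x,
      forall x v, 'd u x v = 0 -> v = 0,
      forall x y, u x = u y -> int_vec (y - x) &
      forall x (e : R), 0 < e -> exists2 d : R, 0 < d &
        forall y, `|u y - u x| < d ->
          exists2 z, int_vec z & `|y - (x + z)| < e].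

Definition embedded_torus {n : nat} (m : nat) (M : set 'rV[R]_n) : Prop :=
  exists2 u : 'rV[R]_m -> 'rV[R]_n, torus_embedding u & M = range u.

End Tori.

Section NormalHyperbolicity.
Context {R : realType} {n : nat}.
Implicit Types (F : 'rV[R]_n -> 'rV[R]_n) (M : set 'rV[R]_n)
  (p v w : 'rV[R]_n).

(* T_p M, as the set of velocities at p of curves in M. *)
Definition tangent_space M p : set 'rV[R]_n :=
  [set v | exists c : R -> 'rV[R]_n,
     [/\ c 0 = p, \forall s \near (0 : R), M (c s) & is_derive (0 : R) 1 c v]].

Definition normal_space M p : set 'rV[R]_n :=
  [set w | forall v, tangent_space M p v -> edot w v = 0].

(* The orthogonal projection onto the normal space. *)
Definition normal_proj M p v : 'rV[R]_n :=
  xget 0 [set w | normal_space M p w /\ tangent_space M p (v - w)].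

(* For p in M and M invariant, the differential at p of the restriction of
   the time -t map to M is the restriction to T_p M of the differential of
   the time -t map. *)
Definition A_op F (t : R) p v : 'rV[R]_n := 'd (flow F (- t)) p v.

Definition B_op F M (t : R) p v : 'rV[R]_n :=
  normal_proj M p ('d (flow F t) (flow F (- t) p) v).

(* M is meant to be a compact connected invariant C^1 manifold, which an
   embedded invariant torus is.  A bound c on an operator norm is written as
   |A v| <= c |v| for all v in the domain of the operator. *)
Definition attracting_rNH F M (r : nat) : Prop :=
  exists KA KB rhoM rhoN : R,
    [/\ [/\ 1 < KA, 1 < KB, 0 < rhoM & 0 < rhoN],
        forall (t : R) p v, M p -> tangent_space M p v ->
          enorm (A_op F t p v) <= KA * expR (rhoM * `|t|) * enorm v,
        forall (t : R) p v, 0 <= t -> M p -> normal_space M (flow F (- t) p) v ->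
          enorm (B_op F M t p v) <= KB * expR (- rhoN * t) * enorm v &
        r%:R * rhoM < rhoN].

Definition attracting_NH F M : Prop :=
  exists2 r : nat, (1 <= r)%N & attracting_rNH F M r.

End NormalHyperbolicity.

Section InvariantTori.
Context {R : realType} {n : nat}.

Definition attracting_NH_invariant_torus (k : nat)
    (F : 'rV[R]_n -> 'rV[R]_n) (M : set 'rV[R]_n) : Prop :=
  [/\ embedded_torus (n - k) M, flow_invariant F M & attracting_NH F M].

End InvariantTori.

(* Main.v *)
Require Import Defs.
From HB Require Import structures.
From mathcomp Require Import all_boot all_order all_algebra.
From mathcomp Require Import all_classical all_reals all_analysis.
From mathcomp Require Import zify ring lra.
From mathcomp Require mpoly.
Import (canonicals, coercions) mpoly.
Import Order.TTheory GRing.Theory Num.Theory.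
Import numFieldNormedType.Exports.
Local Open Scope classical_set_scope.
Local Open Scope card_scope.
Local Open Scope ring_scope.
Set Implicit Arguments.
Unset Strict Implicit.
Unset Printing Implicit Defensive.

(** The slow system [th' = 1, a' = eps G, b' = eps (sin th) G] with
   [G = a cos (b + a sin th)] averages over [th] to a planar system whose linear part, at a
   zero [a0] of the Bessel function J0 and at [b0] with [sin b0 = 0], is a multiple
   [- (a0 cos b0 J1 (a0)) / (2 pi)] of the identity.  As J0 has infinitely many zeros, a
   small [eps] gives any prescribed number of attracting periodic solutions
   [(A (th), B (th))], with amplitudes [A] that are separated from each other.

   With [(Z, Q) = a (cos th, sin th)] and [al = b + Q] the system reads
   [Q' = Z + eps Q cos al, Z' = - Q + eps Z cos al, al' = Z + 2 eps Q cos al].  In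
   [x + iy = sqrt (Q + c) exp (i al / 2)] and [Z] it is, up to a change of time, polynomial.
   Next [Z] is replaced by [sigma_l (u_0, ..., u_l)], where [sigma_0 = u_0] and
   [sigma_(j+1) = sigma_j ^ 2 + u_(j+1) ^ 2 - c]: for large [c] its level sets at bounded heights are
   [l]-tori, so that each periodic solution becomes an [l+1]-torus.  Additional coordinates
   are contracted, and a positive factor [(x + c) ^ jj] adjusts the degree.

   On an invariant torus the [l] angles of the level sets are constant and the phase
   satisfies a scalar equation, so the flow is Lipschitz with a constant linear in time.
   Transversally, solutions that start near the torus approach it exponentially.  Both
   bounds only involve distances; they pass to the differential of the flow, since a
   differential along a curve, and its normal component, are bounded by the corresponding
   difference quotients. *)

(** * Calculus of one real variable *)

(** The degree does not limit the number of tori: all of them belong to one field with two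
    parameters, [eps], the least of finitely many thresholds, and [c], twice a bound of all
    amplitudes. With [l = n - k - 1], the plane and the [l + 1] nested coordinates carry a torus of
    codimension 2, and the other [k - 2] coordinates are contracted. The half angle makes
    [Q + c = x ^ 2 + y ^ 2] and [(Q + c) cos al = x ^ 2 - y ^ 2], so that the rates of [Q], [Z] and
    [al] become polynomial once multiplied by [2 (x ^ 2 + y ^ 2) ^ 2]; without the padding factor
    the degree is at most [3 * 2 ^ l + 4]. The choice of [b0] between 0 and [pi] adapts to the sign
    of J1 at the zero, so that each zero of J0 used gives an attractor. As the flow on a torus
    expands at most linearly in time, [rho_M] can be any positive number, and every exponential
    transverse rate suffices. Regularity of the flow is nowhere established: its differential is
    either the default 0 or a limit of difference quotients. *)

Section RealCalculus.
Context {R : realType}.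
Implicit Types (f g h k F : R -> R) (x y z s t a b d : R).

(* Typing the derivative in [R] keeps the terms readable by [ring]. *)
Definition has_deriv (f : R -> R) (x d : R) : Prop := is_derive x 1 f d.

Lemma der_eq f x (d d' : R) :
  has_deriv f x d -> d = d' -> has_deriv f x d'.
Proof. by move=> H <-. Qed.

Lemma der_cst c x : has_deriv (fun _ : R => c : R) x 0.
Proof. exact: is_derive_cst. Qed.

Lemma der_id x : has_deriv (fun y : R => y) x (1 : R).
Proof. exact: is_derive_id. Qed.

Lemma der_add f g x df dg : has_deriv f x df -> has_deriv g x dg ->
  has_deriv (fun y => f y + g y) x (df + dg).
Proof. by move=> *; exact: is_deriveD. Qed.

Lemma der_sub f g x df dg : has_deriv f x df -> has_deriv g x dg ->
  has_deriv (fun y => f y - g y) x (df - dg).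
Proof. by move=> *; exact: is_deriveB. Qed.

Lemma der_opp f x df : has_deriv f x df ->
  has_deriv (fun y => - f y) x (- df).
Proof. by move=> *; exact: is_deriveN. Qed.

Lemma der_mul f g x df dg : has_deriv f x df -> has_deriv g x dg ->
  has_deriv (fun y => f y * g y) x (df * g x + f x * dg).
Proof.
move=> Hf Hg; apply: der_eq (is_deriveM Hf Hg) _.
by rewrite /GRing.scale /= addrC mulrC (mulrC (f x)) [X in _ + X]mulrC mulrC.
Qed.

Lemma der_sqr f x df : has_deriv f x df ->
  has_deriv (fun y => f y ^+ 2) x (2 * f x * df).
Proof.
move=> Hf; have := der_mul Hf Hf.
have -> : (fun y => f y * f y) = (fun y => f y ^+ 2).
  by apply/funext => y; rewrite expr2.
move=> H; apply: der_eq H _; ring.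
Qed.

Lemma der_comp f g x df dg : has_deriv f (g x) df -> has_deriv g x dg ->
  has_deriv (fun y => f (g y)) x (df * dg).
Proof. by move=> Hf Hg; exact: (is_derive1_comp Hf Hg). Qed.

Lemma der_inv f x df : f x != 0 -> has_deriv f x df ->
  has_deriv (fun y => (f y)^-1) x (- df / f x ^+ 2).
Proof.
move=> f0 Hf; apply: der_eq (is_deriveV f0 Hf) _.
by rewrite /GRing.scale /= mulrC mulrN mulNr.
Qed.

Lemma der_sin f x df : has_deriv f x df ->
  has_deriv (fun y => sin (f y)) x (cos (f x) * df).
Proof. by apply: der_comp; exact: is_derive_sin. Qed.

Lemma der_cos f x df : has_deriv f x df ->
  has_deriv (fun y => cos (f y)) x (- sin (f x) * df).
Proof. by apply: der_comp; exact: is_derive_cos. Qed.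

Lemma der_exp f x df : has_deriv f x df ->
  has_deriv (fun y => expR (f y)) x (expR (f x) * df).
Proof. by apply: der_comp; exact: is_derive_expR. Qed.

Lemma der_sqrt f x df : 0 < f x -> has_deriv f x df ->
  has_deriv (fun y => Num.sqrt (f y)) x (df / (2 * Num.sqrt (f x))).
Proof.
move=> f0 Hf.
apply: der_eq (der_comp (is_derive1_sqrt f0) Hf) _; exact: mulrC.
Qed.

Lemma der_continuous f x d :
  has_deriv f x d -> {for x, continuous f}.
Proof. by move=> [Hf _]; exact/differentiable_continuous/derivable1_diffP. Qed.

Lemma mvt f df a b : a <= b ->
  (forall x, a <= x <= b -> has_deriv f x (df x)) ->
  exists2 c, a <= c <= b & f b - f a = df c * (b - a).
Proof.
move=> ab Hf.
have [||c cab E] := @MVT_segment _ f df a b ab.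
- by move=> x /itvP xab; apply: Hf; rewrite !xab.
- apply: continuous_in_subspaceT => x /set_mem /itvP xab.
  by apply: (der_continuous (Hf _ _)); rewrite !xab.
- by exists c => //; rewrite !(itvP cab).
Qed.

Lemma der_le0_le f df a b : a <= b ->
  (forall x, a <= x <= b -> has_deriv f x (df x)) ->
  (forall x, a <= x <= b -> df x <= 0) -> f b <= f a.
Proof.
move=> ab Hf H0; have [c cab E] := mvt ab Hf.
by rewrite -subr_le0 E mulr_le0_ge0 ?subr_ge0// H0.
Qed.

Lemma der_ge0_le f df a b : a <= b ->
  (forall x, a <= x <= b -> has_deriv f x (df x)) ->
  (forall x, a <= x <= b -> 0 <= df x) -> f a <= f b.
Proof.
move=> ab Hf H0; have [c cab E] := mvt ab Hf.
by rewrite -subr_ge0 E mulr_ge0 ?subr_ge0// H0.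
Qed.

Lemma der_lip f df a b K :
  (forall x, has_deriv f x (df x)) ->
  (forall x, `|df x| <= K) -> `|f b - f a| <= K * `|b - a|.
Proof.
move=> Hf HK; wlog ab : a b / a <= b.
  by move=> W; case: (leP a b) => [/W//|/ltW/W]; rewrite distrC (distrC a).
have [c _ ->] := mvt ab (fun x _ => Hf x).
by rewrite normrM ler_wpM2r.
Qed.

Lemma der0_cst_on f a b :
  (forall x, a <= x <= b -> has_deriv f x 0) ->
  forall x y, a <= x <= b -> a <= y <= b -> f x = f y.
Proof.
move=> Hf x y; wlog xy : x y / x <= y.
  by move=> W; case: (leP x y) => [/W//|/ltW/W H ? ?]; rewrite H.
move=> /andP[ax xb] /andP[ay yb].
have [|c _] := @mvt f (fun=> 0) x y xy.
  by move=> z /andP[xz zy]; apply: Hf; rewrite (le_trans ax)//= (le_trans zy).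
by rewrite mul0r => /eqP; rewrite subr_eq0 => /eqP.
Qed.

Let mu := @lebesgue_measure R.

Lemma antiderivative_on h a b :
  (forall x, a <= x <= b -> {for x, continuous h}) ->
  exists F, forall x, a < x < b -> has_deriv F x (h x).
Proof.
move=> hc; exists (fun x => \int[mu]_(t in [set` `[a, x]]) h t)%R => x.
case/andP => ax xb.
have [||dF F'] := @continuous_FTC1_closed R h a x b xb _ ax (hc x _).
- apply: continuous_compact_integrable; first exact: segment_compact.
  by apply: continuous_in_subspaceT => y /set_mem /itvP yab; apply: hc; rewrite !yab.
- by rewrite !ltW.
- by rewrite -F' derive1E; exact: derivableP.
Qed.

(** The fundamental theorem of calculus is applied on bounded intervals. The antiderivatives on the
    intervals of radius [n + 1], normalized at 0, agree where both are defined, and the one used at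
    [x] has as index the integer part of [|x|]. *)
Lemma antiderivative h : continuous h ->
  exists2 F, F 0 = 0 & forall x, has_deriv F x (h x).
Proof.
move=> hc.
have /choice[G HG] : forall n : nat, exists F : R -> R,
    F 0 = 0 /\ forall x, - n.+1%:R < x < n.+1%:R -> has_deriv F x (h x).
  move=> n; have [F HF] := antiderivative_on (fun x (_ : - n.+1%:R <= x <= n.+1%:R) => hc x).
  exists (fun x => F x - F 0); rewrite subrr; split=> // x /HF Hx.
  by apply: der_eq (der_sub Hx (der_cst _ _)) _; rewrite subr0.
have agree n m x : `|x| < n.+1%:R -> `|x| < m.+1%:R -> G n x = G m x.
  move=> xn xm; have [Gn0 Gn] := HG n; have [Gm0 Gm] := HG m.
  have H : forall y, - `|x| <= y <= `|x| ->
      has_deriv (fun y => G n y - G m y) y 0.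
    move=> y; rewrite -ler_norml => yx; rewrite -(subrr (h y)).
    by apply: der_sub; [apply: Gn|apply: Gm]; rewrite -ltr_norml (le_lt_trans yx).
  have := der0_cst_on H (x := x) (y := 0).
  rewrite Gn0 Gm0 subrr -!ler_norml lexx normr0 normr_ge0 => /(_ isT isT)/eqP.
  by rewrite subr_eq0 => /eqP.
pose k (x : R) := Num.truncn `|x|.
have kP (x : R) : `|x| < (k x).+1%:R by rewrite -truncn_lt_nat.
exists (fun x => G (k x) x); first by have [] := HG (k 0).
move=> x; have [_ /(_ x)] := HG (k x).+1.
have xk : `|x| < (k x).+2%:R by rewrite (lt_trans (kP x))// ltr_nat.
rewrite -ltr_norml => /(_ xk); apply: near_eq_is_derive.
near=> y; apply: agree => //.
near: y; apply: (cvgr_lt `|x|) => //.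
by apply: cvg_norm; exact: cvg_id.
Unshelve. all: by end_near. Qed.

(** A chosen antiderivative replaces the integral: linearity and bounds then follow from uniqueness
    and from the mean value theorem. The zero function is a default value. *)
Definition prim h : R -> R :=
  xget (fun=> 0) [set F | F 0 = 0 /\ forall x, has_deriv F x (h x)].

Lemma primP h : continuous h ->
  prim h 0 = 0 /\ forall x, has_deriv (prim h) x (h x).
Proof.
move=> /antiderivative[F F0 F'].
by have := @xgetPex _ (fun=> 0) [set F | F 0 = 0 /\ _] (ex_intro _ F (conj F0 F')).
Qed.

Lemma prim0 h : continuous h -> prim h 0 = 0.
Proof. by case/primP. Qed.

Lemma der_prim h x : continuous h -> has_deriv (prim h) x (h x).
Proof. by case/primP. Qed.

Lemma prim_unique h F x y : continuous h ->
  (forall x, has_deriv F x (h x)) -> prim h y - prim h x = F y - F x.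
Proof.
move=> hc HF.
have H (z : R) : has_deriv (fun z => F z - prim h z) z 0.
  by rewrite -(subrr (h z)); apply: der_sub (HF z) (der_prim z hc).
have := is_derive_0_is_cst y x H; lra.
Qed.

Lemma prim_add h k x : continuous h -> continuous k ->
  prim (fun y => h y + k y) x = prim h x + prim k x.
Proof.
move=> hc kc; have c : continuous (fun y => h y + k y).
  by move=> y; exact: continuousD (hc y) (kc y).
have := @prim_unique _ (fun y => prim h y + prim k y) 0 x c.
rewrite !prim0// addr0 !subr0; apply => y.
by apply: der_add; exact: der_prim.
Qed.

Lemma prim_scale c h x : continuous h -> prim (fun y => c * h y) x = c * prim h x.
Proof.
move=> hc; have cc : continuous (fun y => c * h y).
  by move=> y; apply: continuousM (hc y); exact: cst_continuous.
have := @prim_unique _ (fun y => c * prim h y) 0 x cc.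
rewrite !prim0// mulr0 !subr0; apply => y.
apply: der_eq (der_mul (der_cst c y) (der_prim y hc)) _; ring.
Qed.

Lemma prim_sub h k x : continuous h -> continuous k ->
  prim (fun y => h y - k y) x = prim h x - prim k x.
Proof.
move=> hc kc; have c : continuous (fun y => h y - k y).
  by move=> y; exact: continuousB (hc y) (kc y).
have := @prim_unique _ (fun y => prim h y - prim k y) 0 x c.
rewrite !prim0// subr0 !subr0; apply => y.
by apply: der_sub; exact: der_prim.
Qed.

Lemma prim_le h K x y : continuous h -> (forall z, `|h z| <= K) ->
  `|prim h y - prim h x| <= K * `|y - x|.
Proof. by move=> hc hK; apply: der_lip hK => z; exact: der_prim. Qed.

Lemma prim_le0 h K x : continuous h -> (forall z, `|h z| <= K) ->
  `|prim h x| <= K * `|x|.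
Proof.
by move=> hc hK; have := prim_le 0 x hc hK; rewrite prim0// !subr0.
Qed.

(** The factor [E] is the exponential of a primitive of [k]. So a quantity with [f' = k f] that is
    positive at [a] stays positive, and one that vanishes there vanishes throughout; this is how
    positivity and algebraic relations propagate along solutions. *)
Lemma linear_ode_on f k a b : a <= b ->
  (exists2 F, F a = 0 & forall s, a <= s <= b -> has_deriv F s (k s)) ->
  (forall s, a <= s <= b -> has_deriv f s (k s * f s)) ->
  exists E : R -> R, (forall s, 0 < E s) /\ forall s, a <= s <= b -> f s = f a * E s.
Proof.
move=> ab [F F0 HF] Hf; exists (fun s => expR (F s)); split=> [s|s sab].
  exact: expR_gt0.
have H s' : a <= s' <= b -> has_deriv (fun s => f s * expR (- F s)) s' 0.
  move=> s'ab; apply: der_eq (der_mul (Hf _ s'ab)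
    (der_exp (der_opp (HF _ s'ab)))) _; ring.
have := der0_cst_on H sab (_ : a <= a <= b); rewrite lexx ab F0 oppr0 expR0 mulr1.
by move=> <-//; rewrite -mulrA -expRD addrC subrr expR0 mulr1.
Qed.

Lemma gronwall f a b K : a <= b ->
  (forall s, a <= s <= b -> exists2 d, has_deriv f s d & d <= K * f s) ->
  f b <= f a * expR (K * (b - a)).
Proof.
move=> ab Hf.
have /(@choice _ _)[df Hdf] : forall s, exists d, a <= s <= b ->
    has_deriv f s d /\ d <= K * f s.
  move=> s; case: (boolP (a <= s <= b)) => [/Hf[d]|_]; last by exists 0.
  by exists d.
pose g s := f s * expR (- (K * (s - a))).
have Hg s : a <= s <= b -> has_deriv g s ((df s - K * f s) * expR (- (K * (s - a)))).
  move=> /Hdf[Hd _]; apply: der_eq (der_mul Hd (der_exp (der_opp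
    (der_mul (der_cst K s) (der_sub (der_id s) (der_cst a s)))))) _; ring.
have := der_le0_le ab Hg; rewrite /g subrr mulr0 oppr0 expR0 mulr1 => H.
rewrite -ler_pdivrMr ?expR_gt0// -expRN; apply: H => s /Hdf[_ Hs].
by rewrite mulr_le0_ge0 ?subr_le0// expR_ge0.
Qed.

(** Continuity argument: the differential inequality is known only where [f < eta], but as long as
    it holds [f] stays below [f 0 < eta]. Hence the supremum of the times up to which [f <= f 0]
    cannot lie before [s]. *)
Lemma gronwall_local f t K eta : 0 <= t -> f 0 < eta -> 0 <= K ->
  (forall s, 0 <= s <= t -> 0 <= f s) ->
  (forall s, 0 <= s <= t -> exists2 d, has_deriv f s d &
     (f s < eta -> d <= - K * f s)) ->
  forall s, 0 <= s <= t -> f s <= f 0 * expR (- K * s).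
Proof.
move=> t0 f0 K0 fpos Hf s st.
have fc u : 0 <= u <= t -> {for u, continuous f}.
  by move=> /Hf[d /der_continuous].
(* The closed condition [f v <= f 0], unlike [f v < eta], passes to the supremum. *)
pose ok u := 0 <= u <= s /\ forall v, 0 <= v <= u -> f v <= f 0.
have s0 : 0 <= s by case/andP: st.
have ok0 : ok 0.
  by split=> [|v]; [rewrite lexx|rewrite -eq_le => /eqP <-].
have okb : has_sup ok by split; [exists 0|exists s => u [/andP[]]].
have mono u v : 0 <= u -> u <= v -> v <= s ->
    (forall w, u <= w <= v -> f w < eta) -> f v <= f u * expR (- K * (v - u)).
  move=> u0 uv vs H; apply: gronwall uv _ => w /andP[uw wv].
  have [|d Hd Hd'] := Hf w.
    by rewrite (le_trans u0)//= (le_trans wv)// (le_trans vs)//; case/andP: st.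
  by exists d => //; apply/Hd'/H; rewrite uw.
have key u : ok u -> forall v, 0 <= v <= u -> f v <= f 0 * expR (- K * v).
  move=> [/andP[u0 us] uv] v /andP[v0 vu].
  have := mono 0 v; rewrite subr0; apply => //; first exact: le_trans us.
  move=> w /andP[w0 wv]; apply: le_lt_trans f0; apply: uv.
  by rewrite w0 (le_trans wv).
suff oks : ok s by apply: (key s oks); rewrite s0 lexx.
pose S := sup ok.
have Sge0 : 0 <= S by apply: ub_le_sup ok0; case: okb.
have Ss : S <= s by apply: ge_sup => [|u [/andP[]]//]; case: okb.
have below v : 0 <= v < S -> f v <= f 0.
  case/andP=> v0 vS; have [|u uok vu] := @sup_adherent _ ok (S - v) _ okb.
    by rewrite subr_gt0.
  by rewrite subKr in vu; case: uok => _; apply; rewrite v0 ltW.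
have Sin : 0 <= S <= t by rewrite Sge0 (le_trans Ss)//; case/andP: st.
have fS : f S <= f 0.
  rewrite leNgt; apply/negP => fS.
  have S0 : 0 < S.
    rewrite lt_neqAle Sge0 andbT; apply/eqP => S0.
    by move: fS; rewrite -S0 ltxx.
  have /nbhs_ballP[e /= e0 He] : \forall v \near S, f 0 < f v.
    exact: cvgr_gt (fc S Sin) _ fS.
  pose v := Num.max 0 (S - e / 2).
  have : f 0 < f v.
    apply: He; rewrite /ball/= /v; case: (leP 0 (S - e / 2)) => vv.
      by rewrite subKr ger0_norm; lra.
    by rewrite subr0 ger0_norm//; lra.
  rewrite ltNge below// /v; case: (leP 0 (S - e / 2)) => vv; last by rewrite lexx.
  by rewrite vv/=; lra.
have okS : ok S.
  split=> [|v /andP[v0]]; first by rewrite Sge0.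
  by rewrite le_eqVlt => /predU1P[->//|vS]; apply: below; rewrite v0.
have /nbhs_ballP[e /= e0 He] : \forall v \near S, f v < eta.
  exact: cvgr_lt (fc S Sin) _ (le_lt_trans fS f0).
(* As [f < eta] within distance [e] of [S], the decay continues up to [S + e / 2]: this reaches [s],
   or exceeds the supremum. *)
have [sSe|Ses] := leP s (S + e / 2).
- split=> [|v /andP[v0 vs]]; first by rewrite s0 lexx.
  have [vS|Sv] := ltP v S; first by apply: below; rewrite v0.
  apply: le_trans fS; apply: le_trans (mono S v _ _ _ _) _ => //.
    move=> w /andP[Sw wv]; apply: He; rewrite /ball/= ler0_norm ?subr_le0//; lra.
  rewrite ler_piMr ?fpos// -[leRHS]expR0 ler_expR mulNr oppr_le0 mulr_ge0//.
  by rewrite subr_ge0.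
- suff /(ub_le_sup (proj2 okb)) : ok (S + e / 2) by rewrite -/S; lra.
  split=> [|v /andP[v0 vs]]; first by apply/andP; split; lra.
  have [vS|Sv] := ltP v S; first by apply: below; rewrite v0.
  apply: le_trans fS; apply: le_trans (mono S v _ _ _ _) _ => //; first lra.
    move=> w /andP[Sw wv]; apply: He; rewrite /ball/= ler0_norm ?subr_le0//; lra.
  rewrite ler_piMr ?fpos// -[leRHS]expR0 ler_expR mulNr oppr_le0 mulr_ge0//.
  by rewrite subr_ge0.
Qed.

Lemma lip_continuous f K : (forall x y, `|f x - f y| <= K * `|x - y|) -> continuous f.
Proof.
move=> fK x; apply/cvgrPdist_lt => e e0.
have [K0|K0] := leP K 0.
  apply: nearW => y; apply: le_lt_trans (fK x y) _.
  by apply: le_lt_trans e0; rewrite mulr_le0_ge0.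
apply/nbhs_ballP; exists (e / K) => [|y]; first by rewrite /= divr_gt0.
rewrite /ball/= ltr_pdivlMr// mulrC; exact: le_lt_trans.
Qed.

End RealCalculus.

Ltac der_step :=
  lazymatch goal with
  | |- has_deriv (fun y => y) _ _ => exact: der_id
  | |- has_deriv (fun y => @?f y + - @?g y) _ _ => notypeclasses refine (@der_sub _ f g _ _ _ _ _)
  | |- has_deriv (fun y => @?f y + @?g y) _ _ => notypeclasses refine (@der_add _ f g _ _ _ _ _)
  | |- has_deriv (fun y => - @?f y) _ _ => notypeclasses refine (@der_opp _ f _ _ _)
  | |- has_deriv (fun y => @?f y * @?g y) _ _ => notypeclasses refine (@der_mul _ f g _ _ _ _ _)
  | |- has_deriv (fun y => (@?f y) ^+ 2) _ _ => notypeclasses refine (@der_sqr _ f _ _ _)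
  | |- has_deriv (fun y => (@?f y)^-1) _ _ => notypeclasses refine (@der_inv _ f _ _ _ _)
  | |- has_deriv (fun y => sin (@?f y)) _ _ => notypeclasses refine (@der_sin _ f _ _ _)
  | |- has_deriv (fun y => cos (@?f y)) _ _ => notypeclasses refine (@der_cos _ f _ _ _)
  | |- has_deriv (fun y => expR (@?f y)) _ _ => notypeclasses refine (@der_exp _ f _ _ _)
  | |- has_deriv (fun y => Num.sqrt (@?f y)) _ _ => notypeclasses refine (@der_sqrt _ f _ _ _ _)
  end.

Ltac der_auto := cbv beta;
  first [eassumption | notypeclasses refine (@der_cst _ _ _) | der_step; der_auto | idtac].
Ltac der := cbv beta; notypeclasses refine (der_eq _ _); [der_auto .. | cbv beta].

(** * Averages and Bessel functions *)

Ltac cont := move=> ?; eapply der_continuous; der_auto.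

Section Averages.
Context {R : realType}.
Implicit Types (f g h k F : R -> R) (x y z s t a b : R).

Lemma cos2piD x : cos (x + 2 * pi) = cos x :> R.
Proof. by rewrite mulr_natl cosD2pi. Qed.

Lemma sin2piD x : sin (x + 2 * pi) = sin x :> R.
Proof. by rewrite mulr_natl sinD2pi. Qed.

(** A quadratic remainder makes the Caratheodory slope continuous at [x]. Derivatives of integrals
    with respect to a parameter are obtained in this form, from a Taylor remainder that is uniform
    in the variable of integration. *)
Lemma der_quad f x d K :
  (forall y, `|f y - f x - d * (y - x)| <= K * (y - x) ^+ 2) -> has_deriv f x d.
Proof.
move=> Hf; have /is_derive1_caratheodory : exists g : R -> R,
    [/\ forall z, f z - f x = g z * (z - x), {for x, continuous g} & g x = d].
  exists (fun z => if z == x then d else (f z - f x) / (z - x)).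
  rewrite eqxx; split=> // [z|].
    by case: eqP => [->|/eqP zx]; rewrite ?subrr ?mulr0// divfK// subr_eq0.
  apply/cvgrPdist_lt => e e0; rewrite eqxx.
  apply/nbhs_ballP; exists (e / (`|K| + 1)) => [|y] /=.
    by rewrite divr_gt0// ltr_wpDl.
  rewrite /ball/= ltr_pdivlMr ?ltr_wpDl// => xy.
  case: eqP => [_|/eqP yx]; first by rewrite subrr normr0.
  have yx0 : y - x != 0 by rewrite subr_eq0.
  have -> : d - (f y - f x) / (y - x) = - ((f y - f x - d * (y - x)) / (y - x)).
    by field.
  rewrite normrN normrM normfV ltr_pdivrMr ?normr_gt0//.
  apply: le_lt_trans (Hf y) _.
  have -> : (y - x) ^+ 2 = `|y - x| * `|y - x| by rewrite -expr2 real_normK// num_real.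
  rewrite mulrA ltr_pM2r ?normr_gt0//; apply: le_lt_trans xy.
  rewrite distrC mulrC ler_wpM2l//; have := ler_norm K; lra.
by [].
Qed.

Lemma sin_lip x y : `|sin x - sin y| <= `|x - y|.
Proof.
rewrite -[leRHS]mul1r; apply: (der_lip (f := sin) (df := cos)) => z.
  exact: is_derive_sin.
exact: cos_max.
Qed.

Lemma cos_lip x y : `|cos x - cos y| <= `|x - y|.
Proof.
rewrite -[leRHS]mul1r; apply: (der_lip (f := cos) (df := fun z => - sin z)) => z.
  exact: is_derive_cos.
by rewrite normrN; exact: sin_max.
Qed.

Lemma taylor1 f df x y : (forall z, has_deriv f z (df z)) ->
  (forall z w, `|df z - df w| <= `|z - w|) ->
  `|f y - f x - df x * (y - x)| <= (y - x) ^+ 2.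
Proof.
move=> Hf Hdf.
have D z : has_deriv (fun z => f z - df x * z) z (df z - df x).
by have Hz := Hf z; der; ring.
have E c : x <= c <= y \/ y <= c <= x -> `|c - x| <= `|y - x|.
  by move=> [] /andP[? ?]; case: (ger0P (c - x)); case: (ger0P (y - x)) => *; lra.
have -> : f y - f x - df x * (y - x) = (f y - df x * y) - (f x - df x * x) by ring.
have [c cxy ->] : exists2 c, x <= c <= y \/ y <= c <= x &
    (f y - df x * y) - (f x - df x * x) = (df c - df x) * (y - x).
  have [xy|/ltW xy] := leP x y; have [c cxy E'] := mvt xy (fun z _ => D z).
    by exists c; [left|].
  by exists c; [right|rewrite -opprB E' -mulrN opprB].
have -> : (y - x) ^+ 2 = `|y - x| * `|y - x|.
  by rewrite -expr2 real_normK// num_real.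
by rewrite normrM ler_wpM2r//; apply: le_trans (Hdf _ _) (E _ cxy).
Qed.

Lemma cos_taylor x y : `|cos y - cos x + sin x * (y - x)| <= (y - x) ^+ 2.
Proof.
have := @taylor1 cos (fun z => - sin z) x y _ _; rewrite mulNr opprK; apply.
  by move=> z; exact: is_derive_cos.
by move=> z w; rewrite -opprD normrN; exact: sin_lip.
Qed.

Lemma sin_taylor x y : `|sin y - sin x - cos x * (y - x)| <= (y - x) ^+ 2.
Proof. by apply: taylor1; [move=> z; exact: is_derive_sin|exact: cos_lip]. Qed.

Definition total h : R := prim h (2 * pi).

Lemma total_le h K : continuous h -> (forall z, `|h z| <= K) ->
  `|total h| <= K * (2 * pi).
Proof.
move=> hc hK; have := prim_le0 (2 * pi) hc hK.
by rewrite [`|2 * pi|]ger0_norm// mulr_ge0// pi_ge0.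
Qed.

Lemma total_add h k : continuous h -> continuous k ->
  total (fun x => h x + k x) = total h + total k.
Proof. exact: prim_add. Qed.

Lemma total_scale c h : continuous h -> total (fun x => c * h x) = c * total h.
Proof. exact: prim_scale. Qed.

Lemma total_antiderivative h F : continuous h ->
  (forall x, has_deriv F x (h x)) -> total h = F (2 * pi) - F 0.
Proof. by move=> hc HF; rewrite -(prim_unique 0 _ hc HF) prim0// subr0. Qed.

(** [prim h (x + pi) + prim h x] has derivative 0; its values at 0 and at [pi] are compared. *)
Lemma total_antiperiodic h : continuous h -> (forall x, h (x + pi) = - h x) ->
  total h = 0.
Proof.
move=> hc ha.
have H x : has_deriv (fun x => prim h (x + pi) + prim h x) x 0.
  apply: der_eq (der_add (der_comp (g := fun x => x + pi) (der_prim (x + pi) hc)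
    (der_add (der_id x) (der_cst pi x))) (der_prim x hc)) _.
  by rewrite ha; ring.
have := is_derive_0_is_cst pi 0 H; rewrite add0r prim0// addr0.
rewrite (_ : pi + pi = 2 * pi); last by ring.
by rewrite /total; lra.
Qed.

Lemma prim_periodic h : continuous h -> (forall x, h (x + 2 * pi) = h x) ->
  total h = 0 -> forall x, prim h (x + 2 * pi) = prim h x.
Proof.
move=> hc hp h0 x.
have H y : has_deriv (fun x => prim h (x + 2 * pi) - prim h x) y 0.
  apply: der_eq (der_sub (der_comp (g := fun x => x + 2 * pi) (der_prim (y + 2 * pi) hc)
    (der_add (der_id y) (der_cst _ y))) (der_prim y hc)) _.
  by rewrite hp; ring.
have := is_derive_0_is_cst x 0 H; rewrite add0r prim0// subr0.
by rewrite -/(total h) h0 => /eqP; rewrite subr_eq0 => /eqP.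
Qed.

Lemma total_param_der (k k' : R -> R -> R) a K :
  (forall b, continuous (k b)) -> continuous (k' a) ->
  (forall b x, `|k b x - k a x - k' a x * (b - a)| <= K * (b - a) ^+ 2) ->
  has_deriv (fun b => total (k b)) a (total (k' a)).
Proof.
move=> kc kc' H; apply: (@der_quad _ _ _ (K * (2 * pi))) => b.
have c1 : continuous (fun x => k b x - k a x).
  by move=> x; exact: continuousB (kc b x) (kc a x).
have c2 : continuous (fun x => (b - a) * k' a x).
  by move=> x; apply: continuousM (kc' x); exact: cst_continuous.
have -> : total (k b) - total (k a) - total (k' a) * (b - a) =
   total (fun x => (k b x - k a x) - (b - a) * k' a x).
  by rewrite /total prim_sub// prim_sub// prim_scale//; ring.
rewrite mulrAC; apply: total_le => [x|x]; first exact: continuousB (c1 x) (c2 x).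
by rewrite [(b - a) * _]mulrC; exact: H.
Qed.

End Averages.

(** * Bessel functions: nonvanishing of J1 at the zeros of J0, and infinitely many zeros *)

Section Bessel.
Context {R : realType}.
Implicit Types (f g h k F : R -> R) (x y z s t a b : R).

(** [bessel0] and [bessel1] are [2 pi J0] and [2 pi J1]. In contrast, [bessel2] is the derivative of
    [bessel1] and not [2 pi J2]. *)
Definition bessel0 a : R := total (fun x => cos (a * sin x)).
Definition bessel1 a : R := total (fun x => sin x * sin (a * sin x)).
Definition bessel2 a : R := total (fun x => sin x ^+ 2 * cos (a * sin x)).

Lemma bessel0_der a : has_deriv bessel0 a (- bessel1 a).
Proof.
have c : continuous (fun x => sin x * sin (a * sin x)) by cont.
have -> : - bessel1 a = total (fun x => -1 * (sin x * sin (a * sin x))).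
  by rewrite /total prim_scale// mulN1r.
apply: (@total_param_der _ (fun a x => cos (a * sin x))
  (fun a x => -1 * (sin x * sin (a * sin x))) a 1); first by move=> b; cont.
  by cont.
move=> b x; have := cos_taylor (a * sin x) (b * sin x).
have -> : (b * sin x - a * sin x) ^+ 2 = (b - a) ^+ 2 * sin x ^+ 2 by ring.
have s1 : sin x ^+ 2 <= 1 by rewrite sin2cos2; have := sqr_ge0 (cos x); lra.
rewrite (_ : _ - _ + _ = cos (b * sin x) - cos (a * sin x) -
  -1 * (sin x * sin (a * sin x)) * (b - a)); last by ring.
by move/le_trans; apply; rewrite mul1r ler_piMr// sqr_ge0.
Qed.

Lemma bessel1_der a : has_deriv bessel1 a (bessel2 a).
Proof.
apply: (@total_param_der _ (fun a x => sin x * sin (a * sin x))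
  (fun a x => sin x ^+ 2 * cos (a * sin x)) a 1); first by move=> b; cont.
  by cont.
move=> b x; have := sin_taylor (a * sin x) (b * sin x).
have -> : (b * sin x - a * sin x) ^+ 2 = (b - a) ^+ 2 * sin x ^+ 2 by ring.
have s1 : sin x ^+ 2 <= 1 by rewrite sin2cos2; have := sqr_ge0 (cos x); lra.
move=> H; have -> : sin x * sin (b * sin x) - sin x * sin (a * sin x) -
  sin x ^+ 2 * cos (a * sin x) * (b - a) =
  sin x * (sin (b * sin x) - sin (a * sin x) -
  cos (a * sin x) * (b * sin x - a * sin x)) by ring.
rewrite normrM mul1r; apply: le_trans (_ : 1 * ((b - a) ^+ 2 * sin x ^+ 2) <= _).
  by apply: ler_pM => //; exact: sin_max.
by rewrite mul1r ler_piMr// sqr_ge0.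
Qed.

(* The integrand of the difference of the two sides is the derivative of the
   periodic function [- cos x * sin (a * sin x)]. *)
Lemma bessel_ode a : bessel1 a + a * bessel2 a = a * bessel0 a.
Proof.
have c0 : continuous (fun x => cos (a * sin x)) by cont.
have c1 : continuous (fun x => sin x * sin (a * sin x)) by cont.
have c2 : continuous (fun x => sin x ^+ 2 * cos (a * sin x)) by cont.
have c3 : continuous (fun x => a * (sin x ^+ 2 * cos (a * sin x))) by cont.
have c4 : continuous (fun x => a * cos (a * sin x)) by cont.
apply/eqP; rewrite -subr_eq0; apply/eqP.
rewrite /bessel0 /bessel1 /bessel2 /total -!prim_scale// -prim_add// -prim_sub//;
  last by move=> x; exact: continuousD (c1 x) (c3 x).
have H (x : R) : has_deriv (fun x => - (cos x * sin (a * sin x))) x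
   (sin x * sin (a * sin x) + a * (sin x ^+ 2 * cos (a * sin x)) -
     a * cos (a * sin x)).
  by der; have := cos2sin2 x; move: (cos x) (sin x) => u v uv; ring: uv.
have c5 : continuous (fun x => sin x * sin (a * sin x) +
    a * (sin x ^+ 2 * cos (a * sin x)) - a * cos (a * sin x)) by cont.
have := total_antiderivative c5 H; rewrite /total => ->.
by rewrite -[2 * pi]add0r cos2piD sin2piD subrr.
Qed.

Lemma bessel0_0 : bessel0 0 = 2 * pi.
Proof.
rewrite /bessel0 (_ : (fun x => _) = fun=> 1); last first.
  by apply/funext => x; rewrite mul0r cos0.
rewrite (@total_antiderivative _ (fun=> 1) (fun x => x)) ?subr0//; first by cont.
by move=> x; exact: der_id.
Qed.

Lemma bessel1_le a : `|bessel1 a| <= 2 * pi.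
Proof.
rewrite -[leRHS]mul1r; apply: total_le; first by cont.
by move=> x; rewrite normrM -[leRHS]mulr1; apply: ler_pM => //; exact: sin_max.
Qed.

(** By [bessel_ode], [W x = x ^ 2 (J0 ^ 2 + J1 ^ 2)] has the derivative [2 x J0 ^ 2]. So it does not
    decrease for positive [x], is positive near 0, and cannot vanish at [a]. *)
Lemma bessel1_neq0 a : 0 < a -> bessel0 a = 0 -> bessel1 a != 0.
Proof.
move=> a0 J0; apply/eqP => J1.
pose W x := x ^+ 2 * (bessel0 x ^+ 2 + bessel1 x ^+ 2).
have DW x : has_deriv W x (2 * x * bessel0 x ^+ 2).
  have H0 := bessel0_der x; have H1 := bessel1_der x.
  rewrite /W; der; have := bessel_ode x.
  move: (bessel0 x) (bessel1 x) (bessel2 x) => u v w E.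
  have -> : 2 * x * u ^+ 2 = 2 * x * (u ^+ 2 + v ^+ 2) - 2 * x * v ^+ 2 by ring.
  have -> : v ^+ 2 = v * (x * u - x * w) by rewrite -E; ring.
  ring.
(* With [x <= 1 / 2], the bound [2 * pi] on [bessel1] leaves [bessel0 x] at least [2 * pi - pi]. *)
pose x := Num.min a (1 / 2).
have x0 : 0 < x by rewrite lt_min a0/=; lra.
have xa : x <= a by rewrite ge_min lexx.
have xh : x <= 1 / 2 by rewrite ge_min lexx orbT.
have : W x <= W a.
  apply: der_ge0_le xa (fun y _ => DW y) _ => y /andP[xy _].
  by rewrite mulr_ge0 ?sqr_ge0// mulr_ge0//; lra.
have : 0 < W x.
  rewrite /W mulr_gt0 ?exprn_gt0// ltr_pwDl ?sqr_ge0// exprn_gt0//.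
  have := @der_lip _ bessel0 (fun a => - bessel1 a) 0 x (2 * pi) bessel0_der.
  rewrite subr0 bessel0_0 [`|x|]gtr0_norm// => /(_ _) H.
  have /H : forall y, `|- bessel1 y| <= 2 * pi.
    by move=> y; rewrite normrN bessel1_le.
  have p0 := @pi_gt0 R; have : 2 * pi * x <= pi :> R.
    by rewrite mulrAC -[leRHS]mul1r ler_wpM2r ?pi_ge0//; lra.
  by rewrite ler_norml => ? /andP[? _]; lra.
by rewrite /W J0 J1 expr0n /= addr0 mulr0; lra.
Qed.

(* If [bessel0] kept a constant sign near infinity, [x * bessel1 x] would be
   monotone there by [bessel_ode]; whatever its sign, this is absurd. *)
Lemma bessel0_zero A : 0 < A -> exists2 a, A < a & bessel0 a = 0.
Proof.
move=> A0; apply: contrapT => nz.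
have {}nz a : A < a -> bessel0 a != 0.
  by move=> Aa; apply/eqP => a0; apply: nz; exists a.
pose a1 := A + 1.
have Aa1 : A < a1 by rewrite ltrDl.
pose c := Num.sg (bessel0 a1).
have c1 : c ^+ 2 = 1 by rewrite sqr_sg nz.
(* The sign [c] makes [f] positive at [a1], hence on the whole half-line. *)
pose f a := c * bessel0 a.
pose g a := c * (a * bessel1 a).
have Df a : has_deriv f a (- (c * bessel1 a)).
  by have H := bessel0_der a; rewrite /f; der; ring.
have Dg a : has_deriv g a (a * f a).
  have H := bessel1_der a; rewrite /g /f; der.
  by rewrite mul0r add0r mul1r bessel_ode; ring.
have fa1 : 0 < f a1 by rewrite /f /c -normrEsg normr_gt0 nz.
have fpos a : a1 <= a -> 0 < f a.
  move=> aa; rewrite ltNge; apply/negP => fa0.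
  have [||b bin fb] := @IVT _ f a1 a 0 aa.
  - apply: continuous_subspaceT => x; exact: der_continuous (Df x).
  - by rewrite ge_min fa0 orbT/= le_max (ltW fa1).
  - move: fb => /eqP; rewrite mulf_eq0 (negbTE (nz b _)) ?orbF.
      by move=> /eqP cE; move: c1; rewrite cE expr0n /= => /eqP; rewrite eq_sym oner_eq0.
    by apply: lt_le_trans Aa1 _; rewrite (itvP bin).
have [[a2 [a12 ga2]]|/forallNP gneg] := pselect (exists a2, a1 <= a2 /\ 0 < g a2).
- have gle a : a2 <= a -> g a2 <= g a.
    move=> aa; apply: der_ge0_le aa (fun y _ => Dg y) _ => y /andP[ay _].
    by apply: mulr_ge0; [lra|apply/ltW/fpos; lra].
  (* In the logarithmic variable the derivative of [f] is [- g]. As [g] stays above [g a2], [f]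
     would drop to 0 within the time [T = f a2 / g a2]. *)
  pose phi t := f (a2 * expR t).
  have Dphi t : has_deriv phi t (- g (a2 * expR t)).
    have H : has_deriv (fun t => a2 * expR t) t (a2 * expR t).
      have He := is_derive_expR t; rewrite -/(has_deriv _ _ _) in He.
      by der; ring.
    by apply: der_eq (der_comp (Df _) H) _; rewrite /g; ring.
  pose T := f a2 / g a2.
  have T0 : 0 <= T by rewrite divr_ge0 ?ltW// fpos.
  have [t /andP[t0 _]] := mvt T0 (fun t _ => Dphi t).
  rewrite {2}/phi expR0 mulr1 subr0 => E.
  have eT u : 0 <= u -> a2 <= a2 * expR u.
    move=> u0; rewrite ler_peMr//; first by lra.
    by rewrite -expR0 ler_expR.
  have : 0 < phi T by apply: fpos; apply: le_trans (eT _ T0).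
  have : g a2 * T <= g (a2 * expR t) * T by rewrite ler_wpM2r// gle// eT.
  have -> : g a2 * T = f a2 by rewrite /T mulrC divfK// gt_eqF.
  by rewrite mulNr in E; lra.
- have {}gneg a : a1 <= a -> g a <= 0.
    by move=> aa; rewrite leNgt; apply/negP => ga; exact: (gneg a).
  have fle a : a1 <= a -> f a1 <= f a.
    move=> aa; apply: der_ge0_le aa (fun y _ => Df y) _ => y /andP[ay _].
    have y0 : 0 < y by lra.
    rewrite oppr_ge0 -(pmulr_rle0 _ y0); apply: le_trans (gneg _ ay).
    by rewrite /g mulrCA.
  (* [g] grows at least at the rate [a1 * f a1], so this [b] would give [g b >= 1]. *)
  pose b := a1 + (1 - g a1) / (a1 * f a1).
  have d0 : 0 < a1 * f a1 by rewrite mulr_gt0//; lra.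
  have ab : a1 <= b.
    by rewrite lerDl divr_ge0 ?(ltW d0)// subr_ge0 (le_trans (gneg _ (lexx _))).
  have [t /andP[t0 _] E] := mvt ab (fun t _ => Dg t).
  have : a1 * f a1 * (b - a1) <= t * f t * (b - a1).
    rewrite ler_wpM2r ?subr_ge0// ler_pM ?fle// ?(ltW fa1)//; lra.
  rewrite -E {1}/b addrAC subrr add0r mulrC divfK ?gt_eqF//.
  by have := gneg _ ab; lra.
Qed.

(** Zeros above 2 keep the perturbed amplitudes above 1, and gaps above 1 keep them apart. *)
Lemma bessel0_zeros : exists a : nat -> R,
  [/\ forall i, 2 < a i, forall i, a i + 1 < a i.+1 & forall i, bessel0 (a i) = 0].
Proof.
have /choice[nxt Hn] : forall A, exists b, 0 < A -> A + 1 < b /\ bessel0 b = 0.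
  move=> A; have [A0|A0] := ltP 0 A; last by exists 0.
  by have [|b] := @bessel0_zero (A + 1); [rewrite addr_gt0|exists b].
pose a i := iter i.+1 nxt 2.
have pos i : 2 < a i.
  elim: i => [|i IH]; first by have [|H _] := Hn 2; [|move: H; rewrite /a /=; lra].
  by have [|H _] := Hn (a i); [lra|move: H IH; rewrite /a /=; lra].
exists a; split=> // i; first by case: (Hn (a i)) => //; have := pos i; lra.
case: i => [|i]; first by case: (Hn 2).
by case: (Hn (a i)) => //; have := pos i; lra.
Qed.

End Bessel.

(** * Attracting periodic solutions of the slow system *)

Section Sequences.
Context {R : realType}.

(** This passes inequalities and equations from the iterates of a geometrically convergent scheme to
    the limit. *)
Lemma le_half_powers (u v C : R) :
  (forall n, u <= v + C / 2 ^+ n) -> u <= v.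
Proof.
move=> H; rewrite leNgt; apply/negP => vu.
have uv : 0 < u - v by rewrite subr_gt0.
have [n] : exists n : nat, `|C| / (u - v) < n%:R.
  exists (Num.truncn (`|C| / (u - v))).+1.
  by rewrite -truncn_lt_nat// divr_ge0// ltW.
rewrite ltr_pdivrMr// => Cn.
have n2 : n%:R <= 2 ^+ n :> R by rewrite -natrX ler_nat ltnW// ltn_expl.
have p2 : 0 < 2 ^+ n :> R by rewrite exprn_gt0.
have := H n; rewrite -lerBlDl ler_pdivlMr// => H1.
have : n%:R * (u - v) <= 2 ^+ n * (u - v) by rewrite ler_wpM2r// ltW.
have := ler_norm C; rewrite [(u - v) * _]mulrC in H1; lra.
Qed.

(** The sequence [u n - 2 C / 2 ^ n] increases and [u n + 2 C / 2 ^ n] decreases; the limit is the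
    supremum of the first one. *)
Lemma geometric_limit (u : nat -> R) (C : R) :
  (forall n, `|u n.+1 - u n| <= C / 2 ^+ n) ->
  exists l, forall n, `|l - u n| <= 2 * C / 2 ^+ n.
Proof.
move=> Hu.
pose v n := u n - 2 * C / 2 ^+ n; pose w n := u n + 2 * C / 2 ^+ n.
have half n : 2 * C / 2 ^+ n.+1 = C / 2 ^+ n.
  by rewrite exprS; field; rewrite expf_neq0.
have vS n : v n <= v n.+1.
  by have := Hu n; rewrite /v half ler_norml => /andP[]; lra.
have wS n : w n.+1 <= w n.
  by have := Hu n; rewrite /w half ler_norml => /andP[]; lra.
have C0 n : 0 <= C / 2 ^+ n by apply: le_trans (Hu n).
have vw m n : v m <= w n.
  have mono i j : (i <= j)%N -> v i <= v j.
    by move/subnK <-; elim: (j - i)%N => // k /le_trans; apply; rewrite addSn.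
  have monow i j : (i <= j)%N -> w j <= w i.
    move/subnK <-; elim: (j - i)%N => // k; apply: le_trans; exact: wS.
  apply: le_trans (mono _ _ (leq_maxl m n)) _.
  apply: le_trans _ (monow _ _ (leq_maxr m n)).
  by rewrite /v /w; have := C0 (maxn m n); lra.
exists (sup (range v)) => n; rewrite ler_norml; apply/andP; split.
  have : v n <= sup (range v).
    apply: ub_le_sup; last by exists n.
    by exists (w 0) => _ [m _ <-].
  by rewrite /v; lra.
have : sup (range v) <= w n by apply: ge_sup => [|_ [m _ <-]//]; exists (v 0), 0.
by rewrite /w; lra.
Qed.

Lemma periodic_int (f : R -> R) p (z : int) x :
  (forall x, f (x + p) = f x) -> f (x + p *~ z) = f x.
Proof.
move=> fp; have fn (n : nat) y : f (y + p *+ n) = f y.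
  by elim: n => [|n IH]; rewrite ?mulr0n ?addr0// mulrSr addrA fp.
case: z => n; first exact: fn.
by rewrite NegzE mulrNz -(fn n.+1 (x - _)) subrK.
Qed.

Lemma period_reduce (p x : R) : 0 < p -> exists2 y, 0 <= y <= p &
  forall f : R -> R, (forall x, f (x + p) = f x) -> f x = f y.
Proof.
move=> p0; exists (x - p *~ Num.floor (x / p)); last first.
  by move=> f fp; rewrite -[in RHS]mulrNz periodic_int.
have /andP[h1 h2] := floor_itv (x / p).
move: h1 h2; rewrite ler_pdivlMr// ltr_pdivrMr// intrD mulrDl mul1r -mulrzl.
by move=> *; apply/andP; split; lra.
Qed.

End Sequences.

(** * The slow field near a zero of its average *)

Section SlowField.
Context {R : realType}.
Implicit Types (a b x eta : R).

Definition slow a b x : R := a * cos (b + a * sin x).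

Variables (a0 b0 : R).
Hypothesis a00 : 0 < a0.

Let A0 x := b0 + a0 * sin x.
Definition slow_da x := cos (b0 + a0 * sin x) - a0 * sin x * sin (b0 + a0 * sin x).
Definition slow_db x := - a0 * sin (b0 + a0 * sin x).

Lemma slow_da_le x : `|slow_da x| <= 1 + a0.
Proof.
apply: le_trans (ler_normB _ _) _; apply: lerD; first exact: cos_max.
rewrite !normrM (gtr0_norm a00) -mulrA ler_piMr ?(ltW a00)//.
by rewrite -[leRHS]mulr1; apply: ler_pM => //; exact: sin_max.
Qed.

Lemma slow_db_le x : `|slow_db x| <= 1 + a0.
Proof.
rewrite normrM normrN (gtr0_norm a00); have := sin_max (b0 + a0 * sin x).
move/(ler_wpM2l (ltW a00)); lra.
Qed.

Lemma slow_da_continuous : continuous slow_da.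
Proof. by cont. Qed.

Lemma slow_db_continuous : continuous slow_db.
Proof. by cont. Qed.

(** The mean value theorem on the segment from [(a', b')] to [(a, b)] gives the gradient at an
    intermediate point. Replacing it by the gradient at [(a0, b0)] costs [2 * eta] in the cosine and
    [(1 + 2 * a0) * eta] in the sine term, whence the constant. *)
Lemma slow_linearize eta a b a' b' x :
  `|a - a0| + `|b - b0| <= eta -> `|a' - a0| + `|b' - b0| <= eta ->
  `|slow a b x - slow a' b' x - slow_da x * (a - a') - slow_db x * (b - b')|
    <= (3 + 2 * a0) * eta * (`|a - a'| + `|b - b'|).
Proof.
move=> H H'; have eta0 : 0 <= eta by apply: le_trans H; rewrite addr_ge0.
set S := sin x; have S1 : `|S| <= 1 by exact: sin_max.
pose at_ s := a' + s * (a - a'); pose bt s := b' + s * (b - b').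
pose At s := bt s + at_ s * S.
have D s : has_deriv (fun s => at_ s * cos (At s)) s
    ((a - a') * cos (At s) - at_ s * sin (At s) * ((b - b') + (a - a') * S)).
  by rewrite /At /at_ /bt; der; ring.
have [s /andP[s0 s1]] := mvt ler01 (fun s _ => D s).
have [ea1 ea0] : at_ 1 = a /\ at_ 0 = a' by rewrite /at_; split; ring.
have [eb1 eb0] : bt 1 = b /\ bt 0 = b' by rewrite /bt; split; ring.
rewrite {1 2}/At ea1 ea0 eb1 eb0 subr0 mulr1 -!/(slow _ _ x) => ->.
have near_a : `|at_ s - a0| <= eta.
  have -> : at_ s - a0 = s * (a - a0) + (1 - s) * (a' - a0) by rewrite /at_; ring.
  apply: le_trans (ler_normD _ _) _; rewrite !normrM.
  rewrite (ger0_norm s0) [`|1 - s|]ger0_norm ?subr_ge0//.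
  have -> : eta = s * eta + (1 - s) * eta by ring.
  by apply: lerD; apply: ler_wpM2l => //; try lra;
    have := normr_ge0 (b - b0); have := normr_ge0 (b' - b0); lra.
have near_b : `|bt s - b0| <= eta.
  have -> : bt s - b0 = s * (b - b0) + (1 - s) * (b' - b0) by rewrite /bt; ring.
  apply: le_trans (ler_normD _ _) _; rewrite !normrM.
  rewrite (ger0_norm s0) [`|1 - s|]ger0_norm ?subr_ge0//.
  have -> : eta = s * eta + (1 - s) * eta by ring.
  by apply: lerD; apply: ler_wpM2l => //; try lra;
    have := normr_ge0 (a - a0); have := normr_ge0 (a' - a0); lra.
have near_A : `|At s - A0 x| <= 2 * eta.
  have -> : At s - A0 x = (bt s - b0) + (at_ s - a0) * S by rewrite /At /A0 /S; ring.
  apply: le_trans (ler_normD _ _) _; rewrite normrM.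
  have : `|at_ s - a0| * `|S| <= eta * 1 by apply: ler_pM.
  lra.
rewrite /slow_da /slow_db -/(A0 x) -/S.
set X := (X in `|X| <= _).
have -> : X = (cos (At s) - cos (A0 x)) * (a - a') -
   (at_ s * sin (At s) - a0 * sin (A0 x)) * ((b - b') + (a - a') * S).
  by rewrite /X; ring.
have c1 : `|cos (At s) - cos (A0 x)| <= 2 * eta := le_trans (cos_lip _ _) near_A.
have c2 : `|at_ s * sin (At s) - a0 * sin (A0 x)| <= (1 + 2 * a0) * eta.
  have -> : at_ s * sin (At s) - a0 * sin (A0 x) =
    (at_ s - a0) * sin (At s) + a0 * (sin (At s) - sin (A0 x)) by ring.
  apply: le_trans (ler_normD _ _) _; rewrite !normrM (gtr0_norm a00).
  have : `|at_ s - a0| * `|sin (At s)| <= eta * 1.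
    by apply: ler_pM => //; exact: sin_max.
  have := ler_wpM2l (ltW a00) (le_trans (sin_lip _ _) near_A); lra.
have c3 : `|(b - b') + (a - a') * S| <= `|a - a'| + `|b - b'|.
  apply: le_trans (ler_normD _ _) _; rewrite addrC lerD2r normrM.
  by rewrite ler_piMr.
apply: le_trans (ler_normB _ _) _; rewrite !normrM.
have N0 : `|a - a'| <= `|a - a'| + `|b - b'| by rewrite lerDl.
have := ler_pM (normr_ge0 _) (normr_ge0 _) c1 N0.
have := ler_pM (normr_ge0 _) (normr_ge0 _) c2 c3.
set u := `|cos _ - _| * _; set v := `|_ - a0 * _| * _; lra.
Qed.

Lemma slow_lip eta a b a' b' x :
  `|a - a0| + `|b - b0| <= eta -> `|a' - a0| + `|b' - b0| <= eta ->
  `|slow a b x - slow a' b' x| <=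
    (1 + a0 + (3 + 2 * a0) * eta) * (`|a - a'| + `|b - b'|).
Proof.
move=> H H'; have := slow_linearize x H H'; set X := (X in `|X| <= _) => HX.
have -> : slow a b x - slow a' b' x = X + (slow_da x * (a - a') + slow_db x * (b - b')).
  by rewrite /X; ring.
rewrite [X + _]addrC; apply: le_trans (ler_normD _ _) _.
rewrite [(1 + a0 + _) * _]mulrDl.
apply: (lerD _ HX); apply: le_trans (ler_normD _ _) _; rewrite !normrM mulrDr.
by apply: lerD; apply: ler_wpM2r => //; rewrite -?normrM; [exact: slow_da_le|exact: slow_db_le].
Qed.

Lemma slow_le eta a b x : `|a - a0| + `|b - b0| <= eta -> `|slow a b x| <= a0 + eta.
Proof.
move=> H; rewrite normrM; have := cos_max (b + a * sin x).
have : `|a| <= a0 + eta.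
  have := ler_normD (a - a0) a0; rewrite subrK (gtr0_norm a00).
  by have := normr_ge0 (b - b0); lra.
by move=> *; rewrite -[leRHS]mulr1; apply: ler_pM.
Qed.

Lemma slow_continuous (a b : R -> R) : continuous a -> continuous b ->
  continuous (fun x => slow (a x) (b x) x).
Proof.
move=> ca cb x; apply: (@continuousM _ _ a (fun x => cos (b x + a x * sin x))).
  exact: ca.
apply: (@continuous_comp _ _ _ (fun x => b x + a x * sin x) cos).
  apply: (@continuousD _ _ _ b (fun x => a x * sin x)); first exact: cb.
  by apply: (@continuousM _ _ a sin); [exact: ca|exact: continuous_sin].
exact: continuous_cos.
Qed.

Hypotheses (sb0 : sin b0 = 0) (J0 : bessel0 a0 = 0).
Let m := a0 * cos b0 * bessel1 a0.

(** This and the next three lemmas integrate the Jacobian of the slow field over a period: the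
    result is [- m] times the identity. The diagonal reduces to [bessel1] since [sin b0] and
    [bessel0 a0] vanish; the other entries vanish because their integrands change sign under a shift
    by [pi]. *)
Lemma slow_da_total : total slow_da = - m.
Proof.
have c1 : continuous (fun x => cos (a0 * sin x)) by cont.
have c2 : continuous (fun x => sin x * sin (a0 * sin x)) by cont.
have -> : slow_da = fun x => cos b0 * cos (a0 * sin x) -
    a0 * cos b0 * (sin x * sin (a0 * sin x)).
  by apply/funext => x; rewrite /slow_da cosD sinD sb0; ring.
rewrite /total prim_sub ?prim_scale//; [|by cont|by cont].
by rewrite -/(total _) -/(bessel0 a0) J0 mulr0 sub0r.
Qed.

Lemma sin_slow_db_total : total (fun x => sin x * slow_db x) = - m.
Proof.
have c2 : continuous (fun x => sin x * sin (a0 * sin x)) by cont.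
have -> : (fun x => sin x * slow_db x) =
    fun x => (- (a0 * cos b0)) * (sin x * sin (a0 * sin x)).
  by apply/funext => x; rewrite /slow_db sinD sb0; ring.
by rewrite /total prim_scale// mulNr.
Qed.

Lemma slow_db_total : total slow_db = 0.
Proof.
apply: total_antiperiodic slow_db_continuous _ => x.
by rewrite /slow_db sinDpi (mulrN a0) !sinD cosN sinN sb0; ring.
Qed.

Lemma sin_slow_da_total : total (fun x => sin x * slow_da x) = 0.
Proof.
apply: total_antiperiodic => [|x]; first by cont.
by rewrite /slow_da sinDpi !(mulrN a0) !sinD !cosD cosN sinN sb0; ring.
Qed.

Lemma slow_total : total (slow a0 b0) = 0.
Proof.
have c1 : continuous (fun x => cos (a0 * sin x)) by cont.
have -> : slow a0 b0 = fun x => (a0 * cos b0) * cos (a0 * sin x).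
  by apply/funext => x; rewrite /slow cosD sb0; ring.
by rewrite /total prim_scale// -/(total _) -/(bessel0 a0) J0 mulr0.
Qed.

Lemma sin_slow_total : total (fun x => sin x * slow a0 b0 x) = 0.
Proof.
apply: total_antiperiodic => [|x]; first by cont.
by rewrite /slow sinDpi (mulrN a0) !cosD cosN sinN sb0; ring.
Qed.

End SlowField.

(** * Periodic solutions of the slow system by a Newton-like iteration *)

Section PeriodicSolution.
Context {R : realType}.
Implicit Types (a b x eta eps e : R) (h k : R -> R).

Section Operator.
Variables (m eps : R).
Hypothesis eps0 : 0 <= eps.

(* A Newton step for the mean of [h], corrected by [eps] times the periodic part
   of the antiderivative of [h]. *)
Definition corr h x : R := total h / m + eps * (prim h x - x / (2 * pi) * total h).

Lemma corr_sub h k x : continuous h -> continuous k ->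
  corr h x - corr k x = corr (fun y => h y - k y) x.
Proof. by move=> hc kc; rewrite /corr /total !prim_sub//; ring. Qed.

Lemma corr_0 h : continuous h -> corr h 0 = total h / m.
Proof. by move=> hc; rewrite /corr prim0//; ring. Qed.

(** The derivative is [eps] times the mean-free part of [h]: when [total h = 0], a constant plus
    [corr h] has the derivative [eps * h]. *)
Lemma corr_der h x : continuous h ->
  has_deriv (corr h) x (eps * (h x - total h / (2 * pi))).
Proof.
move=> hc; have H := der_prim x hc; rewrite /corr.
have -> : (fun x => total h / m + eps * (prim h x - x / (2 * pi) * total h)) =
  (fun x => total h / m + eps * (prim h x - x * ((2 * pi)^-1 * total h))).
  by apply/funext => y; ring.
by der; ring.
Qed.

Lemma corr_periodic h x : continuous h -> (forall x, h (x + 2 * pi) = h x) ->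
  corr h (x + 2 * pi) = corr h x.
Proof.
move=> hc hp.
have p0 : 2 * pi != 0 :> R by rewrite mulf_neq0// ?gt_eqF// pi_gt0.
pose c := total h / (2 * pi).
have cc : continuous (fun y => h y - c).
  by move=> y; apply: continuousB (hc y) _; exact: cst_continuous.
have Ec y : prim (fun y => h y - c) y = prim h y - y / (2 * pi) * total h.
  rewrite prim_sub//; last by move=> z; exact: cst_continuous.
  have := @prim_unique _ (fun=> c) (fun y => y * c) 0 y _ _.
  rewrite prim0 ?subr0 ?mul0r; last by move=> z; exact: cst_continuous.
  move=> ->; first by rewrite /c; ring.
    by move=> z; exact: cst_continuous.
  by move=> z; der; ring.
rewrite /corr -!Ec prim_periodic//; first by move=> y; rewrite hp.
by rewrite /total Ec divff// mul1r subrr.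
Qed.

(** By periodicity [x] may be taken in [[0, 2 pi]], where the primitive and the mean part are each
    at most [2 pi c]. *)
Lemma corr_var h c x : continuous h -> (forall x, h (x + 2 * pi) = h x) ->
  (forall y, `|h y| <= c) -> `|corr h x - corr h 0| <= eps * (4 * pi * c).
Proof.
move=> hc hp hc'; have p0 : 0 < 2 * pi :> R by rewrite mulr_gt0// pi_gt0.
have [y /andP[y0 yp] E] := period_reduce x p0.
rewrite (E (corr h)); last by move=> z; rewrite corr_periodic.
rewrite corr_0// /corr addrAC subrr add0r normrM (ger0_norm eps0).
apply: ler_wpM2l => //; apply: le_trans (ler_normB _ _) _.
have c0 : 0 <= c by apply: le_trans (hc' 0).
have := prim_le0 y hc hc'; rewrite (ger0_norm y0) => H1.
have H2 := total_le hc hc'.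
have H3 : `|y / (2 * pi) * total h| <= `|total h|.
  rewrite normrM ler_piMl// ger0_norm ?divr_ge0// ?(ltW p0)//.
  by rewrite ler_pdivrMr// mul1r.
have H4 : c * y <= c * (2 * pi) by apply: ler_wpM2l.
by lra.
Qed.

End Operator.

Section Iteration.
Variables (a0 b0 : R).
Hypotheses (a00 : 0 < a0) (sb0 : sin b0 = 0) (J0 : bessel0 a0 = 0).
Let m := a0 * cos b0 * bessel1 a0.
Hypothesis m0 : 0 < m.

Variables (eta eps s : R).
Hypotheses (eta0 : 0 < eta) (eps0 : 0 < eps) (s0 : 0 < s) (s1 : s <= 1).
Let w := (3 + 2 * a0) * eta.
Let Lp := 1 + a0.
Hypotheses (small_w : w * (32 * pi) <= m) (small_s : s * (16 * pi * Lp) <= m)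
  (small_eps : eps * (32 * pi * (Lp + w)) <= s)
  (small_eps0 : eps * (64 * pi * a0) <= s * eta).

Let curve : Type := (R -> R) * (R -> R).
Let Ga (y : curve) x := slow (y.1 x) (y.2 x) x.
Let Gb (y : curve) x := sin x * Ga y x.
(** Evaluation at 0 shows that a fixed curve has both totals zero; by [corr_der] it then solves the
    slow system. *)
Let T (y : curve) : curve :=
  (fun x => y.1 0 + corr m eps (Ga y) x, fun x => y.2 0 + corr m eps (Gb y) x).

Let good (y : curve) :=
  [/\ continuous y.1, continuous y.2,
      forall x, y.1 (x + 2 * pi) = y.1 x, forall x, y.2 (x + 2 * pi) = y.2 x &
      forall x, `|y.1 x - a0| + `|y.2 x - b0| <= eta].

(** A weighted norm: [e] bounds the difference of the initial values and [s * e] that of the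
    oscillating parts. In the Newton step the oscillating parts enter with a factor of order
    [Lp / m], which a small [s] compensates; the oscillation produced by [corr] is of order [eps],
    and [small_eps] keeps it below the weight. *)
Let close (y y' : curve) (e : R) :=
  `|y.1 0 - y'.1 0| + `|y.2 0 - y'.2 0| <= e /\
  forall x, `|(y.1 x - y'.1 x) - (y.1 0 - y'.1 0)| +
            `|(y.2 x - y'.2 x) - (y.2 0 - y'.2 0)| <= s * e.

Let Ga_cont y : good y -> continuous (Ga y).
Proof. by case=> c1 c2 _ _ _; exact: slow_continuous. Qed.

Let Gb_cont y : good y -> continuous (Gb y).
Proof.
move=> gy x; apply: (@continuousM _ _ sin (Ga y)); first exact: continuous_sin.
exact: Ga_cont.
Qed.

Let Ga_per y : good y -> forall x, Ga y (x + 2 * pi) = Ga y x.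
Proof. by case=> _ _ p1 p2 _ x; rewrite /Ga /slow p1 p2 sin2piD. Qed.

Let Gb_per y : good y -> forall x, Gb y (x + 2 * pi) = Gb y x.
Proof. by move=> gy x; rewrite /Gb sin2piD Ga_per. Qed.

Let step y y' e : good y -> good y' -> close y y' e -> close (T y) (T y') (e / 2).
Proof.
move=> gy gy' [H0 Hs].
have e0 : 0 <= e by apply: le_trans H0; rewrite addr_ge0.
have p0 : 0 < (pi : R) by exact: pi_gt0.
have w0 : 0 < w by rewrite mulr_gt0// addr_gt0// mulr_gt0.
have L0 : 0 < Lp by rewrite addr_gt0.
pose da := y.1 0 - y'.1 0; pose db := y.2 0 - y'.2 0.
have N x : `|y.1 x - y'.1 x| + `|y.2 x - y'.2 x| <= (1 + s) * e.
  have := Hs x; have := ler_normD (y.1 x - y'.1 x - da) da.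
  have := ler_normD (y.2 x - y'.2 x - db) db.
  by rewrite !subrK; rewrite -/da -/db in H0 *; lra.
have [c1 c2] := (Ga_cont gy, Ga_cont gy').
have [c3 c4] := (Gb_cont gy, Gb_cont gy').
have pa_c : continuous (slow_da a0 b0) := @slow_da_continuous _ a0 b0.
have pb_c : continuous (slow_db a0 b0) := @slow_db_continuous _ a0 b0.
pose D x := Ga y x - Ga y' x.
have Dc : continuous D by move=> x; exact: continuousB (c1 x) (c2 x).
have D_le x : `|D x| <= (Lp + w) * ((1 + s) * e).
  have [_ _ _ _ B] := gy; have [_ _ _ _ B'] := gy'.
  apply: le_trans (slow_lip a00 x (B x) (B' x)) _.
  by apply: ler_wpM2l (N x); rewrite addr_ge0 ?ltW.
pose E x := D x - slow_da a0 b0 x * da - slow_db a0 b0 x * db.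
have E_le x : `|E x| <= w * ((1 + s) * e) + Lp * (s * e).
  have [_ _ _ _ B] := gy; have [_ _ _ _ B'] := gy'.
  have -> : E x = (D x - slow_da a0 b0 x * (y.1 x - y'.1 x) -
      slow_db a0 b0 x * (y.2 x - y'.2 x)) +
      (slow_da a0 b0 x * (y.1 x - y'.1 x - da) +
       slow_db a0 b0 x * (y.2 x - y'.2 x - db)) by rewrite /E; ring.
  apply: le_trans (ler_normD _ _) _; apply: lerD.
    apply: le_trans (slow_linearize a00 x (B x) (B' x)) _.
    by apply: ler_wpM2l (N x); exact: ltW.
  apply: le_trans (ler_normD _ _) _; rewrite !normrM.
  apply: le_trans (_ : Lp * (`|y.1 x - y'.1 x - da| + `|y.2 x - y'.2 x - db|) <= _).
    rewrite mulrDr; apply: lerD; apply: ler_wpM2r => //; rewrite -?normrM.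
      exact: slow_da_le.
    exact: (slow_db_le b0 a00).
  by apply: ler_wpM2l (Hs x); exact: ltW.
have half : (w * ((1 + s) * e) + Lp * (s * e)) * (2 * pi) / m <= e / 4.
  rewrite ler_pdivrMr//.
  have : w * (32 * pi) * ((1 + s) * e) <= m * (2 * e).
    apply: ler_pM => //.
    - by apply: mulr_ge0; [exact: ltW|rewrite mulr_ge0// ltW].
    - by rewrite mulr_ge0// addr_ge0// ltW.
    - by rewrite ler_wpM2r//; move: s1; lra.
  have : s * (16 * pi * Lp) * e <= m * e by apply: ler_wpM2r.
  lra.
have Ec : continuous E.
  move=> x; apply: (@continuousB _ _ _ (fun x => D x - slow_da a0 b0 x * da)
    (fun x => slow_db a0 b0 x * db)).
    apply: (@continuousB _ _ _ D (fun x => slow_da a0 b0 x * da)); first exact: Dc.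
    by apply: (@continuousM _ _ (slow_da a0 b0) (fun=> da)); [exact: pa_c|exact: cst_continuous].
  by apply: (@continuousM _ _ (slow_db a0 b0) (fun=> db)); [exact: pb_c|exact: cst_continuous].
have Sc : continuous (@sin R) by exact: continuous_sin.
have SEc : continuous (fun x => sin x * E x) by move=> x; exact: continuousM (Sc x) (Ec x).
have SDc : continuous (fun x => sin x * D x) by move=> x; exact: continuousM (Sc x) (Dc x).
have Sa : continuous (fun x => sin x * slow_da a0 b0 x).
  by move=> x; exact: continuousM (Sc x) (pa_c x).
have Sb : continuous (fun x => sin x * slow_db a0 b0 x).
  by move=> x; exact: continuousM (Sc x) (pb_c x).
have scal (k : R -> R) c : continuous k -> continuous (fun x => c * k x).
  by move=> kc x; apply: continuousM (kc x); exact: cst_continuous.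
(* As the averaged Jacobian is [- m] times the identity, the term [total D / m] of [corr] cancels
   [da] and leaves [total E / m], which is at most [e / 4]. *)
have tD : total D = total E - m * da.
  have -> : D = fun x => E x + (da * slow_da a0 b0 x + db * slow_db a0 b0 x).
    by apply/funext => x; rewrite /E; ring.
  have sc : continuous (fun x => da * slow_da a0 b0 x + db * slow_db a0 b0 x).
    by move=> x; exact: continuousD (scal _ da pa_c x) (scal _ db pb_c x).
  rewrite (total_add Ec sc) (total_add (scal _ da pa_c) (scal _ db pb_c)).
  by rewrite (total_scale da pa_c) (total_scale db pb_c) slow_da_total// slow_db_total// -/m; ring.
have tSD : total (fun x => sin x * D x) = total (fun x => sin x * E x) - m * db.
  have -> : (fun x => sin x * D x) = fun x => sin x * E x +
      (da * (sin x * slow_da a0 b0 x) + db * (sin x * slow_db a0 b0 x)).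
    by apply/funext => x; rewrite /E; ring.
  have sc : continuous (fun x => da * (sin x * slow_da a0 b0 x) +
      db * (sin x * slow_db a0 b0 x)).
    by move=> x; exact: continuousD (scal _ da Sa x) (scal _ db Sb x).
  rewrite (total_add SEc sc) (total_add (scal _ da Sa) (scal _ db Sb)).
  by rewrite (total_scale da Sa) (total_scale db Sb) sin_slow_da_total// sin_slow_db_total// -/m; ring.
have SD_E x : sin x * D x = Gb y x - Gb y' x by rewrite /D /Gb; ring.
have TaE x : (T y).1 x - (T y').1 x = da + corr m eps D x.
  by rewrite /T/= -corr_sub//; rewrite /da; ring.
have TbE x : (T y).2 x - (T y').2 x = db + corr m eps (fun x => sin x * D x) x.
  have -> : (fun x => sin x * D x) = fun x => Gb y x - Gb y' x by apply/funext.
  by rewrite /T/= -corr_sub//; rewrite /db; ring.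
have Sle (k : R -> R) c : (forall x, `|k x| <= c) -> forall x, `|sin x * k x| <= c.
  move=> kc x; rewrite normrM; apply: le_trans (kc x).
  by rewrite ler_piMl// sin_max.
have half' (k : R -> R) : continuous k ->
    (forall x, `|k x| <= w * ((1 + s) * e) + Lp * (s * e)) -> `|total k / m| <= e / 4.
  move=> kc /(total_le kc) kle; rewrite normrM normfV (gtr0_norm m0).
  by apply: le_trans half; rewrite ler_wpM2r// invr_ge0 ltW.
split=> [|x]; rewrite !TaE !TbE.
  rewrite !corr_0// tD tSD.
  have -> : da + (total E - m * da) / m = total E / m by field; rewrite gt_eqF.
  set tS := total (fun x => sin x * E x).
  have -> : db + (tS - m * db) / m = tS / m by field; rewrite gt_eqF.
  have := half' _ Ec E_le; have := half' _ SEc (Sle _ _ E_le).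
  by rewrite -/tS; lra.
have ea (c u v : R) : c + u - (c + v) = u - v by ring.
rewrite !(ea da) !(ea db).
have Dp z : D (z + 2 * pi) = D z by rewrite /D !Ga_per.
have SDp z : sin (z + 2 * pi) * D (z + 2 * pi) = sin z * D z by rewrite Dp sin2piD.
have := corr_var m (ltW eps0) x Dc Dp D_le.
have := corr_var m (ltW eps0) x SDc SDp (Sle _ _ D_le).
have : eps * (4 * pi * ((Lp + w) * ((1 + s) * e))) <= s * (e / 4).
  have : eps * (32 * pi * (Lp + w)) * ((1 + s) * e) <= s * (2 * e).
    apply: ler_pM => //.
    - apply: mulr_ge0; first exact: ltW.
      by apply: mulr_ge0; [rewrite mulr_ge0// ltW|rewrite addr_ge0// ltW].
    - by rewrite mulr_ge0// addr_ge0// ltW.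
    - by rewrite ler_wpM2r//; move: s1; lra.
  lra.
lra.
Qed.

Let y0 : curve := (fun=> a0, fun=> b0).
Let Y n := iter n T y0.

Let good0 : good y0.
Proof.
split=> //=; try exact: cst_continuous.
by move=> x; rewrite !subrr normr0 addr0 ltW.
Qed.

(** The averages of the slow field vanish at [(a0, b0)], so the first step changes the constant
    curve only by an oscillation of order [eps]. *)
Let close01 : close y0 (T y0) (eta / 8).
Proof.
have E1 : Ga y0 = slow a0 b0 by [].
have E2 : Gb y0 = fun x => sin x * slow a0 b0 x by [].
have c1 := Ga_cont good0; have c2 := Gb_cont good0.
have V x : `|corr m eps (Ga y0) x - corr m eps (Ga y0) 0| <= eps * (4 * pi * a0).
  apply: corr_var => //; [exact: ltW|exact: Ga_per|move=> z].
  have := @slow_le _ a0 b0 a00 0 a0 b0 z; rewrite !subrr normr0 !addr0; exact.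
have V' x : `|corr m eps (Gb y0) x - corr m eps (Gb y0) 0| <= eps * (4 * pi * a0).
  apply: corr_var => //; [exact: ltW|exact: Gb_per|move=> z].
  have := @slow_le _ a0 b0 a00 0 a0 b0 z; rewrite !subrr normr0 !addr0 => /(_ (lexx _)) H.
  by rewrite normrM; apply: le_trans H; rewrite ler_piMl// sin_max.
have Z1 : corr m eps (Ga y0) 0 = 0 by rewrite corr_0// E1 slow_total// mul0r.
have Z2 : corr m eps (Gb y0) 0 = 0 by rewrite corr_0// E2 sin_slow_total// mul0r.
split=> [|x] /=; rewrite Z1 Z2 !addr0 !subrr ?normr0 ?addr0; first by rewrite divr_ge0// ltW.
have := V x; have := V' x; have n1 (c u : R) : c - (c + u) - 0 = - u by ring.
rewrite !n1 !normrN Z1 Z2 !subr0.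
by move: small_eps0; lra.
Qed.

Let close_trans y y' y'' e e' : close y y' e -> close y' y'' e' -> close y y'' (e + e').
Proof.
move=> [H1 H2] [H1' H2']; split=> [|x].
  have := ler_normD (y.1 0 - y'.1 0) (y'.1 0 - y''.1 0).
  have := ler_normD (y.2 0 - y'.2 0) (y'.2 0 - y''.2 0).
  by rewrite !addrA !subrK; lra.
have := ler_normD ((y.1 x - y'.1 x) - (y.1 0 - y'.1 0)) ((y'.1 x - y''.1 x) - (y'.1 0 - y''.1 0)).
have := ler_normD ((y.2 x - y'.2 x) - (y.2 0 - y'.2 0)) ((y'.2 x - y''.2 x) - (y'.2 0 - y''.2 0)).
have := H2 x; have := H2' x; rewrite mulrDr.
have -> : y.1 x - y'.1 x - (y.1 0 - y'.1 0) + (y'.1 x - y''.1 x - (y'.1 0 - y''.1 0)) =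
  y.1 x - y''.1 x - (y.1 0 - y''.1 0) by ring.
have -> : y.2 x - y'.2 x - (y.2 0 - y'.2 0) + (y'.2 x - y''.2 x - (y'.2 0 - y''.2 0)) =
  y.2 x - y''.2 x - (y.2 0 - y''.2 0) by ring.
lra.
Qed.

Let close_dist y y' e : close y y' e ->
  forall x, `|y.1 x - y'.1 x| + `|y.2 x - y'.2 x| <= 2 * e.
Proof.
move=> [H1 H2] x.
have e0 : 0 <= e by apply: le_trans H1; rewrite addr_ge0.
have := ler_normD (y.1 x - y'.1 x - (y.1 0 - y'.1 0)) (y.1 0 - y'.1 0).
have := ler_normD (y.2 x - y'.2 x - (y.2 0 - y'.2 0)) (y.2 0 - y'.2 0).
rewrite !subrK; have := H2 x.
have : s * e <= 1 * e by rewrite ler_wpM2r.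
lra.
Qed.

Let good_T y : good y -> close y0 (T y) (eta / 4) -> good (T y).
Proof.
move=> gy cl; have c1 := Ga_cont gy; have c2 := Gb_cont gy; split.
- move=> x; apply: (@continuousD _ _ _ (fun=> y.1 0) (corr m eps (Ga y))).
    exact: cst_continuous.
  exact: der_continuous (corr_der _ _ x c1).
- move=> x; apply: (@continuousD _ _ _ (fun=> y.2 0) (corr m eps (Gb y))).
    exact: cst_continuous.
  exact: der_continuous (corr_der _ _ x c2).
- by move=> x; rewrite /T/= corr_periodic// ; exact: Ga_per.
- by move=> x; rewrite /T/= corr_periodic// ; exact: Gb_per.
- move=> x; have := close_dist cl x.
  by rewrite (distrC _ a0) (distrC _ b0) /=; move: eta0; lra.
Qed.

(** The steps [eta / 8 / 2 ^ n] sum up to at most [eta / 4]. As [close_dist] doubles this bound, all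
    iterates stay in the [eta]-neighbourhood where the linearization is valid. *)
Let iterates n : [/\ good (Y n), close (Y n) (Y n.+1) (eta / 8 / 2 ^+ n) &
  close y0 (Y n) (eta / 4 * (1 - 1 / 2 ^+ n))].
Proof.
elim: n => [|n [g c c0]].
  split=> //=; first by rewrite expr0 divr1.
  by split=> [|x] /=; rewrite !subrr !normr0 expr0 divr1 subrr !mulr0 addr0.
have p2 : 0 < 2 ^+ n :> R by rewrite exprn_gt0.
have c0' : close y0 (Y n.+1) (eta / 4 * (1 - 1 / 2 ^+ n.+1)).
  have := close_trans c0 c.
  have -> // : eta / 4 * (1 - 1 / 2 ^+ n) + eta / 8 / 2 ^+ n =
     eta / 4 * (1 - 1 / 2 ^+ n.+1).
  by rewrite exprS; field; rewrite gt_eqF.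
have g' : good (Y n.+1).
  apply: good_T => //; have [h1 h2] := c0'.
  have le : eta / 4 * (1 - 1 / 2 ^+ n.+1) <= eta / 4.
    rewrite ler_piMr ?divr_ge0 ?ltW// gerBl divr_ge0// exprn_ge0//.
  split=> [|x]; first exact: le_trans le.
  by apply: le_trans (h2 x) _; rewrite ler_wpM2l// ltW.
split=> //; have := step g g' c.
by rewrite exprS invfM mulrA mulrAC [eta / 8 / 2 * _]mulrAC.
Qed.

(** The iterates converge pointwise at a geometric rate and have a common Lipschitz constant, so
    that the limit is continuous and [step] applies to it; hence it is fixed by [T]. *)
Lemma fixed_curve : exists A B : R -> R,
  [/\ forall x, has_deriv A x (eps * slow (A x) (B x) x),
      forall x, has_deriv B x (eps * (sin x * slow (A x) (B x) x)),
      forall x, A (x + 2 * pi) = A x, forall x, B (x + 2 * pi) = B x &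
      forall x, `|A x - a0| + `|B x - b0| <= eta].
Proof.
have D n x := close_dist (let: And3 _ h _ := iterates n in h) x.
have Da n x : `|(Y n.+1).1 x - (Y n).1 x| <= eta / 4 / 2 ^+ n.
  have := D n x; rewrite distrC; have := normr_ge0 ((Y n).2 x - (Y n.+1).2 x); lra.
have Db n x : `|(Y n.+1).2 x - (Y n).2 x| <= eta / 4 / 2 ^+ n.
  rewrite distrC; have := D n x; have := normr_ge0 ((Y n).1 x - (Y n.+1).1 x); lra.
have /choice[A HA] : forall x, exists l, forall n, `|l - (Y n).1 x| <= 2 * (eta / 4) / 2 ^+ n.
  by move=> x; apply: geometric_limit => n; exact: Da.
have /choice[B HB] : forall x, exists l, forall n, `|l - (Y n).2 x| <= 2 * (eta / 4) / 2 ^+ n.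
  by move=> x; apply: geometric_limit => n; exact: Db.
pose L := eps * (2 * (a0 + eta)).
have p0 : 0 < 2 * pi :> R by rewrite mulr_gt0// pi_gt0.
have corr_lip h : continuous h -> (forall x, `|h x| <= a0 + eta) ->
    forall x y, `|corr m eps h x - corr m eps h y| <= L * `|x - y|.
  move=> hc hle x y; apply: der_lip => [z|z]; first exact: corr_der.
  rewrite normrM (gtr0_norm eps0) ler_wpM2l ?(ltW eps0)//.
  apply: le_trans (ler_normB _ _) _; have := total_le hc hle.
  have := hle z; rewrite [`|total h / _|]normrM normfV (gtr0_norm p0).
  by rewrite -ler_pdivrMr//; lra.
have Gle y x : good y -> `|Ga y x| <= a0 + eta.
  by move=> [_ _ _ _ H]; exact: (slow_le a00 x (H x)).
have Gle' y x : good y -> `|Gb y x| <= a0 + eta.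
  by move=> g; apply: le_trans (Gle _ x g); rewrite normrM ler_piMl// sin_max.
have L0 : 0 <= L by rewrite !mulr_ge0 ?addr_ge0 ?ltW.
have lipY n x y : `|(Y n).1 x - (Y n).1 y| <= L * `|x - y| /\
                  `|(Y n).2 x - (Y n).2 y| <= L * `|x - y|.
  case: n => [|n]; first by rewrite !subrr normr0 mulr_ge0.
  have [g _ _] := iterates n.
  have Ea u v (c : R) : c + u - (c + v) = u - v by ring.
  change (`|(Y n).1 0 + corr m eps (Ga (Y n)) x -
     ((Y n).1 0 + corr m eps (Ga (Y n)) y)| <= L * `|x - y| /\
    `|(Y n).2 0 + corr m eps (Gb (Y n)) x -
     ((Y n).2 0 + corr m eps (Gb (Y n)) y)| <= L * `|x - y|).
  rewrite (Ea _ _ ((Y n).1 0)) (Ea _ _ ((Y n).2 0)); split; apply: corr_lip => //.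
  - exact: Ga_cont.
  - by move=> z; exact: Gle.
  - exact: Gb_cont.
  - by move=> z; exact: Gle'.
have Alip x y : `|A x - A y| <= L * `|x - y|.
  apply: (@le_half_powers _ _ _ eta) => n.
  have := HA x n; have := HA y n; have [h _] := lipY n x y; rewrite (distrC (A y)).
  have := ler_normD (A x - (Y n).1 x) ((Y n).1 x - (Y n).1 y + ((Y n).1 y - A y)).
  have := ler_normD ((Y n).1 x - (Y n).1 y) ((Y n).1 y - A y).
  by rewrite !addrA !subrK; lra.
have Blip x y : `|B x - B y| <= L * `|x - y|.
  apply: (@le_half_powers _ _ _ eta) => n.
  have := HB x n; have := HB y n; have [_ h] := lipY n x y; rewrite (distrC (B y)).
  have := ler_normD (B x - (Y n).2 x) ((Y n).2 x - (Y n).2 y + ((Y n).2 y - B y)).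
  have := ler_normD ((Y n).2 x - (Y n).2 y) ((Y n).2 y - B y).
  by rewrite !addrA !subrK; lra.
pose Z : curve := (A, B).
have gZ : good Z.
  split; [exact: lip_continuous Alip|exact: lip_continuous Blip| | |] => x /=.
  - apply/eqP; rewrite -subr_eq0 -normr_le0; apply: (@le_half_powers _ _ _ eta) => n.
    have [[_ _ per _ _] _ _] := iterates n.
    have := HA (x + 2 * pi) n; have := HA x n; rewrite per (distrC (A x)).
    have := ler_normD (A (x + 2 * pi) - (Y n).1 x) ((Y n).1 x - A x).
    by rewrite addrA subrK; lra.
  - apply/eqP; rewrite -subr_eq0 -normr_le0; apply: (@le_half_powers _ _ _ eta) => n.
    have [[_ _ _ per _] _ _] := iterates n.
    have := HB (x + 2 * pi) n; have := HB x n; rewrite per (distrC (B x)).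
    have := ler_normD (B (x + 2 * pi) - (Y n).2 x) ((Y n).2 x - B x).
    by rewrite addrA subrK; lra.
  - apply: (@le_half_powers _ _ _ eta) => n.
    have [[_ _ _ _ bd] _ _] := iterates n.
    have := HA x n; have := HB x n; have := bd x.
    have := ler_normD (A x - (Y n).1 x) ((Y n).1 x - a0).
    have := ler_normD (B x - (Y n).2 x) ((Y n).2 x - b0).
    by rewrite !addrA !subrK; lra.
(* The factor [1 / s] makes up for the weight of the oscillating part in [close]. *)
have clZ n : close Z (Y n) (2 * eta / s / 2 ^+ n).
  have p2 : 0 < 2 ^+ n :> R by rewrite exprn_gt0.
  have e1 : eta / 2 ^+ n <= eta / s / 2 ^+ n.
    apply: ler_wpM2r; first by rewrite invr_ge0 ltW.
    by rewrite ler_pdivlMr// ler_piMr// ltW.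
  have e3 : 0 <= eta / 2 ^+ n by rewrite divr_ge0 ?ltW.
  have e2 : s * (2 * eta / s / 2 ^+ n) = 2 * (eta / 2 ^+ n) by field; rewrite !gt_eqF.
  split=> [|x] /=; first by have := HA 0 n; have := HB 0 n; lra.
  rewrite e2; have := HA 0 n; have := HB 0 n; have := HA x n; have := HB x n.
  have := ler_normB (A x - (Y n).1 x) (A 0 - (Y n).1 0).
  have := ler_normB (B x - (Y n).2 x) (B 0 - (Y n).2 0).
  lra.
have TZ x : (T Z).1 x = A x /\ (T Z).2 x = B x.
  suff : `|(T Z).1 x - A x| + `|(T Z).2 x - B x| <= 0.
    move=> H; have := normr_ge0 ((T Z).1 x - A x); have := normr_ge0 ((T Z).2 x - B x).
    by move=> h1 h2; split; apply/eqP; rewrite -subr_eq0 -normr_le0; lra.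
  apply: (@le_half_powers _ _ _ (4 * eta / s)) => n; rewrite add0r.
  have [g _ _] := iterates n.
  have p2 : 0 < 2 ^+ n :> R by rewrite exprn_gt0.
  have h1 : `|A x - (Y n.+1).1 x| + `|B x - (Y n.+1).2 x| <= 2 * (eta / s / 2 ^+ n).
    have -> : eta / s / 2 ^+ n = 2 * eta / s / 2 ^+ n.+1.
      by rewrite exprS; field; rewrite !gt_eqF.
    exact: close_dist (clZ n.+1) x.
  have h2 : `|(T Z).1 x - (Y n.+1).1 x| + `|(T Z).2 x - (Y n.+1).2 x| <=
     2 * (2 * eta / s / 2 ^+ n / 2) := close_dist (step gZ g (clZ n)) x.
  move: h1 h2; rewrite (distrC (A x)) (distrC (B x)).
  have := ler_distD ((Y n.+1).1 x) ((T Z).1 x) (A x).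
  have := ler_distD ((Y n.+1).2 x) ((T Z).2 x) (B x).
  lra.
have cA := Ga_cont gZ; have cB := Gb_cont gZ.
have tA : total (Ga Z) = 0.
  have : A 0 + corr m eps (Ga Z) 0 = A 0 by have [] := TZ 0.
  rewrite corr_0// => H; have /eqP : total (Ga Z) / m = 0 by lra.
  by rewrite mulf_eq0 invr_eq0 (gt_eqF m0) orbF => /eqP.
have tB : total (Gb Z) = 0.
  have : B 0 + corr m eps (Gb Z) 0 = B 0 by have [] := TZ 0.
  rewrite corr_0// => H; have /eqP : total (Gb Z) / m = 0 by lra.
  by rewrite mulf_eq0 invr_eq0 (gt_eqF m0) orbF => /eqP.
exists A, B; case: gZ => _ _ pA pB bd; split=> // x.
- have EA : (fun x => A 0 + corr m eps (Ga Z) x) = A.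
    by apply/funext => z; have [] := TZ z.
  rewrite -[X in has_deriv X]EA; have H := corr_der m eps x cA; der.
  by rewrite tA mul0r subr0 add0r.
- have EB : (fun x => B 0 + corr m eps (Gb Z) x) = B.
    by apply/funext => z; have [] := TZ z.
  rewrite -[X in has_deriv X]EB; have H := corr_der m eps x cB; der.
  by rewrite tB mul0r subr0 add0r.
Qed.

End Iteration.
End PeriodicSolution.

(** * Exponential contraction towards the periodic solutions *)

Section Contraction.
Context {R : realType}.
Implicit Types (x t : R).

Lemma prim_bounded (h : R -> R) c x : continuous h ->
  (forall x, h (x + 2 * pi) = h x) -> total h = 0 -> (forall y, `|h y| <= c) ->
  `|prim h x| <= c * (2 * pi).
Proof.
move=> hc hp h0 hle; have p0 : 0 < 2 * pi :> R by rewrite mulr_gt0// pi_gt0.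
have [y /andP[y0 yp] E] := period_reduce x p0.
rewrite (E (prim h)); last exact: prim_periodic.
apply: le_trans (prim_le0 y hc hle) _; rewrite (ger0_norm y0).
by apply: ler_wpM2l => //; apply: le_trans (hle 0).
Qed.

(* The decay of the corrected distance: [d1, d2] is the difference of two
   solutions, [z1, z2] its corrected version, [- mu * di + ei] the time
   derivative of [zi]. *)
Lemma corrected_decay (mu nu d1 d2 z1 z2 e1 e2 : R) : 0 < mu ->
  nu = mu / (8 * (1 + mu)) ->
  `|z1 - d1| <= nu * (`|d1| + `|d2|) -> `|z2 - d2| <= nu * (`|d1| + `|d2|) ->
  `|e1| <= nu * (`|d1| + `|d2|) -> `|e2| <= nu * (`|d1| + `|d2|) ->
  [/\ z1 * (- mu * d1 + e1) + z2 * (- mu * d2 + e2) <= - (mu / 12) * (z1 ^+ 2 + z2 ^+ 2),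
      (`|d1| + `|d2|) ^+ 2 <= 8 * (z1 ^+ 2 + z2 ^+ 2) &
      z1 ^+ 2 + z2 ^+ 2 <= 3 * (`|d1| + `|d2|) ^+ 2].
Proof.
move=> mu0 nuE h1 h2 k1 k2; set N := `|d1| + `|d2| in h1 h2 k1 k2 *.
have NE : `|d1| + `|d2| = N by [].
have N0 : 0 <= N by rewrite addr_ge0.
clearbody N.
have nu0 : 0 < nu by rewrite nuE divr_gt0// mulr_gt0// addr_gt0.
(* With this [nu] the cross terms of first order in [nu] add up to at most [mu / 8 * N ^ 2], against
   a decay of at least [mu / 2 * N ^ 2]. *)
have nue : nu * (1 + mu) = mu / 8 by rewrite nuE; field; rewrite gt_eqF// addr_gt0.
have den0 : 0 < 8 * (1 + mu) by lra.
have nu8 : nu <= 1 / 8 by rewrite nuE ler_pdivrMr//; lra.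
have sqN (x : R) : `|x| * `|x| = x ^+ 2 by rewrite -expr2 real_normK// num_real.
have N2 : N ^+ 2 <= 2 * (d1 ^+ 2 + d2 ^+ 2).
  rewrite -(sqN d1) -(sqN d2) -NE; have := sqr_ge0 (`|d1| - `|d2|); rewrite !expr2; lra.
have sq_le (u v x y : R) : `|u| <= x -> `|v| <= y -> - (x * y) <= u * v <= x * y.
  by move=> ux vy; rewrite -ler_norml normrM ler_pM.
pose c1 := z1 - d1; pose c2 := z2 - d2.
have dN1 : `|d1| <= N by rewrite -NE lerDl.
have dN2 : `|d2| <= N by rewrite -NE lerDr.
have E1 : z1 * (- mu * d1 + e1) = - mu * d1 ^+ 2 - mu * (c1 * d1) + d1 * e1 + c1 * e1.
  by rewrite /c1; ring.
have E2 : z2 * (- mu * d2 + e2) = - mu * d2 ^+ 2 - mu * (c2 * d2) + d2 * e2 + c2 * e2.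
  by rewrite /c2; ring.
have nuN2 : nu * N * (nu * N) <= nu / 8 * N ^+ 2.
  have -> : nu * N * (nu * N) = nu * nu * N ^+ 2 by ring.
  by rewrite ler_wpM2r ?sqr_ge0//; apply: ler_wpM2l; [exact: ltW|lra].
have cd1 : - (nu * N * `|d1|) <= c1 * d1 <= nu * N * `|d1| by apply: sq_le.
have cd2 : - (nu * N * `|d2|) <= c2 * d2 <= nu * N * `|d2| by apply: sq_le.
have de1 : - (`|d1| * (nu * N)) <= d1 * e1 <= `|d1| * (nu * N) by apply: sq_le.
have de2 : - (`|d2| * (nu * N)) <= d2 * e2 <= `|d2| * (nu * N) by apply: sq_le.
have /andP[_ ce1] := sq_le _ _ _ _ h1 k1.
have /andP[_ ce2] := sq_le _ _ _ _ h2 k2.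
have mcd : - (mu * (nu * N ^+ 2)) <= mu * (c1 * d1 + c2 * d2).
  rewrite -mulrN ler_wpM2l ?(ltW mu0)//.
  move: cd1 cd2 => /andP[+ _] /andP[+ _].
  have : nu * N * `|d1| + nu * N * `|d2| = nu * N ^+ 2 by rewrite -mulrDr NE; ring.
  lra.
have dee : d1 * e1 + d2 * e2 <= nu * N ^+ 2.
  move: de1 de2 => /andP[_ +] /andP[_ +].
  have : `|d1| * (nu * N) + `|d2| * (nu * N) = nu * N ^+ 2 by rewrite -mulrDl NE; ring.
  lra.
have zle : z1 ^+ 2 + z2 ^+ 2 <= 3 * N ^+ 2.
  have za1 : `|z1| <= `|d1| + nu * N.
    by have := ler_normD (z1 - d1) d1; rewrite subrK; lra.
  have za2 : `|z2| <= `|d2| + nu * N.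
    by have := ler_normD (z2 - d2) d2; rewrite subrK; lra.
  have : `|z1| + `|z2| <= 5 / 4 * N.
    by have := ler_wpM2r N0 nu8; lra.
  move=> H; have : (`|z1| + `|z2|) ^+ 2 <= (5 / 4 * N) ^+ 2.
    by rewrite lerXn2r// nnegrE ?addr_ge0 ?mulr_ge0//; lra.
  rewrite !exprMn -[z1 ^+ 2]sqN -[z2 ^+ 2]sqN.
  have := mulr_ge0 (normr_ge0 z1) (normr_ge0 z2); have := sqr_ge0 N.
  by rewrite !expr2; clear; lra.
have zge : N ^+ 2 <= 8 * (z1 ^+ 2 + z2 ^+ 2).
  have za1 : `|d1| <= `|z1| + nu * N.
    by have := ler_normD (d1 - z1) z1; rewrite subrK distrC; lra.
  have za2 : `|d2| <= `|z2| + nu * N.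
    by have := ler_normD (d2 - z2) z2; rewrite subrK distrC; lra.
  have : 3 / 4 * N <= `|z1| + `|z2|.
    by have := ler_wpM2r N0 nu8; lra.
  move=> H; have : (3 / 4 * N) ^+ 2 <= (`|z1| + `|z2|) ^+ 2.
    by rewrite lerXn2r// nnegrE ?addr_ge0 ?mulr_ge0//; lra.
  rewrite !exprMn -[z1 ^+ 2]sqN -[z2 ^+ 2]sqN.
  have := sqr_ge0 (`|z1| - `|z2|); have := sqr_ge0 N.
  have := mulr_ge0 (normr_ge0 z1) (normr_ge0 z1).
  have := mulr_ge0 (normr_ge0 z2) (normr_ge0 z2).
  by rewrite !expr2; clear; lra.
split=> //; rewrite E1 E2.
have F1 : mu * N ^+ 2 <= mu * (2 * (d1 ^+ 2 + d2 ^+ 2)) by rewrite ler_wpM2l// ltW.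
have F2 : mu / 12 * (z1 ^+ 2 + z2 ^+ 2) <= mu / 12 * (3 * N ^+ 2).
  by rewrite ler_wpM2l// divr_ge0// ltW.
have F3 : nu * (1 + mu) * N ^+ 2 = mu / 8 * N ^+ 2 by rewrite nue.
have F4 : nu * N ^+ 2 <= mu / 8 * N ^+ 2.
  rewrite -nue ler_wpM2r ?sqr_ge0// ler_peMr ?(ltW nu0)//; lra.
rewrite -/c1 in ce1; rewrite -/c2 in ce2.
have F5 : c1 * e1 + c2 * e2 <= nu / 4 * N ^+ 2 by move: ce1 ce2 nuN2; clear; lra.
have F0 : 0 <= mu * N ^+ 2 by rewrite mulr_ge0 ?sqr_ge0// ltW.
move: F0 F1 F2 F3 F4 F5 mcd dee; clear; lra.
Qed.

Section Decay.
Variables (a0 b0 : R).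
Hypotheses (a00 : 0 < a0) (sb0 : sin b0 = 0) (J0 : bessel0 a0 = 0).
Let m := a0 * cos b0 * bessel1 a0.
Hypothesis m0 : 0 < m.

Let mu := m / (2 * pi).
Let nu := mu / (8 * (1 + mu)).
Let Lp := 1 + a0.
Let Ub := (Lp + mu) * (2 * pi).

(** Bounded primitives of the entries of the Jacobian minus their means. Passing from a difference
    [d] of solutions to [z = d - eps U d] is the near-identity transformation of averaging: to first
    order in [eps] it replaces the periodic coefficients by the mean [- mu]. *)
Let U11 := prim (fun x => slow_da a0 b0 x + mu).
Let U12 := prim (slow_db a0 b0).
Let U21 := prim (fun x => sin x * slow_da a0 b0 x).
Let U22 := prim (fun x => sin x * slow_db a0 b0 x + mu).

Let p0 : 0 < 2 * pi :> R. Proof. by rewrite mulr_gt0// pi_gt0. Qed.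
Let mu0 : 0 < mu. Proof. by rewrite divr_gt0. Qed.

Let c11 : continuous (fun x => slow_da a0 b0 x + mu). Proof. by cont. Qed.
Let c12 : continuous (slow_db a0 b0). Proof. exact: slow_db_continuous. Qed.
Let c21 : continuous (fun x => sin x * slow_da a0 b0 x). Proof. by cont. Qed.
Let c22 : continuous (fun x => sin x * slow_db a0 b0 x + mu). Proof. by cont. Qed.

Let total_cst (c : R) : total (fun=> c) = c * (2 * pi).
Proof.
have cc : continuous (fun _ : R => c) by exact: cst_continuous.
rewrite (@total_antiderivative _ (fun=> c) (fun x => c * x) cc) ?mulr0 ?subr0// => x.
by der; ring.
Qed.

Let mu_total : mu * (2 * pi) = m.
Proof. by rewrite /mu divfK// gt_eqF. Qed.

Let bU x : [/\ `|U11 x| <= Ub, `|U12 x| <= Ub, `|U21 x| <= Ub & `|U22 x| <= Ub].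
Proof.
have cc : continuous (fun _ : R => mu) by exact: cst_continuous.
have L0 : 0 <= Lp by rewrite addr_ge0// ltW.
have Sle (k : R -> R) : (forall x, `|k x| <= Lp) -> forall x, `|sin x * k x| <= Lp.
  move=> kc y; rewrite normrM; apply: le_trans (kc y).
  by rewrite ler_piMl// sin_max.
have Dle (k : R -> R) : (forall x, `|k x| <= Lp) -> forall x, `|k x + mu| <= Lp + mu.
  move=> kc y; apply: le_trans (ler_normD _ _) _.
  by rewrite (gtr0_norm mu0) lerD2r.
have Wle (k : R -> R) : (forall x, `|k x| <= Lp) -> forall x, `|k x| <= Lp + mu.
  by move=> kc y; apply: le_trans (kc y) _; rewrite lerDl ltW.
have da := slow_da_le b0 a00; have db := slow_db_le b0 a00.
have per x' : slow_da a0 b0 (x' + 2 * pi) = slow_da a0 b0 x' /\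
    slow_db a0 b0 (x' + 2 * pi) = slow_db a0 b0 x'.
  by rewrite /slow_da /slow_db sin2piD.
split; apply: prim_bounded => //.
- by move=> y; have [-> _] := per y.
- by rewrite total_add ?slow_da_total// ?total_cst ?mu_total -?/m ?addNr//; exact: slow_da_continuous.
- exact: Dle.
- by move=> y; have [_ ->] := per y.
- exact: slow_db_total.
- exact: Wle.
- by move=> y; have [-> _] := per y; rewrite sin2piD.
- exact: sin_slow_da_total.
- exact: Wle (Sle _ da).
- by move=> y; have [_ ->] := per y; rewrite sin2piD.
- rewrite total_add// ?sin_slow_db_total// ?total_cst ?mu_total -?/m ?addNr//.
  by cont.
- exact: Dle (Sle _ db).
Qed.

Variables (eta eps : R).
Let w := (3 + 2 * a0) * (2 * eta).
Hypotheses (eta0 : 0 < eta) (eps0 : 0 < eps) (small_w : w <= nu / 2)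
  (small_eps : eps * (4 * Ub * (Lp + 1)) <= nu).
Variables (A B : R -> R).
Hypotheses (DA : forall x, has_deriv A x (eps * slow (A x) (B x) x))
  (DB : forall x, has_deriv B x (eps * (sin x * slow (A x) (B x) x)))
  (AB : forall x, `|A x - a0| + `|B x - b0| <= eta).
Variables (t theta : R) (th a b Th : R -> R).
Hypotheses (t0 : 0 <= t) (theta0 : 0 < theta)
  (Dth : forall s, 0 <= s <= t -> has_deriv th s (Th s))
  (Da : forall s, 0 <= s <= t ->
     has_deriv a s (Th s * (eps * slow (a s) (b s) (th s))))
  (Db : forall s, 0 <= s <= t ->
     has_deriv b s (Th s * (eps * (sin (th s) * slow (a s) (b s) (th s))))).
Let N s := `|a s - A (th s)| + `|b s - B (th s)|.
Hypotheses (Thge : forall s, 0 <= s <= t -> N s <= eta -> theta <= Th s)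
  (N0 : N 0 <= eta / 5).

Let d1 s := a s - A (th s).
Let d2 s := b s - B (th s).
Let z1 s := d1 s - eps * (U11 (th s) * d1 s + U12 (th s) * d2 s).
Let z2 s := d2 s - eps * (U21 (th s) * d1 s + U22 (th s) * d2 s).
Let V s := z1 s ^+ 2 + z2 s ^+ 2.
Let DG s := slow (a s) (b s) (th s) - slow (A (th s)) (B (th s)) (th s).
Let r1 s := DG s - slow_da a0 b0 (th s) * d1 s - slow_db a0 b0 (th s) * d2 s -
  eps * (U11 (th s) * DG s + U12 (th s) * (sin (th s) * DG s)).
Let r2 s := sin (th s) * (DG s - slow_da a0 b0 (th s) * d1 s - slow_db a0 b0 (th s) * d2 s) -
  eps * (U21 (th s) * DG s + U22 (th s) * (sin (th s) * DG s)).

Let Dz1 s : 0 <= s <= t -> has_deriv z1 s (Th s * eps * (- mu * d1 s + r1 s)).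
Proof.
move=> st; have h1 := Da st; have h2 := Db st; have h3 := Dth st.
have h4 := der_comp (DA _) h3; have h5 := der_comp (DB _) h3.
have h6 := der_comp (der_prim _ c11) h3; have h7 := der_comp (der_prim _ c12) h3.
rewrite -/U11 -/U12 in h6 h7.
by rewrite /z1 /d1 /d2; der; rewrite /r1 /DG /d1 /d2; ring.
Qed.

Let Dz2 s : 0 <= s <= t -> has_deriv z2 s (Th s * eps * (- mu * d2 s + r2 s)).
Proof.
move=> st; have h1 := Da st; have h2 := Db st; have h3 := Dth st.
have h4 := der_comp (DA _) h3; have h5 := der_comp (DB _) h3.
have h6 := der_comp (der_prim _ c21) h3; have h7 := der_comp (der_prim _ c22) h3.
rewrite -/U21 -/U22 in h6 h7.
by rewrite /z2 /d1 /d2; der; rewrite /r2 /DG /d1 /d2; ring.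
Qed.

Let nu0 : 0 < nu.
Proof. by apply: divr_gt0 => //; move: mu0; lra. Qed.

Let nu1 : nu <= 1.
Proof.
have den0 : 0 < 8 * (1 + mu) by move: mu0; lra.
by rewrite ler_pdivrMr//; move: mu0; lra.
Qed.

Let Ub0 : 0 < Ub.
Proof. by rewrite mulr_gt0// !addr_gt0. Qed.

Let correction s : `|z1 s - d1 s| <= nu * N s /\ `|z2 s - d2 s| <= nu * N s.
Proof.
have [u11 u12 u21 u22] := bU (th s).
have e1 : eps * Ub <= nu.
  apply: le_trans small_eps; rewrite ler_wpM2l ?(ltW eps0)//.
  rewrite mulrAC ler_peMl ?(ltW Ub0)//; move: a00; rewrite /Lp; lra.
have H u v : `|u| <= Ub -> `|v| <= Ub -> `|eps * (u * d1 s + v * d2 s)| <= nu * N s.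
  move=> hu hv; rewrite normrM (gtr0_norm eps0).
  apply: le_trans (_ : eps * (Ub * N s) <= _).
    rewrite ler_wpM2l ?(ltW eps0)//; apply: le_trans (ler_normD _ _) _.
    by rewrite !normrM mulrDr; apply: lerD; apply: ler_wpM2r.
  by rewrite mulrA ler_wpM2r// addr_ge0.
by split; rewrite /z1 /z2 addrAC subrr sub0r normrN; apply: H.
Qed.

Let remainder s : N s <= eta -> `|r1 s| <= nu * N s /\ `|r2 s| <= nu * N s.
Proof.
move=> Ns; have [u11 u12 u21 u22] := bU (th s).
have S1 : `|sin (th s)| <= 1 by exact: sin_max.
have ABs := AB (th s).
have near2 : `|a s - a0| + `|b s - b0| <= 2 * eta.
  have := ler_distD (A (th s)) (a s) a0; have := ler_distD (B (th s)) (b s) b0.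
  by move: Ns; rewrite /N; lra.
have near1 : `|A (th s) - a0| + `|B (th s) - b0| <= 2 * eta by move: eta0; lra.
have L := slow_linearize a00 (th s) near2 near1; rewrite -/(DG s) -/w in L.
have G := slow_lip a00 (th s) near2 near1; rewrite -/(DG s) -/w -/Lp in G.
have Ns0 : 0 <= N s by rewrite addr_ge0.
have {}G : `|DG s| <= (Lp + 1) * N s.
  by apply: le_trans G _; rewrite ler_wpM2r// lerD2l; move: small_w nu1; lra.
have {}L : `|DG s - slow_da a0 b0 (th s) * d1 s - slow_db a0 b0 (th s) * d2 s| <= nu / 2 * N s.
  by apply: le_trans L _; rewrite ler_wpM2r.
have H u v : `|u| <= Ub -> `|v| <= Ub ->
    `|eps * (u * DG s + v * (sin (th s) * DG s))| <= nu / 2 * N s.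
  move=> hu hv; rewrite normrM (gtr0_norm eps0).
  have SG : `|sin (th s) * DG s| <= (Lp + 1) * N s.
    by apply: le_trans G; rewrite normrM ler_piMl.
  have : eps * `|u * DG s + v * (sin (th s) * DG s)| <=
      eps * (Ub * ((Lp + 1) * N s) + Ub * ((Lp + 1) * N s)).
    rewrite ler_wpM2l ?(ltW eps0)//; apply: le_trans (ler_normD _ _) _.
    by apply: lerD; rewrite normrM; apply: ler_pM.
  have := ler_wpM2r Ns0 small_eps; lra.
split; apply: le_trans (ler_normB _ _) _.
  by have := H _ _ u11 u12; lra.
have := H _ _ u21 u22; rewrite [`|sin _ * (_ - _)|]normrM.
have : `|sin (th s)| * `|DG s - slow_da a0 b0 (th s) * d1 s - slow_db a0 b0 (th s) * d2 s|
   <= `|DG s - slow_da a0 b0 (th s) * d1 s - slow_db a0 b0 (th s) * d2 s|.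
  by rewrite ler_piMl.
lra.
Qed.

Let V_compare s : N s ^+ 2 <= 8 * V s /\ V s <= 3 * N s ^+ 2.
Proof.
have [h1 h2] := correction s.
have n0 : `|0 : R| <= nu * (`|d1 s| + `|d2 s|) by rewrite normr0 mulr_ge0 ?addr_ge0// ltW.
by have [] := corrected_decay mu0 erefl h1 h2 n0 n0.
Qed.

(** While [N <= eta], the squared norm [V] of the corrected difference decays at the rate
    [mu / 6 * eps * theta]; [gronwall_local] removes the proviso. The constant 5 comes from
    [N ^ 2 <= 8 V] and [V <= 3 N ^ 2], as [24 <= 25]. *)
Lemma slow_contraction s : 0 <= s <= t ->
  N s <= 5 * N 0 * expR (- (mu / 12 * eps * theta) * s).
Proof.
have Nge0 s' : 0 <= N s' by rewrite addr_ge0.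
have NV s' : V s' < eta ^+ 2 / 8 -> N s' <= eta.
  move=> Vs; have [h _] := V_compare s'.
  by rewrite -(@ler_pXn2r _ 2)// ?nnegrE// ?(ltW eta0)//; lra.
have K0 : 0 <= mu / 6 * eps * theta.
  by apply: mulr_ge0 (mulr_ge0 (divr_ge0 (ltW mu0) _) (ltW eps0)) (ltW theta0).
(* [3 / 25 < 1 / 8]: this is the reason for the bound [eta / 5]. *)
have V0 : V 0 < eta ^+ 2 / 8.
  have [_ h] := V_compare 0; apply: le_lt_trans h _.
  have : N 0 ^+ 2 <= (eta / 5) ^+ 2 by rewrite lerXn2r// nnegrE// divr_ge0 ?ltW.
  by have : 0 < eta ^+ 2 := exprn_gt0 2 eta0; rewrite expr_div_n; lra.
move=> st; have := gronwall_local (f := V) t0 V0 K0 _ _ st.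
have H1 : forall s, 0 <= s <= t -> 0 <= V s.
  by move=> s' _; rewrite addr_ge0 ?sqr_ge0.
have H2 : forall s, 0 <= s <= t -> exists2 d, has_deriv V s d &
    (V s < eta ^+ 2 / 8 -> d <= - (mu / 6 * eps * theta) * V s).
  move=> s' st'; have g1 := Dz1 st'; have g2 := Dz2 st'.
  exists (2 * z1 s' * (Th s' * eps * (- mu * d1 s' + r1 s')) +
          2 * z2 s' * (Th s' * eps * (- mu * d2 s' + r2 s'))).
    by rewrite /V; der; ring.
  move=> /NV Ns; have [h1 h2] := correction s'; have [k1 k2] := remainder Ns.
  have [D _ _] := corrected_decay mu0 erefl h1 h2 k1 k2.
  have Tge := Thge st' Ns; have T0 : 0 < Th s' by apply: lt_le_trans Tge.
  have c0 : 0 <= 2 * Th s' * eps by apply: mulr_ge0 (mulr_ge0 _ (ltW T0)) (ltW eps0).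
  set u1 := - mu * d1 s' + r1 s' in D *; set u2 := - mu * d2 s' + r2 s' in D *.
  have -> : 2 * z1 s' * (Th s' * eps * u1) + 2 * z2 s' * (Th s' * eps * u2) =
    2 * Th s' * eps * (z1 s' * u1 + z2 s' * u2) by ring.
  apply: le_trans (ler_wpM2l c0 D) _; rewrite -/(V s').
  have -> : 2 * Th s' * eps * (- (mu / 12) * V s') = - (mu / 6 * eps * V s' * Th s').
    by field.
  have -> : - (mu / 6 * eps * theta) * V s' = - (mu / 6 * eps * V s' * theta) by ring.
  rewrite lerN2; apply: ler_wpM2l => //.
  apply: mulr_ge0; last by rewrite addr_ge0 ?sqr_ge0.
  exact: mulr_ge0 (divr_ge0 (ltW mu0) _) (ltW eps0).
move=> /(_ H1 H2) Vs.
rewrite -(@ler_pXn2r _ 2)// ?nnegrE ?mulr_ge0 ?expR_ge0//.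
have [h _] := V_compare s; have [_ h'] := V_compare 0.
rewrite !exprMn -expRM_natl.
have -> : 2 * (- (mu / 12 * eps * theta) * s) = - (mu / 6 * eps * theta) * s.
  by field.
have e0 := expR_ge0 (- (mu / 6 * eps * theta) * s).
have := ler_wpM2r e0 h'; have := mulr_ge0 (sqr_ge0 (N 0)) e0.
set E := expR _ in Vs e0 *; lra.
Qed.

End Decay.

End Contraction.

(** * A common parameter for finitely many attractors *)

Section Attractors.
Context {R : realType}.

(** The last clause is contraction under an arbitrary change of time: the phase moves at a speed
    [Th], bounded below by [theta] only where the solution is near. The reference point on the
    periodic orbit has the same phase as the solution, so no convergence of the phase is asked
    for. *)
Definition slow_attractor (eps a0 b0 eta lam : R) (A B : R -> R) : Prop :=
  [/\ forall x, has_deriv A x (eps * slow (A x) (B x) x),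
      forall x, has_deriv B x (eps * (sin x * slow (A x) (B x) x)),
      (forall x, A (x + 2 * pi) = A x) /\ (forall x, B (x + 2 * pi) = B x),
      forall x, `|A x - a0| + `|B x - b0| <= eta &
      forall (t theta : R) (th a b Th : R -> R),
        let N s := `|a s - A (th s)| + `|b s - B (th s)| in
        0 <= t -> 0 < theta ->
        (forall s, 0 <= s <= t -> has_deriv th s (Th s)) ->
        (forall s, 0 <= s <= t ->
           has_deriv a s (Th s * (eps * slow (a s) (b s) (th s)))) ->
        (forall s, 0 <= s <= t ->
           has_deriv b s (Th s * (eps * (sin (th s) * slow (a s) (b s) (th s))))) ->
        (forall s, 0 <= s <= t -> N s <= eta -> theta <= Th s) ->
        N 0 <= eta / 5 ->
        forall s, 0 <= s <= t -> N s <= 5 * N 0 * expR (- (lam * theta) * s)].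

(** [eta] is fixed by the nonlinearity before [eps], and every smaller [eps] works as well, which
    allows one [eps] for several zeros. The minima collect the smallness conditions of [fixed_curve]
    and [slow_contraction]. *)
Lemma slow_attractor_exists (a0 b0 eta1 : R) : 0 < a0 -> sin b0 = 0 ->
  bessel0 a0 = 0 -> 0 < a0 * cos b0 * bessel1 a0 -> 0 < eta1 ->
  exists eta eps0, [/\ 0 < eta <= eta1, 0 < eps0 &
    forall eps, 0 < eps <= eps0 -> exists lam A B, 0 < lam /\
      slow_attractor eps a0 b0 eta lam A B].
Proof.
move=> a00 sb0 J0 m0 eta10; set m := a0 * cos b0 * bessel1 a0 in m0.
have p0 : 0 < pi :> R := pi_gt0 R.
pose mu := m / (2 * pi).
have mu0 : 0 < mu by rewrite divr_gt0// mulr_gt0.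
pose nu := mu / (8 * (1 + mu)).
have nu0 : 0 < nu by rewrite divr_gt0// mulr_gt0// addr_gt0.
pose Lp := 1 + a0.
have L0 : 0 < Lp by rewrite addr_gt0.
pose Ub := (Lp + mu) * (2 * pi).
have U0 : 0 < Ub by apply: mulr_gt0; [exact: addr_gt0|rewrite mulr_gt0].
have k0 : 0 < 3 + 2 * a0 by rewrite addr_gt0// mulr_gt0.
pose eta := Num.min eta1 (Num.min (nu / (4 * (3 + 2 * a0))) (m / ((3 + 2 * a0) * (32 * pi)))).
have eta0 : 0 < eta.
  have kk : 0 < (3 + 2 * a0) * (32 * pi) by rewrite mulr_gt0// mulr_gt0.
  have kk' : 0 < 4 * (3 + 2 * a0) by exact: mulr_gt0.
  by rewrite !lt_min eta10/= (divr_gt0 m0 kk) (divr_gt0 nu0 kk').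
have eta_le : [/\ eta <= eta1, eta <= nu / (4 * (3 + 2 * a0)) &
    eta <= m / ((3 + 2 * a0) * (32 * pi))].
  by rewrite !ge_min !lexx !orbT.
case: eta_le => le1 le2 le3.
pose w := (3 + 2 * a0) * eta.
have w0 : 0 < w by rewrite mulr_gt0.
have wm : w * (32 * pi) <= m.
  have kk : 0 < (3 + 2 * a0) * (32 * pi) by rewrite mulr_gt0// mulr_gt0.
  by move: le3; rewrite ler_pdivlMr// /w; lra.
have w2 : (3 + 2 * a0) * (2 * eta) <= nu / 2.
  have kk : 0 < 4 * (3 + 2 * a0) by exact: mulr_gt0.
  by move: le2; rewrite ler_pdivlMr//; lra.
pose s := Num.min 1 (m / (16 * pi * Lp)).
have d0 : 0 < 16 * pi * Lp by rewrite !mulr_gt0.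
have s0 : 0 < s by rewrite lt_min ltr01/= divr_gt0.
have s1 : s <= 1 by rewrite ge_min lexx.
have sm : s * (16 * pi * Lp) <= m.
  by rewrite -ler_pdivlMr// ge_min lexx orbT.
pose eps0 := Num.min (s / (32 * pi * (Lp + w)))
  (Num.min (s * eta / (64 * pi * a0)) (nu / (4 * Ub * (Lp + 1)))).
have d1 : 0 < 32 * pi * (Lp + w) by apply: mulr_gt0; [rewrite mulr_gt0|exact: addr_gt0].
have d2 : 0 < 64 * pi * a0 by rewrite !mulr_gt0.
have d3 : 0 < 4 * Ub * (Lp + 1) by apply: mulr_gt0; [exact: mulr_gt0|exact: addr_gt0].
have eps00 : 0 < eps0.
  by rewrite !lt_min (divr_gt0 s0 d1) (divr_gt0 (mulr_gt0 s0 eta0) d2) (divr_gt0 nu0 d3).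
exists eta, eps0; split=> //; first by rewrite eta0.
move=> eps /andP[eps_gt0]; rewrite !le_min => /andP[e1 /andP[e2 e3]].
rewrite ler_pdivlMr// in e1; rewrite ler_pdivlMr// in e2; rewrite ler_pdivlMr// in e3.
have [A [B [DA DB pA pB AB]]] := fixed_curve a00 sb0 J0 m0 eta0 eps_gt0 s0 s1 wm sm e1 e2.
exists (mu / 12 * eps), A, B; split; first by rewrite mulr_gt0// divr_gt0.
split=> // t theta th a b Th N t0 theta0 Dth Da Db HT N0 x xt.
exact: (slow_contraction a00 sb0 J0 m0 eta0 eps_gt0 w2 e3 DA DB AB t0 theta0 Dth Da Db HT N0 xt).
Qed.

Lemma finite_lower_bound (e : nat -> R) n : (forall i, 0 < e i) ->
  exists2 d, 0 < d & forall i, (i < n)%N -> d <= e i.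
Proof.
move=> e0; elim: n => [|n [d d0 IH]]; first by exists 1.
exists (Num.min d (e n)); first by rewrite lt_min d0 e0.
move=> i; rewrite ltnS leq_eqVlt => /predU1P[->|/IH]; rewrite ge_min ?lexx ?orbT//.
by move->.
Qed.

(** The sign of [bessel1] at the zero decides between [b0 = 0] and [b0 = pi], so that the averaged
    linear part is negative. The thresholds of the first [n] zeros have a common positive lower
    bound. *)
Lemma slow_attractor_family n : exists (eps : R) (a0 b0 eta lam : nat -> R)
    (A B : nat -> R -> R),
  [/\ 0 < eps, forall i, 2 < a0 i, forall i, a0 i + 1 < a0 i.+1,
      forall i, 0 < eta i <= 1 / 4 &
      forall i, (i < n)%N -> 0 < lam i /\
        slow_attractor eps (a0 i) (b0 i) (eta i) (lam i) (A i) (B i)].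
Proof.
have [a0 [a2 aS aJ]] := @bessel0_zeros R.
have /choice[b0 Hb] : forall i, exists b, sin b = 0 /\ 0 < a0 i * cos b * bessel1 (a0 i).
  move=> i; have a0i : 0 < a0 i by apply: lt_trans (a2 i).
  have := bessel1_neq0 a0i (aJ i); rewrite neq_lt => /orP[J1|J1].
    exists pi; rewrite sinpi cospi; split=> //.
    by rewrite mulrN1 mulNr -mulrN mulr_gt0// oppr_gt0.
  by exists 0; rewrite sin0 cos0 mulr1; split=> //; rewrite mulr_gt0.
have q0 : 0 < 1 / 4 :> R by rewrite divr_gt0.
have /choice[eta He] : forall i, exists eta, exists eps0, [/\ 0 < eta <= 1 / 4, 0 < eps0 &
    forall eps, 0 < eps <= eps0 -> exists lam A B, 0 < lam /\
      slow_attractor eps (a0 i) (b0 i) eta lam A B].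
  move=> i; have [sb mb] := Hb i.
  by apply: slow_attractor_exists => //; apply: lt_trans (a2 i).
have /choice[eps0 {}He] := He.
have [eps eps_gt0 epsle] := @finite_lower_bound eps0 n (fun i => let: And3 _ h _ := He i in h).
have /choice[lam] : forall i, exists lam, exists A B, (i < n)%N -> 0 < lam /\
      slow_attractor eps (a0 i) (b0 i) (eta i) lam A B.
  move=> i; case: (ltnP i n) => [lin|_]; last by exists 0, id, id.
  have [_ _ /(_ eps)] := He i; rewrite eps_gt0 epsle// => /(_ isT)[lam [A [B H]]].
  by exists lam, A, B.
move=> /choice[A /choice[B H]].
by exists eps, a0, b0, eta, lam, A, B; split=> // i; case: (He i).
Qed.

End Attractors.

(** * The vector field *)

(* If every [u j] with [j <= l] moves at the velocity [k * vf l j], then [sig l] moves at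
   the velocity [k * tfac l] (lemma [sig_der]). *)
Section NestedTori.
Context {A : comNzRingType}.
Variables (c : A) (u : nat -> A).

Fixpoint sig l : A :=
  if l is l'.+1 then sig l' ^+ 2 + u l ^+ 2 - c else u 0.

Fixpoint tfac l : A :=
  if l is l'.+1 then tfac l' * (2 * (sig l + c)) else 1.

Fixpoint vf l j : A :=
  if l is l'.+1 then if j == l then u l * tfac l' else sig l' * vf l' j else 1.

End NestedTori.

(* In [field_coord eps c X l i], the coordinates [X 0] and [X 1] span the plane of
   the phase, [X 2], ..., [X l.+2] the space of the nested tori and the remaining
   ones are contracted. *)
Section FieldCoordinates.
Context {A : comNzRingType}.
Variables (eps c : A) (X : nat -> A) (l : nat).

Definition plane_sq : A := X 0 ^+ 2 + X 1 ^+ 2.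
Definition plane_re : A := X 0 ^+ 2 - X 1 ^+ 2.
Definition plane_im : A := 2 * X 0 * X 1.
Definition height : A := sig c (fun j => X j.+2) l.
Definition speed : A := tfac c (fun j => X j.+2) l.
(** With [Q = plane_sq - c] and [cos al = plane_re / plane_sq], the three rates are [plane_sq * Q'],
    [plane_sq ^ 2 * al'] and [2 * plane_sq ^ 2 * Z'], the derivatives being those of the slow
    system. In [field_coord] all of them then run at the common speed [2 * plane_sq ^ 2 * speed]. *)
Definition radial_rate : A :=
  plane_sq * height + eps * (plane_sq - c) * plane_re.
Definition angular_rate : A :=
  plane_sq ^+ 2 * height + 2 * eps * (plane_sq - c) * plane_sq * plane_re.
Definition height_rate : A :=
  2 * (eps * plane_sq * height * plane_re - plane_sq ^+ 2 * (plane_sq - c)).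

Definition field_coord (i : nat) : A :=
  match i with
  | 0 => speed * (X 0 * radial_rate - X 1 * angular_rate)
  | 1 => speed * (X 1 * radial_rate + X 0 * angular_rate)
  | i'.+2 => if (i' <= l)%N then height_rate * vf c (fun j => X j.+2) l i'
             else - (2 * plane_sq ^+ 2 * speed * X i)
  end.

End FieldCoordinates.

Section Continuity.
Context {R : realType}.
Implicit Types (f g : R -> R) (x : R).

Lemma cat_id x : {for x, continuous (fun y : R => y)}. Proof. exact: cvg_id. Qed.
Lemma cat_cst (c : R) x : {for x, continuous (fun _ : R => c)}.
Proof. exact: cst_continuous. Qed.
Lemma cat_add f g x : {for x, continuous f} -> {for x, continuous g} ->
  {for x, continuous (fun y => f y + g y)}.
Proof. exact: continuousD. Qed.
Lemma cat_opp f x : {for x, continuous f} -> {for x, continuous (fun y => - f y)}.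
Proof. exact: continuousN. Qed.
Lemma cat_mul f g x : {for x, continuous f} -> {for x, continuous g} ->
  {for x, continuous (fun y => f y * g y)}.
Proof. exact: continuousM. Qed.
Lemma cat_exp f n x : {for x, continuous f} ->
  {for x, continuous (fun y => f y ^+ n)}.
Proof.
move=> fc; apply: (@continuous_comp _ _ _ f (fun y => y ^+ n)) => //.
exact: exprn_continuous.
Qed.
Lemma cat_inv f x : f x != 0 -> {for x, continuous f} ->
  {for x, continuous (fun y => (f y)^-1)}.
Proof. by move=> f0 fc; apply: cvgV. Qed.
End Continuity.

Ltac cat := cbv beta; first [eassumption | notypeclasses refine (@cat_cst _ _ _) |
  lazymatch goal with
  | |- {for _, continuous (fun y => @?f y + @?g y)} =>
      notypeclasses refine (@cat_add _ f g _ _ _); cat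
  | |- {for _, continuous (fun y => - @?f y)} =>
      notypeclasses refine (@cat_opp _ f _ _); cat
  | |- {for _, continuous (fun y => @?f y * @?g y)} =>
      notypeclasses refine (@cat_mul _ f g _ _ _); cat
  | |- {for _, continuous (fun y => (@?f y) ^+ ?n)} =>
      notypeclasses refine (@cat_exp _ f n _ _); cat
  | |- {for _, continuous (fun y => (@?f y)^-1)} =>
      notypeclasses refine (@cat_inv _ f _ _ _); [|cat]
  end | idtac].

Section FieldAlongCurve.
Context {R : realType}.
Variables (eps c : R) (l : nat) (X : R -> nat -> R).

Lemma sig_der (u : R -> nat -> R) k (t g : R) :
  (forall j, (j <= k)%N -> has_deriv (u ^~ j) t (g * vf c (u t) k j)) ->
  has_deriv (fun t => sig c (u t) k) t (g * tfac c (u t) k).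
Proof.
elim: k g => [|k IH] g Hu; first exact: Hu.
have H1 : has_deriv (fun t => sig c (u t) k) t (g * sig c (u t) k * tfac c (u t) k).
  apply: IH => j jk; have := Hu j (leqW jk); rewrite /=.
  by case: eqP => [E|_]; [move: jk; rewrite E ltnn|rewrite mulrA].
have H2 : has_deriv (u ^~ k.+1) t (g * (u t k.+1 * tfac c (u t) k)).
  by have := Hu k.+1 (leqnn _); rewrite /= eqxx.
by rewrite /=; der; ring.
Qed.

Lemma sig_cat (u : R -> nat -> R) k t :
  (forall j, (j <= k)%N -> {for t, continuous (u ^~ j)}) ->
  {for t, continuous (fun t => sig c (u t) k)}.
Proof.
elim: k => [|k IH] Hu /=; first exact: Hu.
have h1 := IH (fun j jk => Hu j (leqW jk)); have h2 := Hu k.+1 (leqnn _).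
by cat.
Qed.

Lemma tfac_cat (u : R -> nat -> R) k t :
  (forall j, (j <= k)%N -> {for t, continuous (u ^~ j)}) ->
  {for t, continuous (fun t => tfac c (u t) k)}.
Proof.
elim: k => [|k IH] Hu; first exact: cat_cst.
have h1 := IH (fun j jk => Hu j (leqW jk)); have h2 := sig_cat Hu.
have -> : (fun t => tfac c (u t) k.+1) =
  (fun t => tfac c (u t) k * (2 * (sig c (u t) k.+1 + c))) by [].
by cat.
Qed.

Variable h : R -> R.
Let sq t := plane_sq (X t).
Let re t := plane_re (X t).
Let im t := plane_im (X t).
Let Z t := height c (X t) l.
Let Q t := sq t - c.
Let T t := speed c (X t) l.
(** The speed of the phase of the slow system along a solution of the field multiplied by [h]; later
    [h] is the padding factor. [radial] is the logarithmic derivative of [plane_sq], and [angular]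
    the speed of the doubled angle in the plane. *)
Definition clock t : R := 2 * sq t ^+ 2 * T t * h t.
Definition radial t : R := 2 * h t * T t * radial_rate eps c (X t) l.
Definition angular t : R := 2 * h t * T t * angular_rate eps c (X t) l.

Lemma field_der t :
  (forall i, (i <= l.+2)%N -> has_deriv (X ^~ i) t (h t * field_coord eps c (X t) l i)) ->
  [/\ has_deriv sq t (radial t * sq t),
      has_deriv re t (radial t * re t - angular t * im t),
      has_deriv im t (radial t * im t + angular t * re t) &
      has_deriv Z t (h t * height_rate eps c (X t) l * T t)].
Proof.
move=> HX; have H0 : has_deriv (X ^~ 0%N) t (h t * (speed c (X t) l *
    (X t 0 * radial_rate eps c (X t) l - X t 1 * angular_rate eps c (X t) l))).
  exact: HX.
have H1 : has_deriv (X ^~ 1%N) t (h t * (speed c (X t) l *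
    (X t 1 * radial_rate eps c (X t) l + X t 0 * angular_rate eps c (X t) l))).
  exact: HX.
rewrite /radial /angular /T; split.
- by rewrite /sq /plane_sq; der; ring.
- by rewrite /re /im /plane_re /plane_im; der; ring.
- by rewrite /re /im /plane_re /plane_im; der; ring.
- apply: sig_der => j jl; have := HX j.+2 jl; rewrite /field_coord jl.
  by rewrite mulrA.
Qed.

Lemma clock_radial t : sq t != 0 ->
  radial t = clock t * (Z t + eps * Q t * (re t / sq t)) / sq t.
Proof.
move=> s0; rewrite /radial /clock /radial_rate -/(sq t) -/(re t) -/(Z t) -/(T t) /Q.
by field.
Qed.

Lemma clock_angular t : sq t != 0 ->
  angular t = clock t * (Z t + 2 * (eps * Q t * (re t / sq t))).
Proof.
move=> s0; rewrite /angular /clock /angular_rate -/(sq t) -/(re t) -/(Z t) -/(T t) /Q.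
by field.
Qed.

Lemma clock_height t : sq t != 0 ->
  h t * height_rate eps c (X t) l * T t =
  clock t * (eps * Z t * (re t / sq t) - Q t).
Proof.
move=> s0; rewrite /clock /height_rate -/(sq t) -/(re t) -/(Z t) -/(T t) /Q.
by field.
Qed.

End FieldAlongCurve.

(** * Solutions of the field as solutions of the slow system *)

Section Lift.
Context {R : realType}.
Variables (eps c : R) (l : nat) (X : R -> nat -> R) (h : R -> R).
Let sq t := plane_sq (X t).
Let re t := plane_re (X t).
Let im t := plane_im (X t).
Let Z t := height c (X t) l.
Let Q t := sq t - c.
Let Th := clock c l X h.

Variables (a b t1 : R).
Hypotheses (a0 : a < 0) (t1_ge0 : 0 <= t1) (t1b : t1 < b)
  (hc : forall t, a < t < b -> {for t, continuous h})
  (HX : forall t i, a < t < b -> (i <= l.+2)%N ->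
     has_deriv (X ^~ i) t (h t * field_coord eps c (X t) l i)).

Let inab t : 0 <= t <= t1 -> a < t < b.
Proof. by move=> /andP[? ?]; move: a0 t1b; lra. Qed.

Let local_prim (k : R -> R) (v : R) : (forall t, a < t < b -> {for t, continuous k}) ->
  exists2 F, F 0 = v & forall t, 0 <= t <= t1 -> has_deriv F t (k t).
Proof.
move=> kc; have [|F HF] := @antiderivative_on _ k (a / 2) ((t1 + b) / 2).
  by move=> t tin; apply: kc; move: a0 t1b t1_ge0 tin; lra.
exists (fun t => v + (F t - F 0)); first by rewrite subrr addr0.
move=> t tin; have Ft : has_deriv F t (k t).
  by apply: HF; move: a0 t1b t1_ge0 tin; lra.
by der; ring.
Qed.

Let Xcat t i : a < t < b -> (i <= l.+2)%N -> {for t, continuous (X ^~ i)}.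
Proof. by move=> tab il; apply: der_continuous (HX tab il). Qed.

Let sqcat t : a < t < b -> {for t, continuous sq}.
Proof.
move=> tab; have h0 := @Xcat t 0 tab isT; have h1 := @Xcat t 1 tab isT.
by rewrite /sq /plane_sq; cat.
Qed.

Let recat t : a < t < b -> {for t, continuous re}.
Proof.
move=> tab; have h0 := @Xcat t 0 tab isT; have h1 := @Xcat t 1 tab isT.
by rewrite /re /plane_re; cat.
Qed.

Let Zcat t : a < t < b -> {for t, continuous Z}.
Proof. by move=> tab; apply: sig_cat => j jl; exact: (@Xcat t j.+2). Qed.

Let Tcat t : a < t < b -> {for t, continuous (fun t => speed c (X t) l)}.
Proof. by move=> tab; apply: tfac_cat => j jl; exact: (@Xcat t j.+2). Qed.

Let Thcat t : a < t < b -> {for t, continuous Th}.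
Proof.
move=> tab; have h1 := sqcat tab; have h2 := Tcat tab; have h3 := hc tab.
by rewrite /Th /clock -/sq; cat.
Qed.

Let kap := radial eps c l X h.

Let kapcat t : a < t < b -> {for t, continuous kap}.
Proof.
move=> tab; have h1 := sqcat tab; have h2 := Tcat tab; have h3 := hc tab.
have h4 := Zcat tab; have h5 := recat tab.
by rewrite /kap /radial /radial_rate -/sq -/re -/Z; cat.
Qed.

Let linear (k f : R -> R) : (forall t, a < t < b -> {for t, continuous k}) ->
  (forall t, 0 <= t <= t1 -> has_deriv f t (k t * f t)) ->
  exists E : R -> R, (forall t, 0 < E t) /\ forall t, 0 <= t <= t1 -> f t = f 0 * E t.
Proof. by move=> kc; apply: linear_ode_on => //; exact: local_prim. Qed.

Lemma lift_positive t : 0 < sq 0 -> 0 <= t <= t1 -> 0 < sq t.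
Proof.
move=> s0 tt; have [|E [E0 HE]] := @linear kap sq kapcat.
  move=> u ut; have [|H _ _ _] := @field_der _ eps c l X h u; last exact: H.
  by move=> i; apply: HX; exact: inab.
by rewrite HE// mulr_gt0.
Qed.

Variables (th0 r0 b0 : R).
Hypotheses (s0 : 0 < sq 0) (Z0 : Z 0 = r0 * cos th0) (Q0 : Q 0 = r0 * sin th0)
  (X00 : X 0 0%N = Num.sqrt (sq 0) * cos ((b0 + Q 0) / 2))
  (X01 : X 0 1%N = Num.sqrt (sq 0) * sin ((b0 + Q 0) / 2)).

Lemma slow_lift : exists th r be : R -> R,
  [/\ [/\ th 0 = th0, r 0 = r0 & be 0 = b0],
      forall t, 0 <= t <= t1 ->
        [/\ has_deriv th t (Th t),
            has_deriv r t (Th t * (eps * slow (r t) (be t) (th t))) &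
            has_deriv be t (Th t * (eps * (sin (th t) * slow (r t) (be t) (th t))))] &
      forall t, 0 <= t <= t1 ->
        [/\ Z t = r t * cos (th t), Q t = r t * sin (th t),
            X t 0%N = Num.sqrt (sq t) * cos ((be t + Q t) / 2) &
            X t 1%N = Num.sqrt (sq t) * sin ((be t + Q t) / 2)]].
Proof.
have half x : x = x / 2 + x / 2 :> R by field.
have cs1 x : cos x ^+ 2 = 1 - sin x ^+ 2 :> R by rewrite cos2sin2.
have re0 : re 0 = sq 0 * cos (b0 + Q 0).
  rewrite /re /plane_re X00 X01 !exprMn sqr_sqrtr ?ltW// [in RHS](half (b0 + Q 0)) cosD.
  ring.
have im0 : im 0 = sq 0 * sin (b0 + Q 0).
  rewrite /im /plane_im X00 X01 [in RHS](half (b0 + Q 0)) sinD.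
  by rewrite -{3}(sqr_sqrtr (ltW s0)); ring.
have spos t : 0 <= t <= t1 -> 0 < sq t by exact: lift_positive.
(* The quotient [re / sq] is only used where [sq] is positive; the products with
   [clock] are polynomial. *)
pose cs t := 2 * (sq t * speed c (X t) l * h t) * re t.
have cscat t : a < t < b -> {for t, continuous cs}.
  move=> tab; have h1 := sqcat tab; have h2 := Tcat tab; have h3 := hc tab.
  by have h5 := recat tab; rewrite /cs; cat.
have csE t : 0 <= t <= t1 -> Th t * (re t / sq t) = cs t.
  move=> tt; rewrite /cs /Th /clock -/(sq t); field; by rewrite gt_eqF// spos.
have [th th00 Dth] := local_prim th0 Thcat.
have [be be0 Dbe] : exists2 F, F 0 = b0 &
    forall t, 0 <= t <= t1 -> has_deriv F t (cs t * (eps * Q t)).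
  apply: local_prim => t tab; have h1 := cscat _ tab; have h2 := sqcat tab.
  by rewrite /Q; cat.
have D t : 0 <= t <= t1 -> [/\ has_deriv Q t (Th t * Z t + eps * Q t * cs t),
   has_deriv Z t (eps * Z t * cs t - Th t * Q t),
   has_deriv re t (kap t * re t - (Th t * Z t + 2 * (eps * Q t * cs t)) * im t),
   has_deriv im t (kap t * im t + (Th t * Z t + 2 * (eps * Q t * cs t)) * re t) &
   has_deriv sq t (kap t * sq t)].
  move=> tt; have [|H1 H2 H3 H4] := @field_der _ eps c l X h t.
    by move=> i; apply: HX; exact: inab.
  have sn : sq t != 0 by rewrite gt_eqF// spos.
  have E1 := @clock_radial R eps c l X h t sn; have E2 := @clock_angular R eps c l X h t sn.
  have E3 := @clock_height R eps c l X h t sn.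
  rewrite -!/(sq _) -!/(re _) -!/(Z _) -!/(Q _) -!/(Th _) in E1 E2 E3 H1 H2 H3 H4.
  have E4 : angular eps c l X h t = Th t * Z t + 2 * (eps * Q t * cs t).
    by rewrite E2 -csE//; ring.
  split=> //.
  - have H5 : has_deriv sq t (radial eps c l X h t * sq t) := H1.
    rewrite /Q; der; rewrite subr0 E1 divfK// -csE//.
    by rewrite /Q; ring.
  - by apply: der_eq H4 _; rewrite E3 -csE//; ring.
  - by apply: der_eq H2 _; rewrite E4.
  - by apply: der_eq H3 _; rewrite E4.
pose r t := Z t * cos (th t) + Q t * sin (th t).
pose k2 t := Q t * cos (th t) - Z t * sin (th t).
have epscs t : a < t < b -> {for t, continuous (fun t => eps * cs t)}.
  by move=> tab; have h1 := cscat _ tab; cat.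
have Dr t : 0 <= t <= t1 -> has_deriv r t (eps * cs t * r t).
  move=> tt; have [H1 H2 _ _ _] := D t tt; have H3 := Dth t tt.
  by rewrite /r; der; ring.
have Dk2 t : 0 <= t <= t1 -> has_deriv k2 t (eps * cs t * k2 t).
  move=> tt; have [H1 H2 _ _ _] := D t tt; have H3 := Dth t tt.
  by rewrite /k2; der; ring.
have k20 t : 0 <= t <= t1 -> k2 t = 0.
  have [E [_ HE]] := linear epscs Dk2; move/HE ->.
  by rewrite /k2 th00 Z0 Q0; ring.
have ZE t : 0 <= t <= t1 -> Z t = r t * cos (th t).
  move=> tt; have K := k20 t tt.
  have -> : Z t = r t * cos (th t) - k2 t * sin (th t) +
     Z t * (1 - cos (th t) ^+ 2 - sin (th t) ^+ 2) by rewrite /r /k2; ring.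
  by rewrite K cs1; ring.
have QE t : 0 <= t <= t1 -> Q t = r t * sin (th t).
  move=> tt; have K := k20 t tt.
  have -> : Q t = r t * sin (th t) + k2 t * cos (th t) +
     Q t * (1 - cos (th t) ^+ 2 - sin (th t) ^+ 2) by rewrite /r /k2; ring.
  by rewrite K cs1; ring.
pose An t := be t + Q t.
have DA t : 0 <= t <= t1 -> has_deriv An t (Th t * Z t + 2 * (eps * Q t * cs t)).
  move=> tt; have [H1 _ _ _ _] := D t tt; have H2 := Dbe t tt.
  by rewrite /An; der; ring.
pose k4 t := im t * cos (An t) - re t * sin (An t).
pose k5 t := re t * cos (An t) + im t * sin (An t) - sq t.
have Dk4 t : 0 <= t <= t1 -> has_deriv k4 t (kap t * k4 t).
  move=> tt; have [_ _ H3 H4 _] := D t tt; have H5 := DA t tt.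
  by rewrite /k4; der; ring.
have Dk5 t : 0 <= t <= t1 -> has_deriv k5 t (kap t * k5 t).
  move=> tt; have [_ _ H3 H4 H6] := D t tt; have H5 := DA t tt.
  by rewrite /k5; der; ring.
have k40 t : 0 <= t <= t1 -> k4 t = 0.
  have [E [_ HE]] := linear kapcat Dk4; move/HE ->.
  by rewrite /k4 /An be0 re0 im0; ring.
have k50 t : 0 <= t <= t1 -> k5 t = 0.
  have [E [_ HE]] := linear kapcat Dk5; move/HE ->.
  rewrite /k5 /An be0 re0 im0.
  have -> : sq 0 * cos (b0 + Q 0) * cos (b0 + Q 0) + sq 0 * sin (b0 + Q 0) * sin (b0 + Q 0)
    = sq 0 * (cos (b0 + Q 0) ^+ 2 + sin (b0 + Q 0) ^+ 2) by ring.
  by rewrite cs1; ring.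
have reE t : 0 <= t <= t1 -> re t = sq t * cos (be t + Q t).
  move=> tt; have K := k40 t tt; have K' := k50 t tt; rewrite -/(An t).
  have -> : re t = (k5 t + sq t) * cos (An t) - k4 t * sin (An t) +
     re t * (1 - cos (An t) ^+ 2 - sin (An t) ^+ 2) by rewrite /k5 /k4; ring.
  by rewrite K K' cs1; ring.
pose al t := An t / 2.
have Dal t : 0 <= t <= t1 -> has_deriv al t (angular eps c l X h t / 2).
  move=> tt; have H := DA t tt; have sn : sq t != 0 by rewrite gt_eqF// spos.
  have E2 := @clock_angular R eps c l X h t sn.
  rewrite -!/(sq _) -!/(re _) -!/(Z _) -!/(Q _) -!/(Th _) in E2.
  by rewrite /al; der; rewrite E2 -csE//; ring.
have DX t : 0 <= t <= t1 ->
    has_deriv (X ^~ 0%N) t ((kap t * X t 0 - angular eps c l X h t * X t 1) / 2) /\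
    has_deriv (X ^~ 1%N) t ((kap t * X t 1 + angular eps c l X h t * X t 0) / 2).
  move=> tt; have tab := inab tt; split.
    have H0 : has_deriv (X ^~ 0%N) t (h t * (speed c (X t) l *
      (X t 0 * radial_rate eps c (X t) l - X t 1 * angular_rate eps c (X t) l))).
      exact: HX.
    by apply: der_eq H0 _; rewrite /kap /radial /angular; field.
  have H1 : has_deriv (X ^~ 1%N) t (h t * (speed c (X t) l *
    (X t 1 * radial_rate eps c (X t) l + X t 0 * angular_rate eps c (X t) l))).
    exact: HX.
  by apply: der_eq H1 _; rewrite /kap /radial /angular; field.
have halfkap t : a < t < b -> {for t, continuous (fun t => kap t / 2)}.
  by move=> tab; have h1 := kapcat tab; cat.
pose k6 t := X t 1 * cos (al t) - X t 0 * sin (al t).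
pose k7 t := X t 0 * cos (al t) + X t 1 * sin (al t) - Num.sqrt (sq t).
have Dk6 t : 0 <= t <= t1 -> has_deriv k6 t (kap t / 2 * k6 t).
  move=> tt; have [H1 H2] := DX t tt; have H3 := Dal t tt.
  by rewrite /k6; der; field.
have Dk7 t : 0 <= t <= t1 -> has_deriv k7 t (kap t / 2 * k7 t).
  move=> tt; have [H1 H2] := DX t tt; have H3 := Dal t tt.
  have [_ _ _ _ H4] := D t tt; have st := spos t tt.
  have H5 := der_sqrt st H4.
  rewrite /k7; der; have := sqr_sqrtr (ltW st).
  have : Num.sqrt (sq t) != 0 by rewrite gt_eqF// sqrtr_gt0.
  by move: (Num.sqrt _) => q q0 <-; field.
have k60 t : 0 <= t <= t1 -> k6 t = 0.
  have [E [_ HE]] := linear halfkap Dk6; move/HE ->.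
  by rewrite /k6 /al /An be0 X00 X01; ring.
have k70 t : 0 <= t <= t1 -> k7 t = 0.
  have [E [_ HE]] := linear halfkap Dk7; move/HE ->.
  rewrite /k7 /al /An be0 X00 X01.
  set q := Num.sqrt _; set x := _ / 2.
  have -> : q * cos x * cos x + q * sin x * sin x - q =
    q * (cos x ^+ 2 + sin x ^+ 2 - 1) by ring.
  by rewrite cs1; ring.
have X0E t : 0 <= t <= t1 -> X t 0%N = Num.sqrt (sq t) * cos ((be t + Q t) / 2).
  move=> tt; have K := k60 t tt; have K' := k70 t tt; rewrite -/(An t) -/(al t).
  have -> : X t 0 = (k7 t + Num.sqrt (sq t)) * cos (al t) - k6 t * sin (al t) +
     X t 0 * (1 - cos (al t) ^+ 2 - sin (al t) ^+ 2) by rewrite /k7 /k6; ring.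
  by rewrite K K' cs1; ring.
have X1E t : 0 <= t <= t1 -> X t 1%N = Num.sqrt (sq t) * sin ((be t + Q t) / 2).
  move=> tt; have K := k60 t tt; have K' := k70 t tt; rewrite -/(An t) -/(al t).
  have -> : X t 1 = (k7 t + Num.sqrt (sq t)) * sin (al t) + k6 t * cos (al t) +
     X t 1 * (1 - cos (al t) ^+ 2 - sin (al t) ^+ 2) by rewrite /k7 /k6; ring.
  by rewrite K K' cs1; ring.
have csc t : 0 <= t <= t1 -> cs t = Th t * cos (be t + r t * sin (th t)).
  move=> tt; rewrite -csE// reE// -QE//; field; by rewrite gt_eqF// spos.
exists th, r, be; split=> [|t tt|t tt].
- split=> //; rewrite /r th00 Z0 Q0.
  have -> : r0 * cos th0 * cos th0 + r0 * sin th0 * sin th0 =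
    r0 * (cos th0 ^+ 2 + sin th0 ^+ 2) by ring.
  by rewrite cs1; ring.
- split; first exact: Dth.
    by apply: der_eq (Dr t tt) _; rewrite csc// /slow; ring.
  by apply: der_eq (Dbe t tt) _; rewrite csc// QE// /slow; ring.
- by split; [exact: ZE|exact: QE|exact: X0E|exact: X1E].
Qed.

End Lift.

(** * Polar coordinates *)

Section Polar.
Context {R : realType}.
Implicit Types (x y t r p q : R).

Lemma cos2_sin2 x : cos x * cos x + sin x * sin x = 1 :> R.
Proof. by rewrite -!expr2 cos2Dsin2. Qed.

Lemma polar_exists p q r : 0 < r -> p ^+ 2 + q ^+ 2 = r ^+ 2 ->
  exists t, p = r * cos t /\ q = r * sin t.
Proof.
move=> r0 E; have rn : r != 0 by rewrite gt_eqF.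
have E1 : (p / r) ^+ 2 + (q / r) ^+ 2 = 1.
  by rewrite !expr_div_n -mulrDl E divff// expf_neq0.
have p1 : -1 <= p / r <= 1.
  rewrite -ler_norml -(@ler_pXn2r _ 2)// ?nnegrE// real_normK ?num_real// expr1n -E1.
  by rewrite lerDl sqr_ge0.
pose t := acos (p / r).
have ct : cos t = p / r by rewrite acosK.
have st : sin t = Num.sqrt ((q / r) ^+ 2).
  by rewrite sin_acos//; congr Num.sqrt; lra.
have [q0|q0] := leP 0 q.
  exists t; rewrite ct st sqrtr_sqr ger0_norm ?divr_ge0// ?ltW//.
  by split; field.
exists (- t); rewrite cosN sinN ct st sqrtr_sqr ltr0_norm; last first.
  by rewrite ltr_pdivrMr// mul0r.
by split; field.
Qed.

Lemma half_angle_sin x : 0 <= x <= pi / 2 -> x / 2 <= sin x.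
Proof.
move=> /andP[x0 x1]; have p0 := @pi_gt0 R.
have p4 : 0 <= pi / 4 :> R by rewrite divr_ge0// ltW.
have c4 : cos (pi / 4) ^+ 2 = 1 / 2 :> R.
  have := @cosD R (pi / 4) (pi / 4).
  rewrite (_ : pi / 4 + pi / 4 = pi / 2); last by field.
  by rewrite cos_pihalf -!expr2 sin2cos2 => H; move: H; lra.
pose y := x / 2.
have yle : y <= pi / 4 by rewrite /y; lra.
have y0 : 0 <= y by rewrite /y; lra.
have cpos z : 0 <= z <= pi / 4 -> cos (pi / 4) <= cos z.
  move=> /andP[z0 z1]; rewrite le_eqVlt; have [->|zn] := eqVneq z (pi / 4).
    by rewrite eqxx.
  by rewrite ltr_cos ?in_itv/= ?z0 ?p4//= ?lt_neqAle ?zn ?z1 ?orbT//; lra.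
have c40 : 0 <= cos (pi / 4) :> R.
  by rewrite cos_ge0_pihalf//; apply/andP; split; lra.
have sy : y * cos (pi / 4) <= sin y.
  have [z /andP[z0 zy] E] := mvt y0 (fun z _ => is_derive_sin z : has_deriv sin z (cos z)).
  rewrite sin0 !subr0 in E; rewrite E mulrC ler_wpM2r// cpos// z0.
  exact: le_trans yle.
have -> : x = y + y by rewrite /y; field.
rewrite sinD.
have : y * cos (pi / 4) * cos (pi / 4) <= sin y * cos y.
  apply: ler_pM => //; first by rewrite mulr_ge0.
  by apply: cpos; rewrite y0.
rewrite -mulrA -expr2 c4; lra.
Qed.

Lemma circle_dist x : exists2 z : R, z \is a Num.int &
  `|x - z| <= `|1 - cos (2 * pi * x)| + `|sin (2 * pi * x)|.
Proof.
have p0 := @pi_gt0 R.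
have p2 := @pi_ge2 R.
pose z : R := (Num.floor (x + 1 / 2))%:~R.
have zint : z \is a Num.int by rewrite /z intr_int.
pose y := x - z.
have yle : `|y| <= 1 / 2.
  have /andP[h1 h2] := floor_itv (x + 1 / 2); move: h2; rewrite intrD => h2.
  by rewrite ler_norml /y /z; apply/andP; split; lra.
have [cE sE] : cos (2 * pi * x) = cos (2 * pi * y) /\ sin (2 * pi * x) = sin (2 * pi * y).
  have -> : 2 * pi * x = 2 * pi * y + (2 * pi) *~ Num.floor (x + 1 / 2).
    by rewrite -mulrzr /y; ring.
  rewrite (periodic_int (f := cos)); last exact: cos2piD.
  by rewrite (periodic_int (f := sin)); last exact: sin2piD.
exists z => //; rewrite cE sE -/y.
have -> : 2 * pi * y = pi * y + pi * y by ring.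
set u := pi * y; have cu2 : cos u * cos u = 1 - sin u * sin u.
  by have := cos2_sin2 u; lra.
have -> : 1 - cos (u + u) = 2 * (sin u * sin u) by rewrite cosD cu2; ring.
have su : `|u| / 2 <= `|sin u|.
  have -> : `|sin u| = sin `|u|.
    have [u0|u0] := leP 0 u.
      rewrite (ger0_norm u0) ger0_norm//; apply: sin_ge0_pi; rewrite u0/=.
      by move: yle; rewrite ler_norml /u => /andP[_]; rewrite -(ler_pM2l p0); lra.
    rewrite (ltr0_norm u0) sinN ler0_norm// -oppr_ge0 -sinN; apply: sin_ge0_pi.
    rewrite oppr_ge0 ltW//=.
    by move: yle; rewrite ler_norml /u => /andP[+ _]; rewrite -(ler_pM2l p0); lra.
  apply: half_angle_sin; rewrite normr_ge0/= /u normrM (gtr0_norm p0).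
  by have := ler_wpM2l (ltW p0) yle; lra.
have yu : `|y| <= `|sin u|.
  apply: le_trans su; rewrite /u normrM (gtr0_norm p0).
  have : 2 * `|y| <= pi * `|y| by rewrite ler_wpM2r.
  lra.
apply: le_trans yu _; rewrite sinD (mulrC (cos u)).
have -> : sin u * cos u + sin u * cos u = 2 * (sin u * cos u) by ring.
rewrite !normrM !(ger0_norm (_ : 0 <= 2 :> R))//.
set s := `|sin u|; set k := `|cos u|.
have s0 : 0 <= s := normr_ge0 _; have k0 : 0 <= k := normr_ge0 _.
have sk : s * s + k * k = 1.
  by rewrite /s /k -!normrM !ger0_norm -?expr2 ?sqr_ge0// addrC cos2Dsin2.
have sk1 : 1 <= s + k.
  rewrite -(@ler_pXn2r _ 2)// ?nnegrE ?addr_ge0// expr1n sqrrD !expr2.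
  by have := mulr_ge0 s0 k0; rewrite -mulr_natl; lra.
have := ler_wpM2l s0 sk1; have := mulr_ge0 s0 s0; have := mulr_ge0 s0 k0; lra.
Qed.

Lemma angle_dist x y : exists2 z : R, z \is a Num.int &
  `|x - y - z| <= 3 * (`|cos (2 * pi * x) - cos (2 * pi * y)| +
    `|sin (2 * pi * x) - sin (2 * pi * y)|).
Proof.
have [z zint Hz] := circle_dist (x - y); exists z => //; apply: le_trans Hz _.
set u := 2 * pi * x; set v := 2 * pi * y.
have -> : 2 * pi * (x - y) = u - v by rewrite /u /v; ring.
rewrite cosB sinB.
have -> : 1 - (cos u * cos v + sin u * sin v) =
   1 / 2 * ((cos u - cos v) * (cos u - cos v) + (sin u - sin v) * (sin u - sin v)).
  have := cos2_sin2 u; have := cos2_sin2 v; lra.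
have -> : sin u * cos v - cos u * sin v =
  (sin u - sin v) * cos v - (cos u - cos v) * sin v by ring.
have sq (f : R -> R) : (forall x, `|f x| <= 1) ->
    (f u - f v) * (f u - f v) <= 2 * `|f u - f v|.
  move=> f1; apply: le_trans (ler_norm _) _; rewrite normrM ler_wpM2r//.
  by apply: le_trans (ler_normB _ _) _; have := f1 u; have := f1 v; lra.
have sc := sq _ (@cos_max R); have ss := sq _ (@sin_max R).
have n1 : `|(sin u - sin v) * cos v| <= `|sin u - sin v|.
  by rewrite normrM ler_piMr// cos_max.
have n2 : `|(cos u - cos v) * sin v| <= `|cos u - cos v|.
  by rewrite normrM ler_piMr// sin_max.
have := ler_normB ((sin u - sin v) * cos v) ((cos u - cos v) * sin v).
rewrite [`|1 / 2 * _|]ger0_norm; last by rewrite mulr_ge0// addr_ge0// -expr2 sqr_ge0.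
have := normr_ge0 (sin u - sin v); have := normr_ge0 (cos u - cos v); lra.
Qed.

Lemma polar_lip r r' r0 t t' d : 0 < r0 -> r0 <= r -> r0 <= r' ->
  `|r * cos t - r' * cos t'| <= d -> `|r * sin t - r' * sin t'| <= d ->
  [/\ `|r - r'| <= 2 * d, `|cos t - cos t'| <= 3 * d / r0 &
      `|sin t - sin t'| <= 3 * d / r0].
Proof.
move=> r00 rr rr' hc hs.
have rE x k : x = (x * cos k) * cos k + (x * sin k) * sin k.
  by rewrite -[LHS]mulr1 -(cos2_sin2 k); ring.
have half x x' k k' : 0 <= x -> 0 <= x' -> `|x * cos k - x' * cos k'| <= d ->
    `|x * sin k - x' * sin k'| <= d -> x - x' <= 2 * d.
  move=> x0 x'0 h1 h2.
  have e1 : (x * cos k - x' * cos k') * cos k <= d.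
    apply: le_trans (ler_norm _) _; rewrite normrM; apply: le_trans h1.
    by rewrite ler_piMr// cos_max.
  have e2 : (x * sin k - x' * sin k') * sin k <= d.
    apply: le_trans (ler_norm _) _; rewrite normrM; apply: le_trans h2.
    by rewrite ler_piMr// sin_max.
  have e3 : x' * (cos k' * cos k + sin k' * sin k) <= x'.
    by rewrite ler_piMr// -cosB; exact: cos_le1.
  have := rE x k; lra.
have r0' : 0 <= r by lra.
have r1' : 0 <= r' by lra.
have dr : `|r - r'| <= 2 * d.
  rewrite ler_norml; apply/andP; split; last exact: half hc hs.
  by have := half r' r t' t r1' r0'; rewrite distrC (distrC (r' * sin _)) => /(_ hc hs); lra.
have key (u v : R) : `|v| <= 1 -> `|r * u - r' * v| <= d -> `|u - v| <= 3 * d / r0.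
  move=> v1 h; rewrite ler_pdivlMr//.
  apply: le_trans (_ : `|r * (u - v)| <= _).
    by rewrite normrM (ger0_norm r0') mulrC ler_wpM2r.
  have -> : r * (u - v) = (r * u - r' * v) - (r - r') * v by ring.
  apply: le_trans (ler_normB _ _) _; rewrite [`|(r - r') * v|]normrM.
  have : `|r - r'| * `|v| <= `|r - r'| by rewrite ler_piMr.
  lra.
by split=> //; apply: key => //; [exact: cos_max|exact: sin_max].
Qed.

Lemma polar_near r1 r0 t1 p q d : 0 < r0 -> 2 * r0 <= r1 -> d <= r0 / 4 ->
  `|p - r1 * cos t1| <= d -> `|q - r1 * sin t1| <= d ->
  exists r t, [/\ p = r * cos t, q = r * sin t, r0 <= r, `|r - r1| <= 2 * d &
    `|t - t1| <= 2 * pi * (18 * d / r0)].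
Proof.
move=> r00 r01 dr hp hq; have p0 : 0 < pi :> R := pi_gt0 R.
have d0 : 0 <= d by apply: le_trans hp.
pose r := Num.sqrt (p ^+ 2 + q ^+ 2).
have s0 : 0 <= p ^+ 2 + q ^+ 2 by rewrite addr_ge0 ?sqr_ge0.
have rsq : p ^+ 2 + q ^+ 2 = r ^+ 2 by rewrite sqr_sqrtr.
have rge : r0 <= r.
  rewrite leNgt; apply/negP => rr.
  have pr : `|p| <= r by rewrite -sqrtr_sqr ler_sqrt// lerDl sqr_ge0.
  have qr : `|q| <= r by rewrite -sqrtr_sqr ler_sqrt// lerDr sqr_ge0.
  have e1 : `|r1 * cos t1| <= r + d.
    by have := ler_normB p (p - r1 * cos t1); rewrite subKr; lra.
  have e2 : `|r1 * sin t1| <= r + d.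
    by have := ler_normB q (q - r1 * sin t1); rewrite subKr; lra.
  have key (x y : R) : `|x| <= y -> x * x <= y * y.
    by move=> xy; apply: le_trans (ler_norm _) _; rewrite normrM; apply: ler_pM.
  have k0 := key _ _ e1; have k1 := key _ _ e2.
  have kp : (p - r1 * cos t1) * (p - r1 * cos t1) <= d * d by exact: key.
  have kq : (q - r1 * sin t1) * (q - r1 * sin t1) <= d * d by exact: key.
  pose P := p * cos t1 + q * sin t1.
  have P1 : r1 - P <= 2 * d.
    have -> : r1 - P = - ((p - r1 * cos t1) * cos t1) - (q - r1 * sin t1) * sin t1.
      have : r1 = r1 * (cos t1 * cos t1 + sin t1 * sin t1) by rewrite cos2_sin2 mulr1.
      by rewrite /P; lra.
    have h1 : `|(p - r1 * cos t1) * cos t1| <= d.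
      by rewrite normrM; apply: le_trans hp; rewrite ler_piMr// cos_max.
    have h2 : `|(q - r1 * sin t1) * sin t1| <= d.
      by rewrite normrM; apply: le_trans hq; rewrite ler_piMr// sin_max.
    by move: h1 h2; rewrite !ler_norml => /andP[+ _] /andP[+ _]; lra.
  have P2 : P <= r.
    have r0' : 0 <= r by rewrite sqrtr_ge0.
    apply: le_trans (ler_norm _) _; rewrite -(@ler_pXn2r _ 2)// ?nnegrE//.
    rewrite real_normK ?num_real// -rsq.
    have -> : p ^+ 2 + q ^+ 2 = P ^+ 2 + (p * sin t1 - q * cos t1) ^+ 2.
      rewrite -[LHS]mulr1 -(cos2_sin2 t1) /P; ring.
    by rewrite lerDl sqr_ge0.
  lra.
have rpos : 0 < r by exact: lt_le_trans rge.
have [t [pE qE]] := polar_exists rpos rsq.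
have r1r : r0 <= r1 by lra.
have hp' : `|r * cos t - r1 * cos t1| <= d by rewrite -pE.
have hq' : `|r * sin t - r1 * sin t1| <= d by rewrite -qE.
have [dr1 dc ds] := polar_lip r00 rge r1r hp' hq'.
have [z zint Hz] := angle_dist (t / (2 * pi)) (t1 / (2 * pi)).
have p2 : 2 * pi != 0 :> R by rewrite mulf_neq0// gt_eqF.
rewrite !(mulrC (2 * pi)) !divfK// in Hz.
exists r, (t - 2 * pi * z); have [m zE] := intrP zint.
have tE : t = t - 2 * pi * z + (2 * pi) *~ m by rewrite zE mulrzr subrK.
have cE : cos (t - 2 * pi * z) = cos t.
  by rewrite [in RHS]tE (periodic_int (f := cos))//; exact: cos2piD.
have sE : sin (t - 2 * pi * z) = sin t.
  by rewrite [in RHS]tE (periodic_int (f := sin))//; exact: sin2piD.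
split=> //; rewrite ?cE ?sE//.
have -> : t - 2 * pi * z - t1 = 2 * pi * (t / (2 * pi) - t1 / (2 * pi) - z).
  have F (P : R) : P != 0 -> t - P * z - t1 = P * (t / P - t1 / P - z) by move=> ?; field.
  exact: F.
rewrite normrM (ger0_norm (_ : 0 <= 2 * pi)); last by rewrite mulr_ge0// ltW.
apply: ler_wpM2l; first by rewrite mulr_ge0// ltW.
by apply: le_trans Hz _; have -> : 18 * d / r0 = 3 * (3 * d / r0 + 3 * d / r0); [field; rewrite gt_eqF|rewrite ler_wpM2l// lerD].
Qed.

End Polar.

(** * Nested tori *)

Section NestedExt.
Context {A : comNzRingType} (c : A).
Implicit Types (u v : nat -> A).

Lemma sigS u l : sig c u l.+1 = sig c u l ^+ 2 + u l.+1 ^+ 2 - c.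
Proof. by []. Qed.

Lemma tfacS u l : tfac c u l.+1 = tfac c u l * (2 * (sig c u l.+1 + c)).
Proof. by []. Qed.

Lemma vfS u l j : vf c u l.+1 j =
  if j == l.+1 then u l.+1 * tfac c u l else sig c u l * vf c u l j.
Proof. by []. Qed.

Lemma sig_ext u v l : (forall j, (j <= l)%N -> u j = v j) -> sig c u l = sig c v l.
Proof.
elim: l => [|l IH] E /=; first exact: E.
by rewrite IH ?E// => j jl; apply: E; exact: leqW.
Qed.

Lemma tfac_ext u v l : (forall j, (j <= l)%N -> u j = v j) -> tfac c u l = tfac c v l.
Proof.
elim: l => [|l IH] E //; rewrite !tfacS (sig_ext E) IH// => j jl.
by apply: E; exact: leqW.
Qed.

Lemma vf_ext u v l k : (forall j, (j <= l)%N -> u j = v j) -> vf c u l k = vf c v l k.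
Proof.
elim: l => [|l IH] E //=; have E' j : (j <= l)%N -> u j = v j.
  by move=> jl; apply: E; exact: leqW.
by rewrite (sig_ext E') (tfac_ext E') (IH E') E.
Qed.

End NestedExt.

Section NestedPoint.
Context {R : realType}.
Variable B : R.
Hypothesis B3 : 3 <= B.
Let c := 2 * B.
Implicit Types (u ph : nat -> R) (z y : R).

(* The point of the nested torus at height [z] with angles [ph 1], ..., [ph l]. *)
Fixpoint psi l ph z (j : nat) : R :=
  if l is l'.+1 then
    let r := Num.sqrt (z + 2 * B) in
    if j == l then r * sin (2 * pi * ph l) else psi l' ph (r * cos (2 * pi * ph l)) j
  else z.

Lemma rad_bounds z : `|z| <= B ->
  [/\ 0 < z + c, B <= z + c, 1 <= Num.sqrt (z + c) & Num.sqrt (z + c) <= B].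
Proof.
rewrite ler_norml => /andP[z1 z2]; have zc : B <= z + c by rewrite /c; lra.
have z0 : 0 < z + c by move: B3; lra.
split=> //.
  by rewrite -[leLHS]sqrtr1 ler_sqrt//; move: B3; lra.
have -> : B = Num.sqrt (B ^+ 2) by rewrite sqrtr_sqr ger0_norm//; move: B3; lra.
rewrite ler_sqrt ?sqr_ge0// expr2; apply: le_trans (_ : 3 * B <= _).
  by rewrite /c; lra.
by rewrite ler_wpM2r//; move: B3; lra.
Qed.

Lemma rad_le z (k : R) : `|z| <= B -> `|k| <= 1 -> `|Num.sqrt (z + c) * k| <= B.
Proof.
move=> /rad_bounds[_ _ h1 h2] k1; rewrite normrM ger0_norm ?sqrtr_ge0//.
by apply: le_trans h2; rewrite ler_piMr ?sqrtr_ge0.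
Qed.

Lemma psi_ext l ph ph' z j :
  (forall k, (0 < k <= l)%N -> cos (2 * pi * ph k) = cos (2 * pi * ph' k) /\
     sin (2 * pi * ph k) = sin (2 * pi * ph' k)) ->
  psi l ph z j = psi l ph' z j.
Proof.
elim: l z => [//|l IH] z E /=; have [|-> ->] := E l.+1; first by rewrite leqnn.
case: eqP => // _; apply: IH => k /andP[k0 kl]; apply: E.
by rewrite k0 leqW.
Qed.

Lemma psi_le l ph z j : `|z| <= B -> `|psi l ph z j| <= B.
Proof.
elim: l z => [//|l IH] z zB /=; case: ifP => _.
  by apply: rad_le => //; exact: sin_max.
by apply/IH/rad_le => //; exact: cos_max.
Qed.

Lemma psi_low l ph z j : (j <= l)%N ->
  psi l.+1 ph z j = psi l ph (Num.sqrt (z + c) * cos (2 * pi * ph l.+1)) j.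
Proof. by move=> jl /=; rewrite ltn_eqF. Qed.

Lemma sig_psi l ph z : `|z| <= B -> sig c (psi l ph z) l = z.
Proof.
elim: l z => [//|l IH] z zB; rewrite sigS.
rewrite (@sig_ext _ c _ (psi l ph (Num.sqrt (z + c) * cos (2 * pi * ph l.+1)))); last first.
  by move=> j jl; exact: psi_low.
rewrite IH; last by apply: rad_le => //; exact: cos_max.
rewrite /= eqxx !exprMn; have [z0 _ _ _] := rad_bounds zB.
by rewrite sqr_sqrtr ?ltW// cos2sin2 /c; ring.
Qed.

Lemma sig_psi_mid l ph z j : `|z| <= B -> (j < l)%N ->
  [/\ `|sig c (psi l ph z) j.+1| <= B,
      sig c (psi l ph z) j = Num.sqrt (sig c (psi l ph z) j.+1 + c) * cos (2 * pi * ph j.+1) &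
      psi l ph z j.+1 = Num.sqrt (sig c (psi l ph z) j.+1 + c) * sin (2 * pi * ph j.+1)].
Proof.
elim: l z => [//|l IH] z zB; rewrite ltnS => jl.
have yB : `|Num.sqrt (z + c) * cos (2 * pi * ph l.+1)| <= B.
  by apply: rad_le => //; exact: cos_max.
have low k : (k <= l)%N -> sig c (psi l.+1 ph z) k =
    sig c (psi l ph (Num.sqrt (z + c) * cos (2 * pi * ph l.+1))) k.
  by move=> kl; apply: sig_ext => i ik; apply: psi_low; exact: leq_trans kl.
have [jl'|lj] := ltnP j l.
  by have := IH _ yB jl'; rewrite !low//; rewrite psi_low.
have -> : j = l by apply/eqP; rewrite eqn_leq jl.
rewrite sig_psi// low// sig_psi//; split=> //.
by rewrite /= eqxx.
Qed.

Lemma psi_der l ph (z : R -> R) (f t : R) : `|z t| <= B ->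
  has_deriv z t (f * tfac c (psi l ph (z t)) l) ->
  forall j, (j <= l)%N ->
  has_deriv (fun t => psi l ph (z t) j) t (f * vf c (psi l ph (z t)) l j).
Proof.
elim: l z f => [|l IH] z f zB Dz j jl; first by [].
have [z0 _ _ _] := rad_bounds zB.
set r := Num.sqrt (z t + c); set th := 2 * pi * ph l.+1.
have yB : `|r * cos th| <= B by apply: rad_le => //; exact: cos_max.
have E k : (k <= l)%N -> psi l.+1 ph (z t) k = psi l ph (r * cos th) k.
  exact: psi_low.
pose T := tfac c (psi l ph (r * cos th)) l.
have TE : tfac c (psi l.+1 ph (z t)) l.+1 = T * (2 * r ^+ 2).
  rewrite tfacS sig_psi// (tfac_ext _ E).
  by rewrite sqr_sqrtr// ltW.
have rn : r != 0 by rewrite gt_eqF// sqrtr_gt0.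
have Dr : has_deriv (fun t => Num.sqrt (z t + c)) t (f * T * r).
  have Dz' : has_deriv (fun t => z t + c) t (f * (T * (2 * r ^+ 2))).
    by rewrite TE in Dz; der; ring.
  have H := @der_sqrt _ (fun t => z t + c) t _ z0 Dz'.
  by apply: der_eq H _; rewrite -/r; field.
rewrite vfS; have [->|jn] := eqVneq j l.+1.
  rewrite (tfac_ext _ E) -/T.
  have -> : psi l.+1 ph (z t) l.+1 = r * sin th by rewrite /= eqxx.
  have -> : (fun t => psi l.+1 ph (z t) l.+1) = fun t => Num.sqrt (z t + c) * sin th.
    by apply/funext => t'; rewrite /= eqxx.
  by der; ring.
have jl' : (j <= l)%N by rewrite -ltnS ltn_neqAle jn jl.
have -> : (fun t => psi l.+1 ph (z t) j) =
    fun t => psi l ph (Num.sqrt (z t + c) * cos th) j.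
  by apply/funext => t'; exact: psi_low.
rewrite (sig_ext _ E) (vf_ext _ _ E) sig_psi//.
rewrite [f * _]mulrA.
apply: (IH (fun t => Num.sqrt (z t + c) * cos th) (f * (r * cos th)) yB _ j jl').
by der; rewrite -/r -/T; ring.
Qed.

Lemma sqrt_lip (x y : R) : 1 <= x -> 1 <= y ->
  `|Num.sqrt x - Num.sqrt y| <= `|x - y|.
Proof.
move=> x1 y1; have sx : 1 <= Num.sqrt x by rewrite -[leLHS]sqrtr1 ler_sqrt//; lra.
have sy : 1 <= Num.sqrt y by rewrite -[leLHS]sqrtr1 ler_sqrt//; lra.
have -> : x - y = (Num.sqrt x - Num.sqrt y) * (Num.sqrt x + Num.sqrt y).
  have Ex : Num.sqrt x ^+ 2 = x by rewrite sqr_sqrtr//; lra.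
  have Ey : Num.sqrt y ^+ 2 = y by rewrite sqr_sqrtr//; lra.
  by rewrite -[in LHS]Ex -[in LHS]Ey; ring.
rewrite normrM ler_peMr// ger0_norm; lra.
Qed.

Lemma psi_lip l ph z z' j : `|z| <= B -> `|z'| <= B ->
  `|psi l ph z j - psi l ph z' j| <= `|z - z'|.
Proof.
elim: l z z' => [//|l IH] z z' zB z'B /=.
have [_ zc _ _] := rad_bounds zB; have [_ zc' _ _] := rad_bounds z'B.
have rr : `|Num.sqrt (z + c) - Num.sqrt (z' + c)| <= `|z - z'|.
  apply: le_trans (sqrt_lip _ _) _; [by move: B3; lra|by move: B3; lra|].
  by rewrite (_ : z + c - (z' + c) = z - z')//; ring.
have sc (k : R) : `|k| <= 1 ->
    `|Num.sqrt (z + c) * k - Num.sqrt (z' + c) * k| <= `|z - z'|.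
  by move=> k1; rewrite -mulrBl normrM; apply: le_trans rr; rewrite ler_piMr.
case: ifP => _; first by apply: sc; exact: sin_max.
apply: le_trans (IH _ _ _ _) _; [exact: rad_le (cos_max _)|exact: rad_le (cos_max _)|].
by apply: sc; exact: cos_max.
Qed.

Lemma sig_bounds u l j : `|sig c u l| <= B -> (j <= l)%N ->
  `|sig c u j| <= B /\ `|u j| <= B.
Proof.
elim: l j => [|l IH] j; first by rewrite leqn0 => uB /eqP ->.
move=> sB; have [_ _ r1 rB] := rad_bounds sB.
have [s0 _ _ _] := rad_bounds sB.
have E : sig c u l.+1 + c = sig c u l ^+ 2 + u l.+1 ^+ 2 by rewrite sigS subrK.
have key (x y : R) : x ^+ 2 + y ^+ 2 = sig c u l.+1 + c -> `|x| <= B.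
  move=> H; apply: le_trans rB; rewrite -sqrtr_sqr -H ler_sqrt ?addr_ge0 ?sqr_ge0//.
  by rewrite lerDl sqr_ge0.
have lB : `|sig c u l| <= B by apply: (key _ (u l.+1)).
have uB : `|u l.+1| <= B by apply: (key _ (sig c u l)); rewrite addrC.
rewrite leq_eqVlt => /predU1P[->//|]; rewrite ltnS; exact: IH.
Qed.

Lemma psi_surj u l : `|sig c u l| <= B ->
  exists ph, forall j, (j <= l)%N -> u j = psi l ph (sig c u l) j.
Proof.
elim: l => [|l IH] sB.
  by exists (fun=> 0) => j; rewrite leqn0 => /eqP ->.
have [s0 _ r1 _] := rad_bounds sB.
have [lB _] := sig_bounds sB (leqnSn l).
have [ph Hph] := IH lB.
have r0 : 0 < Num.sqrt (sig c u l.+1 + c) by rewrite sqrtr_gt0.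
have [t [Ec Es]] : exists t, sig c u l = Num.sqrt (sig c u l.+1 + c) * cos t /\
    u l.+1 = Num.sqrt (sig c u l.+1 + c) * sin t.
  by apply: polar_exists => //; rewrite sqr_sqrtr ?ltW// sigS subrK.
have p2 : 2 * pi != 0 :> R by rewrite mulf_neq0// gt_eqF// pi_gt0.
have tE : 2 * pi * (t / (2 * pi)) = t by rewrite mulrC divfK.
exists (fun i => if i == l.+1 then t / (2 * pi) else ph i) => j jl.
rewrite [psi _ _ _ _]/= eqxx tE -Ec -/c.
case: eqP => [->//|/eqP jn].
have jl' : (j <= l)%N by rewrite -ltnS ltn_neqAle jn jl.
rewrite Hph//; apply: psi_ext => k /andP[_ kl].
by rewrite ltn_eqF.
Qed.

Lemma sig_lip u v l d : `|sig c u l| <= B -> `|sig c v l| <= B ->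
  (forall j, (j <= l)%N -> `|u j - v j| <= d) ->
  forall j, (j <= l)%N -> `|sig c u j - sig c v j| <= (4 * B) ^+ j * d.
Proof.
move=> su sv H; elim=> [|j IHj] jl; first by rewrite expr0 mul1r; exact: H.
  have d0 : 0 <= d by apply: le_trans (H 0 (leq0n _)).
  have [s1 _] := sig_bounds su (ltnW jl); have [s2 _] := sig_bounds sv (ltnW jl).
  have [_ u1] := sig_bounds su jl; have [_ u2] := sig_bounds sv jl.
  have -> : sig c u j.+1 - sig c v j.+1 =
    (sig c u j - sig c v j) * (sig c u j + sig c v j) +
    (u j.+1 - v j.+1) * (u j.+1 + v j.+1) by rewrite !sigS; ring.
  apply: le_trans (ler_normD _ _) _; rewrite !normrM.
  have h1 : `|sig c u j + sig c v j| <= 2 * B by have := ler_normD (sig c u j) (sig c v j); lra.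
  have h2 : `|u j.+1 + v j.+1| <= 2 * B by have := ler_normD (u j.+1) (v j.+1); lra.
  have k1 := ler_pM (normr_ge0 _) (normr_ge0 _) (IHj (ltnW jl)) h1.
  have k2 := ler_pM (normr_ge0 _) (normr_ge0 _) (H _ jl) h2.
  have e1 : 1 <= (4 * B) ^+ j by rewrite exprn_ege1//; move: B3; lra.
  have : d * (2 * B) <= (4 * B) ^+ j * d * (2 * B).
    by rewrite ler_wpM2r//; [move: B3; lra|rewrite ler_peMl].
  rewrite exprS; lra.
Qed.

Lemma tfac_bounds u l : `|sig c u l| <= B -> 1 <= tfac c u l <= (6 * B) ^+ l.
Proof.
elim: l => [|l IH] sB; first by rewrite /= expr0 lexx.
have [lB _] := sig_bounds sB (leqnSn l); have /andP[h1 h2] := IH lB.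
move: sB; rewrite tfacS ler_norml => /andP[s1 s2].
have k1 : 1 <= 2 * (sig c u l.+1 + c) by rewrite /c; move: B3; lra.
have k2 : 2 * (sig c u l.+1 + c) <= 6 * B by rewrite /c; lra.
apply/andP; split; first by rewrite -[leLHS]mulr1; apply: ler_pM.
rewrite exprS mulrC; apply: ler_pM => //; lra.
Qed.

End NestedPoint.

(** * Bounded Lipschitz functions of class C^1 and torus embeddings *)

Section RegularFunctions.
Context {R : realType} {m : nat}.
Implicit Types (f g : 'rV[R]_m -> R) (x y v : 'rV[R]_m).

Lemma norm_entry_le x i : `|x 0 i| <= `|x|.
Proof.
rewrite [leRHS]/Num.Def.normr/= mx_normrE.
by apply: le_trans (le_bigmax _ _ (0, i)); rewrite /=.
Qed.

Lemma norm_le_entries x (K : R) : 0 <= K -> (forall i, `|x 0 i| <= K) -> `|x| <= K.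
Proof.
move=> K0 H; rewrite [leLHS]/Num.Def.normr/= mx_normrE.
by apply: bigmax_le => // -[i j] _ /=; rewrite (ord1 i).
Qed.

Definition lipC1 f : Prop :=
  [/\ exists K, forall x y, `|f x - f y| <= K * `|x - y|,
      forall x, differentiable f x &
      forall v, continuous (fun x => 'd f x v)].

Definition regular f : Prop := lipC1 f /\ exists K, forall x, `|f x| <= K.

Lemma regular_cst (a : R) : regular (fun=> a).
Proof.
split; last by exists `|a|.
split; first by exists 0 => x y; rewrite subrr normr0 mul0r.
  by move=> x; exact: differentiable_cst.
move=> v x; have -> : (fun x => 'd (fun _ : 'rV[R]_m => a) x v) = fun=> 0.
  by apply/funext => y; rewrite (diff_cst a).
exact: cst_continuous.
Qed.

Lemma lipC1_coord (i : 'I_m) : lipC1 (fun x => x 0 i).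
Proof.
have @f : {linear 'rV[R]_m -> R}.
  by exists (fun N : 'rV[R]_m => N 0 i); do 2![eexists]; do ?[constructor];
     rewrite ?mxE// => ? *; rewrite ?mxE//; move=> ?; rewrite !mxE.
have fc : continuous f by move=> x; exact: coord_continuous.
split.
- exists 1 => x y; rewrite mul1r.
  have -> : x 0 i - y 0 i = (x - y) 0 i by rewrite !mxE.
  exact: norm_entry_le.
- by move=> x; exact: differentiable_coord.
- move=> v x; have -> : (fun x => 'd (fun x : 'rV[R]_m => x 0 i) x v) = fun=> v 0 i.
    by apply/funext => y; rewrite (_ : (fun _ => _) = f)// (diff_lin _ fc).
  exact: cst_continuous.
Qed.

Lemma lipC1_add f g : lipC1 f -> lipC1 g -> lipC1 (fun x => f x + g x).
Proof.
move=> [[K HK] fd fc] [[K' HK'] gd gc]; split.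
- exists (K + K') => x y; have -> : f x + g x - (f y + g y) = (f x - f y) + (g x - g y) by ring.
  by rewrite (le_trans (ler_normD _ _))// mulrDl lerD.
- by move=> x; exact: differentiableD.
- move=> v x; have -> : (fun x => 'd (fun x => f x + g x) x v) = fun x => 'd f x v + 'd g x v.
    by apply/funext => y; rewrite (@diffD _ _ _ f g).
  exact: continuousD (fc v x) (gc v x).
Qed.

Lemma regular_add f g : regular f -> regular g -> regular (fun x => f x + g x).
Proof.
move=> [fl [K HK]] [gl [K' HK']]; split; first exact: lipC1_add.
by exists (K + K') => x; rewrite (le_trans (ler_normD _ _))// lerD.
Qed.

Lemma regular_mul f g : regular f -> regular g -> regular (fun x => f x * g x).
Proof.
move=> [[[K HK] fd fc] [C HC]] [[[K' HK'] gd gc] [C' HC']]; split; last first.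
  by exists (C * C') => x; rewrite normrM ler_pM.
split.
- exists (C' * K + C * K') => x y.
  have -> : f x * g x - f y * g y = g x * (f x - f y) + f y * (g x - g y) by ring.
  rewrite (le_trans (ler_normD _ _))// mulrDl; apply: lerD; rewrite normrM -mulrA.
    by apply: ler_pM.
  by apply: ler_pM.
- by move=> x; exact: differentiableM.
- move=> v x.
  have -> : (fun x => 'd (fun x => f x * g x) x v) =
      fun x => f x * 'd g x v + g x * 'd f x v.
    by apply/funext => y; rewrite (@diffM _ _ f g).
  apply: (@continuousD _ _ _ (fun x => f x * 'd g x v) (fun x => g x * 'd f x v)).
    apply: (@continuousM _ _ f (fun x => 'd g x v)); last exact: gc.
    exact: differentiable_continuous.
  apply: (@continuousM _ _ g (fun x => 'd f x v)); last exact: fc.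
  exact: differentiable_continuous.
Qed.

Lemma regular_exp f n : regular f -> regular (fun x => f x ^+ n).
Proof.
move=> fr; elim: n => [|n IH].
  have -> : (fun x => f x ^+ 0) = fun=> 1 by apply/funext => x; rewrite expr0.
  exact: regular_cst.
have -> : (fun x => f x ^+ n.+1) = fun x => f x * f x ^+ n.
  by apply/funext => x; rewrite exprS.
exact: regular_mul.
Qed.

Lemma lipC1_comp f (h h' : R -> R) (K : R) : lipC1 f -> 0 <= K ->
  (forall x, has_deriv h (f x) (h' (f x))) ->
  (forall x, {for f x, continuous h'}) ->
  (forall x y, `|h (f x) - h (f y)| <= K * `|f x - f y|) ->
  lipC1 (fun x => h (f x)).
Proof.
move=> [[C HC] fd fc] K0 hd hc HK; split.
- by exists (K * C) => x y; apply: le_trans (HK x y) _; rewrite -mulrA ler_wpM2l.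
- move=> x; apply: (@differentiable_comp _ _ _ _ f h) => //.
  by have [H _] := hd x; exact/derivable1_diffP.
- move=> v x.
  have -> : (fun x => 'd (fun x => h (f x)) x v) = fun x => 'd f x v * h' (f x).
    apply/funext => y; have [H E] := hd y.
    rewrite (@diff_comp _ _ _ _ f h)//; last exact/derivable1_diffP.
    by rewrite /= deriv1E// derive1E E.
  apply: (@continuousM _ _ (fun x => 'd f x v) (fun x => h' (f x))); first exact: fc.
  apply: (@continuous_comp _ _ _ f h'); last exact: hc.
  exact: differentiable_continuous.
Qed.

Lemma regular_comp f (h h' : R -> R) (K : R) : lipC1 f ->
  (forall x, has_deriv h (f x) (h' (f x))) ->
  (forall x, {for f x, continuous h'}) ->
  (forall x y, `|h (f x) - h (f y)| <= K * `|f x - f y|) ->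
  (forall x, `|h (f x)| <= K) ->
  regular (fun x => h (f x)).
Proof.
move=> fl hd hc HK bK; split; last by exists K.
by apply: (lipC1_comp fl _ hd hc HK); apply: le_trans (bK 0).
Qed.

End RegularFunctions.

Section ScalarFlow.
Context {R : realType}.
Implicit Types (k : R -> R) (x y t : R).

Lemma scalar_flow k (K x0 : R) : continuous k -> (forall x, 1 <= k x <= K) ->
  exists2 th : R -> R, th 0 = x0 & forall t, has_deriv th t (k (th t)).
Proof.
move=> kc kK; pose h x := (k x)^-1.
have k0 x : 0 < k x by have /andP[h1 _] := kK x; lra.
have K0 : 0 < K by have /andP[h1 h2] := kK 0; lra.
have hc : continuous h.
  by move=> x; apply: cat_inv; [rewrite gt_eqF|exact: kc].
pose N := prim h.
have DN x : has_deriv N x (h x) by exact: der_prim.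
have Nc : continuous N by move=> x; exact: der_continuous (DN x).
have incr x y : x <= y -> K^-1 * (y - x) <= N y - N x.
  move=> xy; have [z _ ->] := mvt xy (fun x _ => DN x).
  rewrite ler_wpM2r ?subr_ge0// /h lef_pV2 ?posrE//.
  by have /andP[] := kK z.
have inj x y : N x = N y -> x = y.
  wlog xy : x y / x <= y.
    by move=> W; case: (leP x y) => [/W//|/ltW/W H /esym/H].
  move=> E; have := incr _ _ xy; rewrite E subrr => H; apply/eqP.
  rewrite eq_le xy/=; move: H; rewrite pmulr_rle0 ?invr_gt0//; lra.
have surj y : exists x, N x = y.
  pose M := K * `|y|.
  have M0 : 0 <= M by rewrite mulr_ge0// ltW.
  have yM : `|y| = K^-1 * M by rewrite /M mulrA mulVf ?mul1r// gt_eqF.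
  have N0 : N 0 = 0 by exact: prim0.
  have h1 : `|y| <= N M by have := incr 0 M M0; rewrite N0 !subr0 -yM.
  have h2 : N (- M) <= - `|y|.
    by have := incr (- M) 0; rewrite oppr_le0 N0 sub0r opprK -yM => /(_ M0); lra.
  have [|||x _ xE] := @IVT _ N (- M) M y.
  - by lra.
  - exact: continuous_subspaceT.
  - rewrite ge_min le_max; apply/andP; split; apply/orP.
      by left; have := ler_norm (- y); rewrite normrN; lra.
    by right; apply: le_trans (ler_norm _) h1.
  - by exists x.
have /choice[g Ng] := surj.
have gN : cancel N g by move=> x; apply: inj; rewrite Ng.
have Dg y : has_deriv g y (k (g y)).
  rewrite -[X in has_deriv g X]Ng.
  have H := @is_derive_inverse _ N g (h (g y)) (g y) _ _ (DN (g y)) _.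
  rewrite -[k (g y)]invrK; apply: H.
  - by near=> z; exact: gN.
  - by near=> z; exact: Nc.
  - by rewrite invr_neq0// gt_eqF.
exists (fun t => g (t + N x0)); first by rewrite add0r gN.
move=> t; have H := Dg (t + N x0).
apply: der_eq (der_comp (g := fun t => t + N x0) H (der_add (der_id t) (der_cst _ t))) _.
by ring.
Unshelve. all: by end_near. Qed.

Lemma scalar_flow_lip k k' (th th' : R -> R) (K d t : R) :
  continuous k -> continuous k' ->
  (forall x, 1 <= k x <= K) -> (forall x, 1 <= k' x <= K) ->
  (forall x, `|k x - k' x| <= d) ->
  (forall s, has_deriv th s (k (th s))) -> (forall s, has_deriv th' s (k' (th' s))) ->
  `|th t - th' t| <= K * (`|th 0 - th' 0| + d * (K * `|t|)).
Proof.
move=> kc kc' kK kK' kd Dth Dth'.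
have K1 : 1 <= K by have /andP[] := kK 0; lra.
have d0 : 0 <= d by apply: le_trans (kd 0).
have inv (q : R -> R) : continuous q -> (forall x, 1 <= q x <= K) ->
    continuous (fun x => (q x)^-1).
  by move=> qc qK x; apply: cat_inv; [rewrite gt_eqF//; have /andP[] := qK x; lra|exact: qc].
have ic := inv _ kc kK; have ic' := inv _ kc' kK'.
pose N := prim (fun x => (k x)^-1); pose N' := prim (fun x => (k' x)^-1).
have DN x : has_deriv N x (k x)^-1 by exact: (der_prim x ic).
have DN' x : has_deriv N' x (k' x)^-1 by exact: (der_prim x ic').
have time (q M f : R -> R) : (forall x, 1 <= q x <= K) ->
    (forall x, has_deriv M x (q x)^-1) -> (forall s, has_deriv f s (q (f s))) ->
    M (f t) = M (f 0) + t.
  move=> qK DM Df.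
  have H (s : R) : has_deriv (fun s => M (f s) - s) s 0.
    apply: der_eq (der_sub (der_comp (DM (f s)) (Df s)) (der_id s)) _.
    by rewrite mulVf ?subrr// gt_eqF//; have /andP[] := qK (f s); lra.
  have := is_derive_0_is_cst t 0 H; lra.
have E := time _ _ _ kK DN Dth; have E' := time _ _ _ kK' DN' Dth'.
have diff x y : `|(N x - N' x) - (N y - N' y)| <= d * `|x - y|.
  apply: (@der_lip _ (fun x => N x - N' x) (fun x => (k x)^-1 - (k' x)^-1)) => z.
    exact: der_sub.
  have /andP[h1 _] := kK z; have /andP[h2 _] := kK' z.
  have -> : (k z)^-1 - (k' z)^-1 = (k' z - k z) / (k z * k' z).
    by field; apply/andP; split; rewrite gt_eqF//; lra.
  have kk : 1 <= k z * k' z by rewrite -[leLHS]mulr1 ler_pM.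
  rewrite normrM normfV [`|k z * _|]ger0_norm; last by lra.
  rewrite ler_pdivrMr; last by lra.
  by rewrite distrC; apply: le_trans (kd z) _; rewrite ler_peMr.
have lipN x y : `|N' x - N' y| <= `|x - y|.
  rewrite -[leRHS]mul1r; apply: (@der_lip _ N' (fun x => (k' x)^-1)) => // z.
  have /andP[h1 _] := kK' z; rewrite normfV invf_le1 ?normr_gt0; last by rewrite gt_eqF//; lra.
  by rewrite ger0_norm//; lra.
have colip x y : `|x - y| <= K * `|N' x - N' y|.
  wlog xy : x y / x <= y.
    by move=> W; case: (leP x y) => [/W//|/ltW/W]; rewrite distrC (distrC (N' x)).
  have [z _ zE] := mvt xy (fun x _ => DN' x).
  rewrite distrC (distrC (N' x)) zE normrM mulrA ler_peMl//.
  have /andP[h1 h2] := kK' z; rewrite normfV ger0_norm; last by lra.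
  by rewrite ler_pdivlMr; lra.
have dth : `|th t - th 0| <= K * `|t|.
  have := @der_lip _ th (fun s => k (th s)) 0 t K Dth; rewrite subr0; apply => s.
  by have /andP[h1 h2] := kK (th s); rewrite ger0_norm; lra.
rewrite distrC; apply: le_trans (colip _ _) _; apply: ler_wpM2l; first by lra.
have -> : N' (th' t) - N' (th t) = (N' (th' 0) - N' (th 0)) +
   ((N (th t) - N' (th t)) - (N (th 0) - N' (th 0))).
  by rewrite E E'; ring.
apply: le_trans (ler_normD _ _) _; rewrite distrC; apply: lerD; first exact: lipN.
by apply: le_trans (diff _ _) _; rewrite ler_wpM2l.
Qed.

End ScalarFlow.

Section TorusPoint.
Context {R : realType}.
Variables (Bd eps : R) (l jj : nat).
Hypotheses (Bd3 : 3 <= Bd).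
Let c := 2 * Bd.
Implicit Types (ph : nat -> R) (r b th : R).

Definition torus_pt r b th ph (i : nat) : R :=
  match i with
  | 0 => Num.sqrt (r * sin th + 2 * Bd) * cos ((b + r * sin th) / 2)
  | 1 => Num.sqrt (r * sin th + 2 * Bd) * sin ((b + r * sin th) / 2)
  | j.+2 => if (j <= l)%N then psi Bd l ph (r * cos th) j else 0
  end.

Definition pad (X : nat -> R) : R := (X 0 + 2 * Bd) ^+ jj.

Definition clock_at (X : nat -> R) : R :=
  2 * plane_sq X ^+ 2 * speed c X l * pad X.

Lemma osc_le r (k : R) : `|r| <= Bd -> `|k| <= 1 -> `|r * k| <= Bd.
Proof. by move=> rB k1; rewrite normrM; apply: le_trans rB; rewrite ler_piMr. Qed.

Lemma torus_pt_sq r b th ph : `|r| <= Bd ->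
  plane_sq (torus_pt r b th ph) = r * sin th + c.
Proof.
move=> rB; have [s0 _ _ _] := rad_bounds Bd3 (osc_le rB (sin_max th)).
rewrite /plane_sq /= !exprMn sqr_sqrtr ?ltW//.
by rewrite [cos _ ^+ 2]cos2sin2 /c; ring.
Qed.

Lemma torus_pt_re r b th ph : `|r| <= Bd ->
  plane_re (torus_pt r b th ph) = (r * sin th + c) * cos (b + r * sin th).
Proof.
move=> rB; have [s0 _ _ _] := rad_bounds Bd3 (osc_le rB (sin_max th)).
rewrite /plane_re /= !exprMn sqr_sqrtr ?ltW//.
rewrite [in RHS](_ : b + r * sin th = (b + r * sin th) / 2 + (b + r * sin th) / 2).
  by rewrite cosD /c; ring.
by field.
Qed.

Lemma torus_pt_psi r b th ph j : (j <= l)%N ->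
  torus_pt r b th ph j.+2 = psi Bd l ph (r * cos th) j.
Proof. by move=> jl; rewrite /= jl. Qed.

Lemma torus_pt_height r b th ph : `|r| <= Bd ->
  height c (torus_pt r b th ph) l = r * cos th.
Proof.
move=> rB; rewrite /height (@sig_ext _ c _ (psi Bd l ph (r * cos th))).
  exact: (sig_psi Bd3 _ _ (osc_le rB (cos_max th))).
by move=> j jl; rewrite torus_pt_psi.
Qed.

Lemma torus_pt_le r b th ph i : `|r| <= Bd -> `|torus_pt r b th ph i| <= Bd.
Proof.
move=> rB; case: i => [|[|i]] /=.
- by apply: (rad_le Bd3 (osc_le rB (sin_max th))); exact: cos_max.
- by apply: (rad_le Bd3 (osc_le rB (sin_max th))); exact: sin_max.
case: ifP => _; last by rewrite normr0; move: Bd3; lra.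
exact: (psi_le Bd3 _ _ _ (osc_le rB (cos_max th))).
Qed.

Definition clock_max : R := 2 * (3 * Bd) ^+ 2 * (6 * Bd) ^+ l * (3 * Bd) ^+ jj.

Lemma clock_at_bounds (X : nat -> R) : `|plane_sq X - c| <= Bd ->
  `|height c X l| <= Bd -> 1 <= clock_at X <= clock_max.
Proof.
move=> qB hB; have [_ q1 _ _] := rad_bounds Bd3 qB.
rewrite subrK in q1.
have q2 : plane_sq X <= 3 * Bd.
  by move: qB; rewrite ler_norml /c => /andP[_]; lra.
have /andP[t1 t2] := tfac_bounds Bd3 hB; rewrite -/(speed c X l) in t1 t2.
have x0 : `|X 0| <= Bd.
  rewrite -(@ler_pXn2r _ 2)// ?nnegrE//; last by move: Bd3; lra.
  rewrite real_normK ?num_real//; apply: le_trans (_ : plane_sq X <= _).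
    by rewrite /plane_sq lerDl sqr_ge0.
  by apply: le_trans q2 _; rewrite expr2 ler_wpM2r//; move: Bd3; lra.
have [p1 p2] : 1 <= pad X /\ pad X <= (3 * Bd) ^+ jj.
  move: x0; rewrite ler_norml => /andP[y1 y2]; split.
    by rewrite exprn_ege1//; move: Bd3; lra.
  by rewrite lerXn2r// ?nnegrE; move: Bd3; lra.
have s1 : 1 <= 2 * plane_sq X ^+ 2.
  have : 1 <= plane_sq X ^+ 2 by rewrite exprn_ege1//; move: Bd3; lra.
  lra.
have s2 : 2 * plane_sq X ^+ 2 <= 2 * (3 * Bd) ^+ 2.
  by rewrite ler_wpM2l// lerXn2r// ?nnegrE//; move: Bd3; lra.
have st1 : 1 <= 2 * plane_sq X ^+ 2 * speed c X l by rewrite -[leLHS]mulr1 ler_pM.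
apply/andP; split; first by rewrite -[leLHS]mulr1 ler_pM.
by rewrite /clock_at /clock_max; apply: ler_pM => //; [lra|lra|apply: ler_pM => //; lra].
Qed.

Lemma torus_pt_clock r b th ph : `|r| <= Bd ->
  1 <= clock_at (torus_pt r b th ph) <= clock_max.
Proof.
move=> rB; apply: clock_at_bounds; rewrite ?torus_pt_sq// ?torus_pt_height//.
  by rewrite addrK osc_le// sin_max.
by rewrite osc_le// cos_max.
Qed.

Lemma torus_pt_der (r b th : R -> R) ph t (D : R) : `|r t| <= Bd ->
  let X := torus_pt (r t) (b t) (th t) ph in
  D = clock_at X ->
  has_deriv th t D ->
  has_deriv r t (D * (eps * slow (r t) (b t) (th t))) ->
  has_deriv b t (D * (eps * (sin (th t) * slow (r t) (b t) (th t)))) ->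
  forall i, has_deriv (fun t => torus_pt (r t) (b t) (th t) ph i) t
    (pad X * field_coord eps c X l i).
Proof.
move=> rB X DE Dth Dr Db i.
have QB := osc_le rB (sin_max (th t)); have ZB := osc_le rB (cos_max (th t)).
have [s0 _ _ _] := rad_bounds Bd3 QB.
set Q := r t * sin (th t) in QB s0; set Z := r t * cos (th t) in ZB.
set C := cos (b t + Q).
have sqE : plane_sq X = Q + c by exact: torus_pt_sq.
have reE : plane_re X = (Q + c) * C by exact: torus_pt_re.
have hE : height c X l = Z by exact: torus_pt_height.
pose T := speed c X l.
have DE' : D = 2 * (Q + c) ^+ 2 * T * pad X by rewrite DE /clock_at sqE.
have GE : slow (r t) (b t) (th t) = r t * C by [].
have DQ : has_deriv (fun t => r t * sin (th t)) t (D * (Z + eps * Q * C)).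
  by der; rewrite GE /Z /Q; ring.
have DZ : has_deriv (fun t => r t * cos (th t)) t (D * (eps * Z * C - Q)).
  by der; rewrite GE /Z /Q; ring.
have Dal : has_deriv (fun t => (b t + r t * sin (th t)) / 2) t
    (D * (Z + 2 * (eps * Q * C)) / 2).
  by der; rewrite GE /Q; field.
have Ds : has_deriv (fun t => Num.sqrt (r t * sin (th t) + 2 * Bd)) t
    (D * (Z + eps * Q * C) / (2 * Num.sqrt (Q + c))).
  have H : has_deriv (fun t => r t * sin (th t) + 2 * Bd) t (D * (Z + eps * Q * C)).
    by der; ring.
  exact: (@der_sqrt _ (fun t => r t * sin (th t) + 2 * Bd) t _ s0 H).
have q2 := sqr_sqrtr (ltW s0); have q0 : Num.sqrt (Q + c) != 0 by rewrite gt_eqF// sqrtr_gt0.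
have radE : radial_rate eps c X l = (Q + c) * (Z + eps * Q * C).
  by rewrite /radial_rate sqE reE hE; ring.
have angE : angular_rate eps c X l = (Q + c) ^+ 2 * (Z + 2 * (eps * Q * C)).
  by rewrite /angular_rate sqE reE hE; ring.
have X0E : X 0 = Num.sqrt (Q + c) * cos ((b t + Q) / 2) by [].
have X1E : X 1 = Num.sqrt (Q + c) * sin ((b t + Q) / 2) by [].
case: i => [|[|j]].
- change (has_deriv (fun t => Num.sqrt (r t * sin (th t) + 2 * Bd) *
    cos ((b t + r t * sin (th t)) / 2)) t (pad X * (T * (X 0 * radial_rate eps c X l -
      X 1 * angular_rate eps c X l)))).
  der; rewrite -/Q radE angE X0E X1E DE' -/c.
  move: (Num.sqrt (Q + c)) q0 q2 (cos _) (sin _) => q qn <- x y; field.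
  by [].
- change (has_deriv (fun t => Num.sqrt (r t * sin (th t) + 2 * Bd) *
    sin ((b t + r t * sin (th t)) / 2)) t (pad X * (T * (X 1 * radial_rate eps c X l +
      X 0 * angular_rate eps c X l)))).
  der; rewrite -/Q radE angE X0E X1E DE' -/c.
  move: (Num.sqrt (Q + c)) q0 q2 (cos _) (sin _) => q qn <- x y; field.
  by [].
- rewrite /torus_pt /field_coord; case: ifP => jl; last first.
    apply: der_eq (der_cst 0 t) _.
    by rewrite /X /= jl !(mulr0, oppr0).
  have E k : (k <= l)%N -> X k.+2 = psi Bd l ph Z k by exact: torus_pt_psi.
  rewrite (vf_ext _ _ E) mulrA.
  apply: (@psi_der _ Bd Bd3 l ph (fun t => r t * cos (th t))) => //.
  rewrite -/Z -/c -(tfac_ext _ E) -/(speed c X l) -/T.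
  apply: der_eq DZ _; rewrite /height_rate sqE reE hE DE'; ring.
Qed.

End TorusPoint.

Section Embeddings.
Context {R : realType}.

Lemma derive_eps {V W : normedModType R} (f : V -> W) a v df :
  is_derive a v f df -> forall e, 0 < e -> exists2 d, 0 < d &
    forall h : R, `|h| < d -> `|f (h *: v + a) - f a - h *: df| <= e * `|h|.
Proof.
move=> [fd <-] e e0.
have /cvgrPdist_le /(_ e e0) := fd : (h^-1 *: ((f \o shift a) (h *: v) - f a)) @[h --> 0^'] --> 'D_v f a.
rewrite near_withinE => /nbhs_ballP[d /= d0 H]; exists d => // h hd.
have [->|h0] := eqVneq h 0.
  by rewrite !scale0r add0r subrr subr0 !normr0 mulr0.
have := H h; rewrite /ball /= sub0r normrN => /(_ hd h0) Hh.
have -> : f (h *: v + a) - f a - h *: 'D_v f a =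
    - (h *: ('D_v f a - h^-1 *: (f (h *: v + a) - f a))).
  by rewrite scalerBr scalerA divff// scale1r opprB.
by rewrite normrN normrZ mulrC ler_wpM2r.
Qed.

Lemma C1_rows {m n : nat} (f : 'I_n -> 'rV[R]_m -> R) :
  (forall i, lipC1 (f i)) -> C1_map (fun x => \row_i f i x).
Proof.
move=> fC; set u := fun x => \row_i f i x.
have ud x : differentiable u x.
  have -> : u = \sum_(i < n) (fun x => f i x *: (delta_mx 0 i : 'rV[R]_n)).
    apply/funext => y; rewrite /u fct_sumE; apply/rowP => j; rewrite !mxE summxE.
    rewrite (bigD1 j)//= !mxE !eqxx mulr1 big1 ?addr0// => i /negbTE ij.
    by rewrite !mxE eqxx /= eq_sym ij mulr0.
  apply: differentiable_sum => i; apply: (@differentiableZl _ _ _ (f i)).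
  by have [_ + _] := fC i; apply.
split=> // v.
have duE : (fun x => 'd u x v) = fun x => \row_i 'd (f i) x v.
  apply/funext => x; apply/rowP => i; rewrite mxE.
  have fE : f i = (fun N : 'rV[R]_n => N 0 i) \o u.
    by apply/funext => y; rewrite /= mxE.
  have cd : differentiable (fun N : 'rV[R]_n => N 0 i) (u x) by exact: differentiable_coord.
  rewrite fE (diff_comp (ud x) cd) /=.
  have @F : {linear 'rV[R]_n -> R}.
    by exists (fun N : 'rV[R]_n => N 0 i); do 2![eexists]; do ?[constructor];
       rewrite ?mxE// => ? *; rewrite ?mxE//; move=> ?; rewrite !mxE.
  have Fc : continuous F by move=> y; exact: coord_continuous.
  by rewrite (_ : (fun _ => _) = F)// (diff_lin _ Fc).
rewrite duE => x; apply/(@cvgrPdist_le _ _ _ _ (nbhs_filter x)) => e e0.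
have H i : nbhs x [set y | `|'d (f i) x v - 'd (f i) y v| <= e].
  have [_ _ /(_ v x) H] := fC i.
  by move/(@cvgrPdist_le _ _ _ _ (nbhs_filter x)) : H => /(_ e e0).
have := filter_forall (nbhs_filter x) H.
apply: (@filterS _ (nbhs x) (nbhs_filter x)) => y Hy.
by apply: norm_le_entries => [|i]; [exact: ltW|rewrite !mxE; exact: Hy].
Qed.

Lemma int_vec_small {m : nat} (z : 'rV[R]_m) : int_vec z -> `|z| < 1 -> z = 0.
Proof.
move=> zi z1; apply/rowP => i; rewrite mxE.
have /intrP[k kE] := zi i.
have : `|z 0 i| < 1 by apply: le_lt_trans z1; exact: norm_entry_le.
rewrite kE -intr_norm -[1]/(1%:~R) ltr_int => k1.
have -> : k = 0 by apply/eqP; rewrite -normr_le0 -ltzD1 add0r.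
by [].
Qed.

Lemma torus_embedding_colip {m n : nat} (u : 'rV[R]_m -> 'rV[R]_n) (K : R) :
  C1_map u -> (forall x z, int_vec z -> u (x + z) = u x) ->
  (forall x y, exists2 z, int_vec z & `|y - x - z| <= K * `|u y - u x|) ->
  torus_embedding u.
Proof.
move=> uC uper colip; pose K' := `|K| + 1.
have K'0 : 0 < K' by rewrite ltr_wpDl.
have colip' x y : exists2 z, int_vec z & `|y - x - z| <= K' * `|u y - u x|.
  have [z zi H] := colip x y; exists z => //; apply: le_trans H _.
  by rewrite ler_wpM2r// /K'; have := ler_norm K; lra.
split=> //.
- move=> x v dv0; apply/eqP/negPn/negP => v0.
  have vpos : 0 < `|v| by rewrite normr_gt0.
  have [ud _] := uC.
  have D0 : is_derive x v u 0.
    by rewrite -dv0 -deriveE//; apply/derivableP/diff_derivable.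
  have e0 : 0 < `|v| / (2 * K') by rewrite divr_gt0// mulr_gt0.
  have [d d0 Hd] := derive_eps D0 e0.
  pose h := Num.min (d / 2) (1 / (4 * `|v|)).
  have h0 : 0 < h by rewrite lt_min !divr_gt0// mulr_gt0.
  have hd : h <= d / 2 by rewrite ge_min lexx.
  have hv : h * `|v| <= 1 / 4.
    by rewrite -ler_pdivlMr// ge_min -[X in _ || (_ <= X)]mulrA -invfM lexx orbT.
  have := Hd h; rewrite gtr0_norm// scaler0 subr0 => /(_ _) Hh.
  have {}Hh : `|u (h *: v + x) - u x| <= `|v| / (2 * K') * h by apply: Hh; lra.
  have [z zi Hz] := colip' x (h *: v + x); rewrite addrK in Hz.
  have {}Hz : `|h *: v - z| <= h * `|v| / 2.
    apply: le_trans Hz _; apply: le_trans (ler_wpM2l (ltW K'0) Hh) _.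
    by rewrite le_eqVlt; apply/orP; left; apply/eqP; field; rewrite gt_eqF.
  have hvn : `|h *: v| = h * `|v| by rewrite normrZ gtr0_norm.
  have z1 : `|z| < 1.
    have := ler_normB (h *: v) (h *: v - z); rewrite subKr hvn.
    by move: (mulr_ge0 (ltW h0) (ltW vpos)); lra.
  move: Hz; rewrite (int_vec_small zi z1) subr0 hvn.
  by have := mulr_gt0 h0 vpos; lra.
- move=> x y E; have [z zi] := colip x y; rewrite E subrr normr0 mulr0 normr_le0.
  by rewrite subr_eq0 => /eqP ->.
- move=> x e e0; exists (e / K'); first by rewrite divr_gt0.
  move=> y yd; have [z zi H] := colip' x y; exists z => //.
  rewrite opprD addrA; apply: le_lt_trans H _.
  by rewrite mulrC -ltr_pdivlMr.
Qed.

End Embeddings.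

(** * Differentials along curves and normal components *)

Section Differentials.
Context {R : realType}.

Lemma diff_eps {V W : normedModType R} (f : V -> W) x : differentiable f x ->
  forall e, 0 < e -> exists2 d, 0 < d &
    forall h, `|h| < d -> `|f (h + x) - f x - 'd f x h| <= e * `|h|.
Proof.
move=> /diff_locally fd e e0.
have /eqaddoP /(_ e e0) : f \o shift x = cst (f x) + 'd f x +o_ 0 id := fd.
move=> /nbhs_ballP[d /= d0 H]; exists d => // h hd.
have := H h; rewrite -ball_normE /= sub0r normrN => /(_ hd).
by rewrite opprD addrA.
Qed.

(* The library gives the junk value 0 to the differential of a function that is not
   differentiable. *)
Lemma diff_junk {m n : nat} (f : 'rV[R]_m -> 'rV[R]_n) x v :
  ~ differentiable f x -> 'd f x v = 0.
Proof.
move=> nd; rewrite /diff; set P := (X in get X).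
have -> // : get P = point.
apply: xgetPN => df Hdf; apply: nd; apply/diffP; rewrite /diff -/P.
exact: (@xgetI _ point P df Hdf).
Qed.

Lemma line_derive {V W : normedModType R} (f : V -> W) x v : differentiable f x ->
  is_derive (0 : R) 1 (fun s : R => f (s *: v + x)) ('d f x v).
Proof.
move=> fx; have D : derivable f x v by exact: diff_derivable.
pose h s := f (s *: v + x).
have Ed : (fun r : R => r^-1 *: ((h \o shift 0) (r *: 1) - h 0)) =
    (fun r => r^-1 *: ((f \o shift x) (r *: v) - f x)).
  by apply/funext => r; rewrite /h /= addr0 scale0r add0r [r *: 1]mulr1.
have -> : 'd f x v = 'D_v f x by rewrite deriveE.
by split; [rewrite /derivable Ed|rewrite /derive Ed].
Qed.

Lemma enorm_ge0 {n} (v : 'rV[R]_n) : 0 <= enorm v.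
Proof. exact: sqrtr_ge0. Qed.

Lemma edot_ge0 {n} (v : 'rV[R]_n) : 0 <= edot v v.
Proof. by apply: sumr_ge0 => i _; rewrite -expr2 sqr_ge0. Qed.

Lemma norm_le_enorm {n} (v : 'rV[R]_n) : `|v| <= enorm v.
Proof.
apply: norm_le_entries => [|i]; first exact: enorm_ge0.
rewrite -sqrtr_sqr /enorm ler_sqrt ?edot_ge0// /edot (bigD1 i)//= -expr2 lerDl.
by apply: sumr_ge0 => j _; rewrite -expr2 sqr_ge0.
Qed.

Lemma enorm_le_norm {n} (v : 'rV[R]_n) : enorm v <= n%:R * `|v|.
Proof.
case: n v => [|n] v.
  rewrite mul0r /enorm /edot big_ord0 sqrtr0//.
have n1 : 1 <= n.+1%:R :> R by rewrite ler1n.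
have -> : n.+1%:R * `|v| = Num.sqrt ((n.+1%:R * `|v|) ^+ 2).
  by rewrite sqrtr_sqr ger0_norm// mulr_ge0.
rewrite /enorm ler_sqrt ?sqr_ge0//; apply: le_trans (_ : \sum_(i < n.+1) `|v| ^+ 2 <= _).
  apply: ler_sum => i _; rewrite -expr2 -[leLHS]real_normK ?num_real//.
  by rewrite lerXn2r ?nnegrE// norm_entry_le.
rewrite sumr_const card_ord -[leLHS]mulr_natl exprMn ler_wpM2r ?sqr_ge0//.
by rewrite expr2 ler_peMr// ler0n.
Qed.

Lemma cauchy_schwarz {n} (v w : 'rV[R]_n) : edot v w <= enorm v * enorm w.
Proof.
have dotE (a : R) : edot (v - a *: w) (v - a *: w) =
    edot v v - 2 * a * edot v w + a ^+ 2 * edot w w.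
  rewrite /edot !mulr_sumr -sumrN -!big_split /=; apply: eq_bigr => i _.
  by rewrite !mxE; ring.
have [w0|w0] := eqVneq (edot w w) 0.
  have wz i : w 0 i = 0.
    have : w 0 i * w 0 i <= edot w w.
      rewrite /edot (bigD1 i)//= lerDl; apply: sumr_ge0 => j _.
      by rewrite -expr2 sqr_ge0.
    rewrite w0 -expr2 => h; apply/eqP; rewrite -sqrf_eq0 eq_le h sqr_ge0//.
  rewrite {1}/edot big1 ?mulr_ge0 ?enorm_ge0// => i _; by rewrite wz mulr0.
have wpos : 0 < edot w w by rewrite lt_neqAle eq_sym w0 edot_ge0.
have := edot_ge0 (v - (edot v w / edot w w) *: w); rewrite dotE.
have -> : edot v v - 2 * (edot v w / edot w w) * edot v w +
   (edot v w / edot w w) ^+ 2 * edot w w = edot v v - edot v w ^+ 2 / edot w w by field.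
rewrite subr_ge0 ler_pdivrMr// => h.
apply: le_trans (ler_norm _) _; rewrite -sqrtr_sqr /enorm -sqrtrM ?edot_ge0//.
by rewrite ler_sqrt// mulr_ge0// edot_ge0.
Qed.

Lemma le_of_eps (x y k : R) : (forall e : R, 0 < e -> x <= y + e * k) -> x <= y.
Proof.
move=> H; rewrite leNgt; apply/negP => yx.
have k0 : 0 < 2 * (`|k| + 1) by rewrite mulr_gt0// ltr_wpDl.
have ek : 0 < (x - y) / (2 * (`|k| + 1)) by rewrite divr_gt0// subr_gt0.
have := H _ ek.
have : (x - y) / (2 * (`|k| + 1)) * k <= (x - y) / 2.
  rewrite mulrAC ler_pdivrMr// -mulrA ler_pM2l ?subr_gt0//.
  by have := ler_norm k; lra.
lra.
Qed.

End Differentials.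

Section Bounds.
Context {R : realType} {n m : nat}.
Variables (u : 'rV[R]_m -> 'rV[R]_n) (K : R).
Hypotheses (uC : C1_map u) (uper : forall x z, int_vec z -> u (x + z) = u x)
  (colip : forall x y, exists2 z, int_vec z & `|y - x - z| <= K * `|u y - u x|).
Let M := range u.

Lemma tangent_bound (phi : 'rV[R]_n -> 'rV[R]_n) p v k :
  0 <= k -> (exists2 d, 0 < d &
    forall p', M p' -> `|p' - p| < d -> `|phi p' - phi p| <= k * `|p' - p|) ->
  M p -> tangent_space M p v -> enorm ('d phi p v) <= n%:R * k * enorm v.
Proof.
move=> k0 [d d0 Hd] Mp [c [c0 cM Dc]].
have [dphi|/diff_junk ->] := pselect (differentiable phi p); last first.
  have -> : enorm (0 : 'rV[R]_n) = 0.
    by rewrite /enorm /edot big1 ?sqrtr0// => i _; rewrite mxE mul0r.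
  by rewrite !mulr_ge0 ?enorm_ge0// ler0n.
apply: le_trans (enorm_le_norm _) _; rewrite -mulrA ler_wpM2l ?ler0n//.
apply: le_trans (_ : k * `|v| <= _); last by rewrite ler_wpM2l// norm_le_enorm.
have dc : differentiable c 0 by apply/derivable1_diffP; case: Dc.
have dphi' : differentiable phi (c 0) by rewrite c0.
have D : is_derive (0 : R) 1 (phi \o c) ('d phi p v).
  have dd : differentiable (phi \o c) 0 by exact: differentiable_comp.
  have -> : 'd phi p v = 'D_1 (phi \o c) 0.
    have E : 'd c 0 1 = v by rewrite -deriveE//; case: Dc.
    have ch := congr1 (fun F : R -> _ => F 1) (diff_comp dc dphi').
    rewrite deriveE//; apply: etrans (esym ch).
    have -> : ('d phi (c 0) \o 'd c 0) 1 = 'd phi (c 0) ('d c 0 1) by [].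
    by rewrite E c0.
  exact/derivableP/diff_derivable.
apply: (@le_of_eps _ _ _ (k + 1)) => e e0.
have [d1 d10 H1] := derive_eps Dc e0.
have [d2 d20 H2] := derive_eps D e0.
move: cM => /nbhs_ballP[d3 /= d30 H3].
have cc : {for (0 : R), continuous c} by apply: differentiable_continuous.
have /nbhs_ballP[d4 /= d40 H4] : \forall s \near (0 : R), `|c 0 - c s| < d.
  by move/cvgrPdist_lt : cc => /(_ d d0).
pose s := Num.min (Num.min d1 d2) (Num.min d3 d4) / 2.
have mn : 0 < Num.min (Num.min d1 d2) (Num.min d3 d4) by rewrite !lt_min d10 d20 d30 d40.
have s0 : 0 < s by rewrite divr_gt0.
have [sd1 sd2 sd3 sd4] : [/\ s < d1, s < d2, s < d3 & s < d4].
  have : s < Num.min (Num.min d1 d2) (Num.min d3 d4) by rewrite /s; lra.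
  by rewrite !lt_min => /andP[/andP[-> ->] /andP[-> ->]].
have ns : `|s| = s by rewrite gtr0_norm.
have h1 := H1 s; rewrite ns in h1; have {}h1 := h1 sd1.
have h2 := H2 s; rewrite ns in h2; have {}h2 := h2 sd2.
have h3 : M (c s) by apply: H3; rewrite /ball /= sub0r normrN ns.
have h4 : `|c s - p| < d.
  by rewrite -c0 distrC; apply: H4; rewrite /ball /= sub0r normrN ns.
have h5 := Hd _ h3 h4.
rewrite [s *: 1]mulr1 addr0 c0 in h1; rewrite [s *: 1]mulr1 addr0 /= c0 in h2.
have e1 : s * `|'d phi p v| <= `|phi (c s) - phi p| + e * s.
  have -> : s * `|'d phi p v| = `|s *: 'd phi p v| by rewrite normrZ ns.
  have -> : s *: 'd phi p v = (phi (c s) - phi p) -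
    (phi (c s) - phi p - s *: 'd phi p v) by rewrite subKr.
  by apply: le_trans (ler_normB _ _) _; rewrite lerD2l.
have e2 : `|c s - p| <= s * `|v| + e * s.
  have -> : s * `|v| = `|s *: v| by rewrite normrZ ns.
  have -> : c s - p = s *: v + (c s - p - s *: v) by rewrite [RHS]addrC subrK.
  by apply: le_trans (ler_normD _ _) _; rewrite lerD2l.
have e3 := ler_wpM2l k0 e2.
rewrite -(ler_pM2l s0); apply: le_trans e1 _.
by move: h5 e3; lra.
Qed.

Lemma normal_bound (h : R -> 'rV[R]_n) p w k : 0 <= k -> h 0 = p ->
  is_derive (0 : R) 1 h w -> M p ->
  (exists2 d, 0 < d & forall s : R, 0 < s < d ->
     exists2 p', M p' & `|h s - p'| <= k * s) ->
  enorm (normal_proj M p w) <= n%:R * k.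
Proof.
move=> k0 h0 Dh [x _ xp] [d d0 Hd].
have proj_le t : tangent_space M p t -> enorm (normal_proj M p w) <= enorm (w - t).
  move=> pt; rewrite /normal_proj; case: xgetP => [q _ [Nq Tq]|_]; last first.
    have -> : enorm (0 : 'rV[R]_n) = 0.
      by rewrite /enorm /edot big1 ?sqrtr0// => i _; rewrite mxE mul0r.
    exact: enorm_ge0.
  have qE : edot q q = edot q (w - t).
    have -> : edot q (w - t) = edot q q + edot q (w - q) - edot q t.
      by rewrite /edot -big_split /= -sumrB; apply: eq_bigr => i _; rewrite !mxE; ring.
    by rewrite (Nq _ Tq) (Nq _ pt) addr0 subr0.
  have [->|q0] := eqVneq (enorm q) 0; first exact: enorm_ge0.
  have qp : 0 < enorm q by rewrite lt_neqAle eq_sym q0 enorm_ge0.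
  rewrite -(ler_pM2l qp) -expr2 sqr_sqrtr ?edot_ge0// qE; exact: cauchy_schwarz.
pose K' := `|K| + 1.
have K'0 : 0 < K' by rewrite ltr_wpDl.
pose L := K' * (k + `|w| + 1).
have L0 : 0 < L by rewrite mulr_gt0// ltr_wpDl// addr_ge0.
apply: (@le_of_eps _ _ _ (n%:R * (1 + L))) => e e0.
have [ud _] := uC.
pose e' := Num.min e 1.
have e'0 : 0 < e' by rewrite lt_min e0 ltr01.
have e'1 : e' <= 1 by rewrite ge_min lexx orbT.
have e'e : e' <= e by rewrite ge_min lexx.
have [d1 d10 H1] := derive_eps Dh e'0.
have [d2 d20 H2] := diff_eps (ud x) e'0.
pose s := Num.min (Num.min d1 d) (d2 / L) / 2.
have mn : 0 < Num.min (Num.min d1 d) (d2 / L) by rewrite !lt_min d10 d0 divr_gt0.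
have s0 : 0 < s by rewrite divr_gt0.
have [sd1 sd sd2] : [/\ s < d1, s < d & s < d2 / L].
  have : s < Num.min (Num.min d1 d) (d2 / L) by rewrite /s; lra.
  by rewrite !lt_min => /andP[/andP[-> ->] ->].
have ns : `|s| = s by rewrite gtr0_norm.
have h1 := H1 s; rewrite ns in h1; have {}h1 := h1 sd1.
rewrite [s *: 1]mulr1 addr0 h0 in h1.
have [|p' [x' _ x'p'] hp'] := Hd s; first by rewrite s0.
have hsp : `|h s - p| <= s * (`|w| + e').
  have -> : h s - p = s *: w + (h s - p - s *: w) by rewrite [RHS]addrC subrK.
  by apply: le_trans (ler_normD _ _) _; rewrite normrZ ns; lra.
have p'p : `|p' - p| <= s * (k + `|w| + 1).
  have := ler_distD (h s) p' p; rewrite (distrC p' (h s)).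
  by have : s * e' <= s * 1 by [rewrite ler_wpM2l// ltW]; move: hsp hp'; lra.
have [z zi Hz] := colip x x'.
pose xi := x' - x - z.
have xiL : `|xi| <= L * s.
  apply: le_trans Hz _; rewrite x'p' xp.
  apply: le_trans (_ : K' * `|p' - p| <= _).
    by rewrite ler_wpM2r// /K'; have := ler_norm K; lra.
  by rewrite /L -mulrA ler_wpM2l ?(ltW K'0)// mulrC.
have uxi : u (xi + x) = p'.
  have -> : xi + x = x' + - z by rewrite /xi addrAC subrK.
  by rewrite uper// => i; rewrite mxE rpredN.
have h2 := H2 xi; rewrite uxi xp in h2.
have {}h2 : `|p' - p - 'd u x xi| <= e' * `|xi|.
  by apply: h2; apply: le_lt_trans xiL _; rewrite mulrC -ltr_pdivlMr.
pose t := 'd u x (s^-1 *: xi).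
have Tt : tangent_space M p t.
  exists (fun r : R => u (r *: (s^-1 *: xi) + x)); split.
  - by rewrite scale0r add0r.
  - by apply: (@nearW _ _ _ (nbhs_filter (0 : R))) => r; exists (r *: (s^-1 *: xi) + x).
  - exact: line_derive.
apply: le_trans (proj_le t Tt) _; apply: le_trans (enorm_le_norm _) _.
have -> : n%:R * k + e * (n%:R * (1 + L)) = n%:R * (k + e * (1 + L)) by ring.
rewrite ler_wpM2l ?ler0n// -(ler_pM2l s0) -{1}ns -normrZ.
have -> : s *: (w - t) = - (h s - p - s *: w) + (h s - p') + (p' - p - 'd u x xi).
  have -> : t = s^-1 *: 'd u x xi by rewrite /t linearZ.
  rewrite scalerBr scalerA divff ?gt_eqF// scale1r.
  by apply/rowP => i; rewrite !mxE; ring.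
apply: le_trans (ler_normD _ _) _.
have := ler_normD (- (h s - p - s *: w)) (h s - p'); rewrite normrN.
have : e' * `|xi| <= e * (L * s) by rewrite ler_pM// ltW.
have : e' * s <= e * s by rewrite ler_wpM2r// ltW.
by move: h1 hp' h2; lra.
Qed.

End Bounds.

Section TorusMap.
Context {R : realType} {n : nat}.
Variables (Bd eps : R) (l jj : nat) (A B : R -> R).
Hypotheses (Bd3 : 3 <= Bd) (ln : (l.+3 <= n)%N)
  (DA : forall x, has_deriv A x (eps * slow (A x) (B x) x))
  (DB : forall x, has_deriv B x (eps * (sin x * slow (A x) (B x) x)))
  (Aper : forall x, A (x + 2 * pi) = A x) (Bper : forall x, B (x + 2 * pi) = B x)
  (A1 : forall x, 1 <= A x <= Bd).
Let c := 2 * Bd.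
Notation vec := 'rV[R]_l.+1.

Definition angles (x : vec) (j : nat) : R := x 0 (inord j).
Definition phase (x : vec) : R := 2 * pi * angles x 0.
Definition torus_at (x : vec) (i : nat) : R :=
  torus_pt Bd l (A (phase x)) (B (phase x)) (phase x) (angles x) i.
Definition torus_map (x : vec) : 'rV[R]_n := \row_i torus_at x i.

Lemma amplitude_le x : `|A x| <= Bd.
Proof. by have /andP[h1 h2] := A1 x; rewrite ger0_norm//; lra. Qed.

Lemma slow_amplitude_le x : `|slow (A x) (B x) x| <= Bd.
Proof. exact: osc_le (amplitude_le x) (cos_max _). Qed.

Lemma lipC1_angle j (k : R) : lipC1 (fun x => k * angles x j).
Proof.
apply: (@lipC1_comp _ _ _ (fun y => k * y) (fun=> k) `|k|).
- exact: lipC1_coord.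
- by [].
- by move=> x; der; ring.
- by move=> x; exact: cst_continuous.
- by move=> x y; rewrite -mulrBr normrM.
Qed.

Lemma sin_comp {m} (f : 'rV[R]_m -> R) : lipC1 f -> regular (fun x => sin (f x)).
Proof.
move=> fl; apply: (@regular_comp _ _ f sin cos 1 fl).
- by move=> x; exact: is_derive_sin.
- by move=> x; exact: continuous_cos.
- by move=> x y; rewrite mul1r sin_lip.
- by move=> x; exact: sin_max.
Qed.

Lemma cos_comp {m} (f : 'rV[R]_m -> R) : lipC1 f -> regular (fun x => cos (f x)).
Proof.
move=> fl; apply: (@regular_comp _ _ f cos (fun x => - sin x) 1 fl).
- by move=> x; exact: is_derive_cos.
- by move=> x; apply: cat_opp; exact: continuous_sin.
- by move=> x y; rewrite mul1r cos_lip.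
- by move=> x; exact: cos_max.
Qed.

Lemma sqrt_comp {m} (f : 'rV[R]_m -> R) : lipC1 f -> (forall x, `|f x| <= Bd) ->
  regular (fun x => Num.sqrt (f x + c)).
Proof.
move=> fl fB; have H x := rad_bounds Bd3 (fB x).
apply: (@regular_comp _ _ f (fun y => Num.sqrt (y + c))
  (fun y => 1 / (2 * Num.sqrt (y + c))) Bd fl).
- move=> x; have [s0 _ _ _] := H x.
  apply: (@der_sqrt _ (fun y => y + c)) => //.
  by der; ring.
- move=> x; have [s0 _ _ _] := H x.
  apply: cat_mul; first exact: cat_cst.
  apply: cat_inv; first by rewrite mulf_neq0// gt_eqF// sqrtr_gt0.
  apply: cat_mul; first exact: cat_cst.
  apply: (@continuous_comp _ _ _ (fun y => y + c) Num.sqrt); last exact: sqrt_continuous.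
  by apply: cat_add; [exact: cat_id|exact: cat_cst].
- move=> x y; have [_ s0 _ _] := H x; have [_ s1 _ _] := H y.
  apply: le_trans (sqrt_lip _ _) _; [by move: Bd3 s0; rewrite /c; lra|by move: Bd3 s1; rewrite /c; lra|].
  rewrite (_ : f x + c - (f y + c) = f x - f y); last by ring.
  by rewrite ler_peMl//; move: Bd3; lra.
- by move=> x; have [_ _ _ s] := H x; rewrite ger0_norm// sqrtr_ge0.
Qed.

Lemma regular_psi k (z : vec -> R) j : regular z -> (forall x, `|z x| <= Bd) ->
  regular (fun x => psi Bd k (angles x) (z x) j).
Proof.
elim: k z => [|k IH] z zr zB /=; first exact: zr.
have sr := sqrt_comp zr.1 zB.
case: (j == k.+1).
  by apply: regular_mul => //; apply: sin_comp; exact: lipC1_angle.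
apply: IH.
  by apply: regular_mul => //; apply: cos_comp; exact: lipC1_angle.
by move=> x; apply: rad_le => //; exact: cos_max.
Qed.

Lemma regular_amplitude : regular (fun x => A (phase x)).
Proof.
apply: (@regular_comp _ _ phase A (fun x => eps * slow (A x) (B x) x) ((`|eps| + 1) * Bd)).
- exact: lipC1_angle.
- by move=> x; exact: DA.
- move=> x; apply: cat_mul; first exact: cat_cst.
  by apply: slow_continuous => y; [exact: der_continuous (DA y)|exact: der_continuous (DB y)].
- move=> x y; apply: (@der_lip _ A _ _ _ _ DA) => // z.
  rewrite normrM ler_pM//; first by lra.
  exact: slow_amplitude_le.
- move=> x; apply: le_trans (amplitude_le _) _.
  by rewrite ler_peMl; [|move: Bd3; lra|rewrite lerDr].
Qed.

Lemma lipC1_phase_shift : lipC1 (fun x => B (phase x)).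
Proof.
apply: (@lipC1_comp _ _ phase B (fun x => eps * (sin x * slow (A x) (B x) x)) (`|eps| * Bd)).
- exact: lipC1_angle.
- by rewrite mulr_ge0//; move: Bd3; lra.
- by move=> x; exact: DB.
- move=> x; apply: cat_mul; first exact: cat_cst.
  apply: cat_mul; first exact: continuous_sin.
  by apply: slow_continuous => y; [exact: der_continuous (DA y)|exact: der_continuous (DB y)].
- move=> x y; apply: (@der_lip _ B _ _ _ _ DB) => // z.
  rewrite normrM ler_wpM2l// mulrC; apply: osc_le; last exact: sin_max.
  exact: slow_amplitude_le.
Qed.

Lemma regular_torus_at i : regular (fun x => torus_at x i).
Proof.
have Ar := regular_amplitude.
have Qr : regular (fun x => A (phase x) * sin (phase x)).
  by apply: regular_mul => //; apply: sin_comp; exact: lipC1_angle.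
have Zr : regular (fun x => A (phase x) * cos (phase x)).
  by apply: regular_mul => //; apply: cos_comp; exact: lipC1_angle.
have QB x : `|A (phase x) * sin (phase x)| <= Bd.
  by apply: osc_le; [exact: amplitude_le|exact: sin_max].
have sr := sqrt_comp Qr.1 QB.
have al : lipC1 (fun x => (B (phase x) + A (phase x) * sin (phase x)) / 2).
  apply: (@lipC1_comp _ _ _ (fun y => y / 2) (fun=> 1 / 2) (1 / 2)).
  - exact: lipC1_add lipC1_phase_shift Qr.1.
  - lra.
  - by move=> x; der; field.
  - by move=> x; exact: cst_continuous.
  - by move=> x y; rewrite -mulrBl normrM [`|2^-1|]ger0_norm; lra.
case: i => [|[|j]].
- exact: (regular_mul sr (cos_comp al)).
- exact: (regular_mul sr (sin_comp al)).
- rewrite /torus_at /=; case: (j <= l)%N; last exact: regular_cst.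
  apply: regular_psi => // x; apply: osc_le; [exact: amplitude_le|exact: cos_max].
Qed.

Lemma regular_sig (u : vec -> nat -> R) k : (forall j, regular (fun x => u x j)) ->
  regular (fun x => sig c (u x) k).
Proof.
move=> ur; elim: k => [|k IH] /=; first exact: ur.
apply: regular_add; last by exact: regular_cst.
by apply: regular_add; exact: regular_exp.
Qed.

Lemma regular_tfac (u : vec -> nat -> R) k : (forall j, regular (fun x => u x j)) ->
  regular (fun x => tfac c (u x) k).
Proof.
move=> ur; elim: k => [|k IH]; first exact: regular_cst.
apply: regular_mul => //; apply: regular_mul; first exact: regular_cst.
by apply: regular_add; [exact: regular_sig|exact: regular_cst].
Qed.

Lemma regular_clock : regular (fun x => clock_at Bd l jj (torus_at x)).
Proof.
have H := regular_torus_at; rewrite /clock_at /plane_sq /pad.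
apply: regular_mul; last first.
  by apply: regular_exp; apply: regular_add; [exact: H|exact: regular_cst].
apply: regular_mul; last by apply: regular_tfac => j; exact: H.
apply: regular_mul; first exact: regular_cst.
by apply/regular_exp/regular_add; apply/regular_exp; exact: H.
Qed.

Lemma torus_map_C1 : C1_map torus_map.
Proof. by apply: C1_rows => i; exact: (regular_torus_at i).1. Qed.

Lemma torus_map_lip : exists2 K, 0 <= K &
  forall x y, `|torus_map x - torus_map y| <= K * `|x - y|.
Proof.
have /choice[k Hk] (i : 'I_n) : exists K, forall x y : vec,
    `|torus_at x i - torus_at y i| <= K * `|x - y|.
  by have [[+ _ _] _] := regular_torus_at i.
have K0 : 0 <= \sum_i `|k i| by apply: sumr_ge0.
exists (\sum_i `|k i|) => // x y; apply: norm_le_entries => [|i].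
  exact: mulr_ge0.
rewrite !mxE; apply: le_trans (Hk i x y) _; apply: ler_wpM2r => //.
apply: le_trans (ler_norm _) _; rewrite (bigD1 i)//= lerDl.
exact: sumr_ge0.
Qed.

Lemma torus_map_per x z : int_vec z -> torus_map (x + z) = torus_map x.
Proof.
move=> zi; have E j : exists w : int, angles (x + z) j = angles x j + w%:~R.
  by have /intrP[w wE] := zi (inord j); exists w; rewrite /angles mxE wE.
have per (f : R -> R) : (forall y, f (y + 2 * pi) = f y) -> forall j,
    f (2 * pi * angles (x + z) j) = f (2 * pi * angles x j).
  move=> fp j; have [w ->] := E j.
  by rewrite mulrDr mulrzr periodic_int.
have cp := @cos2piD R; have sp := @sin2piD R.
apply/rowP => i; rewrite !mxE /torus_at /phase.
have EA := per A Aper 0%N; have EB := per B Bper 0%N.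
have EC := per _ cp 0%N; have ES := per _ sp 0%N.
rewrite EA EB; case: (nat_of_ord i) => [|[|j]] /=; rewrite ?ES ?EC//.
case: ifP => // _; apply: psi_ext => k _.
by split; exact: per.
Qed.

Lemma torus_map_colip : exists K, forall x y : vec,
  exists2 z, int_vec z & `|y - x - z| <= K * `|torus_map y - torus_map x|.
Proof.
exists (18 * (4 * Bd) ^+ l.+1) => x y; set d := `|_ y - _ x|.
have d0 : 0 <= d by exact: normr_ge0.
have b1 : 1 <= 4 * Bd by move: Bd3; lra.
pose D := (4 * Bd) ^+ l.+1 * d.
have dk k : (k <= l.+1)%N -> (4 * Bd) ^+ k * d <= D.
  by move=> kl; rewrite ler_wpM2r// ler_weXn2l.
have dD : d <= D by have := dk 0%N isT; rewrite expr0 mul1r.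
have XB w i : `|torus_at w i| <= Bd by apply: torus_pt_le => //; exact: amplitude_le.
have Xd i : (i <= l.+2)%N -> `|torus_at y i - torus_at x i| <= d.
  move=> il; have i_n : (i < n)%N by exact: leq_ltn_trans ln.
  have := norm_entry_le (torus_map y - torus_map x) (Ordinal i_n).
  by rewrite !mxE.
have Aw w := amplitude_le (phase w).
have ZB w : `|A (phase w) * cos (phase w)| <= Bd by apply: osc_le; [exact: Aw|exact: cos_max].
have sE w j : (j <= l)%N -> torus_at w j.+2 = psi Bd l (angles w) (A (phase w) * cos (phase w)) j.
  by move=> jl; exact: torus_pt_psi.
pose u w := psi Bd l (angles w) (A (phase w) * cos (phase w)).
have su w : sig c (u w) l = A (phase w) * cos (phase w) by exact: sig_psi.
have sigd j : (j <= l)%N -> `|sig c (u y) j - sig c (u x) j| <= D.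
  move=> jl; apply: le_trans (_ : (4 * Bd) ^+ j * d <= _); last by apply: dk; exact: leqW.
  apply: (@sig_lip _ Bd Bd3 _ _ l d) => //; rewrite ?su//.
  by move=> k kl; rewrite /u -!sE//; exact: Xd.
have sqd : `|A (phase y) * sin (phase y) - A (phase x) * sin (phase x)| <= D.
  have E w : A (phase w) * sin (phase w) = torus_at w 0 ^+ 2 + torus_at w 1 ^+ 2 - c.
    have := @torus_pt_sq _ Bd l Bd3 (A (phase w)) (B (phase w)) (phase w) (angles w) (Aw w).
    by rewrite /plane_sq /torus_at => ->; rewrite addrK.
  apply: le_trans (_ : (4 * Bd) ^+ 1 * d <= _); last exact: dk.
  have -> : A (phase y) * sin (phase y) - A (phase x) * sin (phase x) =
     (torus_at y 0 - torus_at x 0) * (torus_at y 0 + torus_at x 0) +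
     (torus_at y 1 - torus_at x 1) * (torus_at y 1 + torus_at x 1) by rewrite !E; ring.
  apply: le_trans (ler_normD _ _) _; rewrite !normrM expr1.
  have k i : (i <= l.+2)%N -> `|torus_at y i - torus_at x i| * `|torus_at y i + torus_at x i| <=
     d * (2 * Bd).
    move=> il; rewrite ler_pM//; first exact: Xd.
    by apply: le_trans (ler_normD _ _) _; have := XB x i; have := XB y i; lra.
  have k0 := k 0%N isT; have k1 := k 1%N isT; lra.
have key (r r' t t' : R) : 1 <= r -> 1 <= r' ->
    `|r' * cos (2 * pi * t') - r * cos (2 * pi * t)| <= D ->
    `|r' * sin (2 * pi * t') - r * sin (2 * pi * t)| <= D ->
    exists2 z : R, z \is a Num.int & `|t' - t - z| <= 18 * D.
  move=> r1 r1' h1 h2; have [z zi Hz] := angle_dist t' t; exists z => //.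
  have [_ h3 h4] := polar_lip (@ltr01 R) r1' r1 h1 h2.
  by apply: le_trans Hz _; move: h3 h4; rewrite divr1; lra.
have /choice[z Hz] (i : 'I_l.+1) : exists z : R, z \is a Num.int /\
    `|y 0 i - x 0 i - z| <= 18 * D.
  have Ei (w : vec) : w 0 i = angles w i by rewrite /angles inord_val.
  rewrite !Ei; case: i {Ei} => i /=; case: i => [|j] jl.
    have /andP[r1 _] := A1 (phase x); have /andP[r2 _] := A1 (phase y).
    have [|z zi h] := key _ _ (angles x 0%N) (angles y 0%N) r1 r2 _ sqd; last by exists z.
    by rewrite -/(phase x) -/(phase y) -!su; apply: sigd.
  have jl' : (j < l)%N := jl.
  have [sx cx nx] := sig_psi_mid Bd3 (angles x) (ZB x) jl'.
  have [sy cy ny] := sig_psi_mid Bd3 (angles y) (ZB y) jl'.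
  have [_ _ rx _] := rad_bounds Bd3 sx; have [_ _ ry _] := rad_bounds Bd3 sy.
  have [||z zi h] := key _ _ (angles x j.+1) (angles y j.+1) rx ry; last by exists z.
    by rewrite -cx -cy; apply: sigd; exact: ltnW.
  by rewrite -nx -ny -!sE//; apply: le_trans dD; exact: Xd.
exists (\row_i z i); first by move=> i; rewrite mxE; have [] := Hz i.
apply: norm_le_entries => [|i]; first by rewrite !mulr_ge0// exprn_ge0//; lra.
by rewrite !mxE -mulrA; have [] := Hz i.
Qed.

Lemma torus_map_embedding : torus_embedding torus_map.
Proof.
have [K HK] := torus_map_colip.
exact: torus_embedding_colip torus_map_C1 torus_map_per HK.
Qed.

End TorusMap.

(** * Uniqueness of solutions *)

Section FlowUniqueness.
Context {R : realType} {n : nat}.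
Implicit Types (f : 'rV[R]_n -> R) (F : 'rV[R]_n -> 'rV[R]_n).

Lemma row_der (g : R -> 'rV[R]_n) (s : R) (d : 'rV[R]_n) :
  is_derive s 1 g d <-> forall i, has_deriv (fun s => g s 0 i) s (d 0 i).
Proof.
split=> [[gd <-] i|H].
  split; first by move/derivable_mxP : gd; apply.
  by rewrite derive_mx// mxE.
have gd : derivable g s 1.
  by apply/derivable_mxP => i j; rewrite (ord1 i); case: (H j).
split=> //; apply/rowP => i; rewrite derive_mx// mxE.
by case: (H i).
Qed.

Definition loclip f : Prop := forall r, exists K, forall x y,
  `|x| <= r -> `|y| <= r -> `|f x| <= K /\ `|f x - f y| <= K * `|x - y|.

Lemma loclip_cst (a : R) : loclip (fun=> a).
Proof.
by move=> r; exists `|a| => x y _ _; split=> //; rewrite subrr normr0 mulr_ge0.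
Qed.

Lemma loclip_coord i : loclip (fun x => x 0 i).
Proof.
move=> r; exists (Num.max r 1) => x y xr yr; split.
  by rewrite le_max (le_trans (norm_entry_le x i) xr).
have -> : x 0 i - y 0 i = (x - y) 0 i by rewrite !mxE.
apply: le_trans (norm_entry_le _ i) _.
by rewrite ler_peMl// le_max lexx orbT.
Qed.

Lemma loclip_add f g : loclip f -> loclip g -> loclip (fun x => f x + g x).
Proof.
move=> Hf Hg r; have [K HK] := Hf r; have [K' HK'] := Hg r.
exists (K + K') => x y xr yr; have [f1 f2] := HK x y xr yr; have [g1 g2] := HK' x y xr yr.
split; first by apply: le_trans (ler_normD _ _) _; rewrite lerD.
have -> : f x + g x - (f y + g y) = (f x - f y) + (g x - g y) by ring.
by apply: le_trans (ler_normD _ _) _; rewrite mulrDl lerD.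
Qed.

Lemma loclip_mul f g : loclip f -> loclip g -> loclip (fun x => f x * g x).
Proof.
move=> Hf Hg r; have [K HK] := Hf r; have [K' HK'] := Hg r.
exists (K * K' + K * K') => x y xr yr.
have [f1 f2] := HK x y xr yr; have [g1 g2] := HK' x y xr yr.
have [f3 _] := HK y y yr yr.
have fg : `|f x * g x| <= K * K' by rewrite normrM ler_pM.
split; first by apply: le_trans fg _; rewrite lerDl mulr_ge0//; [exact: le_trans f1|exact: le_trans g1].
have -> : f x * g x - f y * g y = (f x - f y) * g x + f y * (g x - g y) by ring.
apply: le_trans (ler_normD _ _) _; rewrite !normrM [leRHS]mulrDl; apply: lerD.
  by rewrite mulrAC ler_pM.
by rewrite -mulrA ler_pM.
Qed.

Lemma loclip_opp f : loclip f -> loclip (fun x => - f x).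
Proof.
move=> Hf r; have [K HK] := Hf r; exists K => x y xr yr; have [f1 f2] := HK x y xr yr.
by split; rewrite ?normrN// -opprD normrN.
Qed.

Lemma loclip_meval (p : mpoly.mpoly n R) : loclip (fun x => mpoly.meval (fun j => x 0 j) p).
Proof.
have expn i k : loclip (fun x => x 0 i ^+ k).
  elim: k => [|k IH]; first exact: loclip_cst.
  have -> : (fun x : 'rV[R]_n => x 0 i ^+ k.+1) = fun x => x 0 i * x 0 i ^+ k.
    by apply/funext => x; rewrite exprS.
  by apply: loclip_mul => //; exact: loclip_coord.
have -> : (fun x : 'rV[R]_n => mpoly.meval (fun j => x 0 j) p) =
  fun x => \sum_(m <- mpoly.msupp p) mpoly.mcoeff m p * \prod_(i < n) x 0 i ^+ mpoly.fun_of_multinom m i.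
  by apply/funext => x; rewrite mpoly.mevalE.
elim: (mpoly.msupp p) => [|m s IH].
  by under eq_fun do rewrite big_nil; exact: loclip_cst.
under eq_fun do rewrite big_cons.
apply: loclip_add => //; apply: loclip_mul; first exact: loclip_cst.
elim: (index_enum _) => [|i t IHt]; first by under eq_fun do rewrite big_nil; exact: loclip_cst.
by under eq_fun do rewrite big_cons; exact: loclip_mul.
Qed.

Definition loclip_field F : Prop := forall i, loclip (fun x => F x 0 i).

Lemma curve_bounded (g : R -> 'rV[R]_n) t : 0 <= t ->
  (forall s : R, 0 <= s <= t -> exists d, is_derive s 1 g d) ->
  exists r, forall s, 0 <= s <= t -> `|g s| <= r.
Proof.
move=> t0 gd; have gc s : 0 <= s <= t -> {for s, continuous (fun s => `|g s|)}.
  move=> /gd[d [dg _]]; have gs : {for s, continuous g}.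
    by apply: differentiable_continuous; exact/derivable1_diffP.
  by apply: (@continuous_comp _ _ _ g Num.norm) => //; exact: norm_continuous.
have [|w _ H] := @EVT_max _ (fun s => `|g s|) 0 t t0.
  apply: continuous_in_subspaceT => s; rewrite inE /= in_itv/=; exact: gc.
by exists `|g w| => s st; apply: H; rewrite in_itv.
Qed.

Lemma solution_unique F (g1 g2 : R -> 'rV[R]_n) t : loclip_field F -> 0 <= t ->
  g1 0 = g2 0 ->
  (forall s : R, 0 <= s <= t -> is_derive s 1 g1 (F (g1 s))) ->
  (forall s : R, 0 <= s <= t -> is_derive s 1 g2 (F (g2 s))) ->
  g1 t = g2 t.
Proof.
move=> FL t0 E D1 D2.
have [r1 H1] := curve_bounded t0 (fun s st => ex_intro _ _ (D1 s st)).
have [r2 H2] := curve_bounded t0 (fun s st => ex_intro _ _ (D2 s st)).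
pose r := Num.max r1 r2.
have /choice[K HK] i := FL i r.
pose f s := \sum_(i < n) (g1 s 0 i - g2 s 0 i) ^+ 2.
have df s : 0 <= s <= t -> has_deriv f s
    (\sum_(i < n) 2 * (g1 s 0 i - g2 s 0 i) * (F (g1 s) 0 i - F (g2 s) 0 i)).
  move=> st; have /row_der e1 := D1 s st; have /row_der e2 := D2 s st.
  have -> : f = \sum_(i < n) (fun s => (g1 s 0 i - g2 s 0 i) ^+ 2).
    by apply/funext => w; rewrite fct_sumE.
  apply: is_derive_sum => i; have h1 := e1 i; have h2 := e2 i.
  change (has_deriv (fun s => (g1 s 0 i - g2 s 0 i) ^+ 2) s
    (2 * (g1 s 0 i - g2 s 0 i) * (F (g1 s) 0 i - F (g2 s) 0 i))).
  by der; ring.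
have fge s i : (g1 s 0 i - g2 s 0 i) ^+ 2 <= f s.
  by rewrite /f (bigD1 i)//= lerDl; apply: sumr_ge0 => j _; exact: sqr_ge0.
have f0 s : 0 <= f s by apply: sumr_ge0 => j _; exact: sqr_ge0.
have nf s : `|g1 s - g2 s| <= Num.sqrt (f s).
  apply: norm_le_entries => [|i]; first exact: sqrtr_ge0.
  by rewrite -sqrtr_sqr ler_sqrt// !mxE.
have gr : f t <= f 0 * expR ((\sum_(i < n) 2 * `|K i|) * (t - 0)).
  apply: gronwall => // s st; eexists; first exact: df.
  rewrite mulr_suml; apply: ler_sum => i _.
  have g1r : `|g1 s| <= r by rewrite le_max H1.
  have g2r : `|g2 s| <= r by rewrite le_max H2// orbT.
  have [_ h] := HK i _ _ g1r g2r.
  rewrite -!mulrA; apply: ler_wpM2l => //; apply: le_trans (ler_norm _) _; rewrite normrM.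
  have -> : f s = Num.sqrt (f s) * Num.sqrt (f s) by rewrite -expr2 sqr_sqrtr.
  rewrite mulrCA; apply: ler_pM => //.
    by rewrite -sqrtr_sqr ler_sqrt.
  apply: le_trans h _; apply: le_trans (_ : `|K i| * `|g1 s - g2 s| <= _).
    by rewrite ler_wpM2r// ler_norm.
  by rewrite ler_wpM2l.
have ft : f t = 0.
  apply/eqP; rewrite eq_le f0 andbT; apply: le_trans gr _.
  by rewrite /f E big1 ?mul0r// => i _; rewrite subrr expr0n.
apply/rowP => i; apply/eqP; rewrite -subr_eq0 -sqrf_eq0 eq_le sqr_ge0 andbT.
by rewrite -ft.
Qed.

Lemma flow_rel_unique F t x y y' : loclip_field F ->
  flow_rel F t x y -> flow_rel F t x y' -> y = y'.
Proof.
move=> FL [a [b [g [/andP[a0 b0] /andP[at_ tb] g0 <- Dg]]]].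
move=> [a' [b' [g' [/andP[a0' b0'] /andP[at_' tb'] g0' <- Dg']]]].
have [t0|t0] := leP 0 t.
  apply: (solution_unique FL t0); rewrite ?g0 ?g0'// => s /andP[s0 st].
    by apply: Dg; apply/andP; split; lra.
  by apply: Dg'; apply/andP; split; lra.
have FL' : loclip_field (fun x => - F x).
  move=> i; have H := loclip_opp (FL i).
  have -> : (fun x => (- F x) 0 i) = fun x => - F x 0 i.
    by apply/funext => z; rewrite mxE.
  exact: H.
have rev (h : R -> 'rV[R]_n) al be : al < t -> 0 < be ->
    (forall s : R, al < s < be -> is_derive s 1 h (F (h s))) ->
    forall s : R, 0 <= s <= - t -> is_derive s 1 (fun s => h (- s)) (- F (h (- s))).
  move=> alt be0 Dh s /andP[s0 st]; apply/row_der => i.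
  have /row_der/(_ i) H : is_derive (- s) 1 h (F (h (- s))).
    by apply: Dh; apply/andP; split; lra.
  have H' : has_deriv (fun s => - s) s (- 1 : R) by der; ring.
  rewrite mxE; apply: der_eq (@der_comp _ (fun s => h s 0 i) (fun s => - s) s _ _ H H') _.
  by rewrite mulrN1.
rewrite -[t]opprK.
apply: (@solution_unique _ (fun s => g (- s)) (fun s => g' (- s)) (- t) FL').
- by rewrite oppr_ge0 ltW.
- by rewrite oppr0 g0 g0'.
- exact: (rev _ _ _ at_ b0 Dg).
- exact: (rev _ _ _ at_' b0' Dg').
Qed.

Lemma flow_eq F t x y : loclip_field F -> flow_rel F t x y -> flow F t x = y.
Proof.
by move=> FL xy; apply: xget_unique => // y' xy'; exact: flow_rel_unique xy' xy.
Qed.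

End FlowUniqueness.

(** * The polynomial and its degree *)

Section FieldMorphism.
Context {A B : comNzRingType} (f : {rmorphism A -> B}).
Variables (c eps : A).
Implicit Types u X : nat -> A.

Lemma rmorph_sig u l : f (sig c u l) = sig (f c) (fun j => f (u j)) l.
Proof. by elim: l => [//|l IH]; rewrite !sigS rmorphB rmorphD !rmorphXn IH. Qed.

Lemma rmorph_tfac u l : f (tfac c u l) = tfac (f c) (fun j => f (u j)) l.
Proof.
elim: l => [|l IH]; first exact: rmorph1.
by rewrite !tfacS !rmorphM rmorph_nat rmorphD rmorph_sig IH.
Qed.

Lemma rmorph_vf u l j : f (vf c u l j) = vf (f c) (fun j => f (u j)) l j.
Proof.
elim: l => [|l IH]; first exact: rmorph1.
by rewrite !vfS; case: ifP => _; rewrite rmorphM ?rmorph_tfac// rmorph_sig IH.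
Qed.

Lemma rmorph_field_coord X l i :
  f (field_coord eps c X l i) = field_coord (f eps) (f c) (fun j => f (X j)) l i.
Proof.
have sq : f (plane_sq X) = plane_sq (fun j => f (X j)) by rewrite rmorphD !rmorphXn.
have re : f (plane_re X) = plane_re (fun j => f (X j)) by rewrite rmorphB !rmorphXn.
have h : f (height c X l) = height (f c) (fun j => f (X j)) l by exact: rmorph_sig.
have s : f (speed c X l) = speed (f c) (fun j => f (X j)) l by exact: rmorph_tfac.
have E := (rmorph_nat, rmorphM, rmorphD, rmorphN, rmorphXn, sq, re, h, s).
case: i => [|[|i]]; rewrite /field_coord.
- by rewrite /radial_rate /angular_rate !E.
- by rewrite /radial_rate /angular_rate !E.
- by case: ifP => _; rewrite /height_rate !E ?rmorph_vf.
Qed.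

End FieldMorphism.

Section TorusPolynomial.
Context {R : realType} {n : nat}.
Variables (Bd eps : R) (l : nat).
Hypotheses (Bd3 : 3 <= Bd) (ln : (l.+3 <= n)%N).
Let c := 2 * Bd.
Notation poly := (mpoly.mpoly n R).

Definition coordinate {A : zmodType} (X : 'I_n -> A) (i : nat) : A :=
  if insub i is Some o then X o else 0.

Lemma coordinateE {A : zmodType} (X : 'I_n -> A) (o : 'I_n) : coordinate X o = X o.
Proof. by rewrite /coordinate valK. Qed.

Definition variable (o : 'I_n) : poly := mpoly.mpolyX R (mpoly.mnm1 o).

Definition field_poly (i : nat) : poly :=
  field_coord (mpoly.mpolyC n eps) (mpoly.mpolyC n c) (coordinate variable) l i.

Definition pad_poly : poly := coordinate variable 0 + mpoly.mpolyC n c.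

Definition torus_poly jj (i : 'I_n) : poly := pad_poly ^+ jj * field_poly i.

Lemma meval_coordinate (v : 'I_n -> R) i :
  mpoly.meval v (coordinate variable i) = coordinate v i.
Proof.
rewrite /coordinate; case: insubP => [w _ _|_]; first exact: mpoly.mevalXU.
exact: mpoly.meval0.
Qed.

Lemma meval_field_poly (v : 'I_n -> R) i :
  mpoly.meval v (field_poly i) = field_coord eps c (coordinate v) l i.
Proof.
rewrite /field_poly rmorph_field_coord /= !mpoly.mevalC; congr field_coord.
by apply/funext => j; exact: meval_coordinate.
Qed.

Lemma polyfieldE jj (x : 'rV[R]_n) (i : 'I_n) : polyfield (torus_poly jj) x 0 i =
  pad Bd jj (coordinate (x 0)) * field_coord eps c (coordinate (x 0)) l i.
Proof.
rewrite mxE /torus_poly mpoly.mevalM meval_field_poly rmorphXn /= /pad_poly mpoly.mevalD.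
by rewrite meval_coordinate mpoly.mevalC.
Qed.

Lemma torus_field_loclip jj : loclip_field (polyfield (torus_poly jj)).
Proof.
move=> i; have -> : (fun x => polyfield (torus_poly jj) x 0 i) =
   fun x : 'rV[R]_n => mpoly.meval (fun j => x 0 j) (torus_poly jj i).
  by apply/funext => x; rewrite mxE.
exact: loclip_meval.
Qed.

Definition degree (p : poly) : nat := (mpoly.mmeasure mpoly.mdeg p).-1.
Arguments degree _%_ring_scope.

Lemma degreeM_le p q a b : (degree p <= a)%N -> (degree q <= b)%N ->
  (degree (p * q) <= a + b)%N.
Proof.
have [->|p0] := eqVneq p 0; first by rewrite mul0r /degree mpoly.mmeasure0.
have [->|q0] := eqVneq q 0; first by rewrite mulr0 /degree mpoly.mmeasure0.
rewrite /degree mpoly.msizeM//.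
move: p0 q0; rewrite -!mpoly.msize_poly_eq0 -!lt0n.
case: (mpoly.mmeasure _ p) => // x _; case: (mpoly.mmeasure _ q) => // y _ /= h1 h2.
by rewrite addnS /= leq_add.
Qed.

Lemma degreeD_le p q a : (degree p <= a)%N -> (degree q <= a)%N ->
  (degree (p + q) <= a)%N.
Proof.
rewrite /degree -!subn1 !leq_subLR => h1 h2.
by apply: leq_trans (mpoly.mmeasureD_le _ _ _) _; rewrite geq_max h1.
Qed.

Lemma degreeN_le p a : (degree p <= a)%N -> (degree (- p) <= a)%N.
Proof. by rewrite /degree mpoly.mmeasureN. Qed.

Lemma degreeC_le k a : (degree (mpoly.mpolyC n k) <= a)%N.
Proof. by rewrite /degree mpoly.mmeasureC; case: (k != 0). Qed.

Lemma degree_nat_le k a : (degree k%:R <= a)%N.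
Proof. by rewrite -(rmorph_nat (@mpoly.mpolyC n R)); exact: degreeC_le. Qed.

Lemma degree_weaken p a b : (degree p <= a)%N -> (a <= b)%N -> (degree p <= b)%N.
Proof. exact: leq_trans. Qed.

Lemma degree_coordinate_le i : (degree (coordinate variable i) <= 1)%N.
Proof.
rewrite /coordinate; case: insubP => [w _ _|_]; last by rewrite /degree mpoly.mmeasure0.
by rewrite /degree mpoly.mmeasureX /= mpoly.mdeg1.
Qed.

Let u j := coordinate variable j.+2.

Lemma degree_sig k : (degree (sig (mpoly.mpolyC n c) u k) <= 2 ^ k)%N.
Proof.
elim: k => [|k IH]; first exact: degree_coordinate_le.
rewrite sigS; apply: degreeD_le; last by apply: degreeN_le; exact: degreeC_le.
rewrite expnS mul2n -addnn; apply: degreeD_le; rewrite expr2; apply: degreeM_le => //;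
  by apply: degree_weaken (degree_coordinate_le _) _; rewrite expn_gt0.
Qed.

Lemma degree_tfac k : (degree (tfac (mpoly.mpolyC n c) u k) <= 2 ^ k.+1 - 2)%N.
Proof.
elim: k => [|k IH]; first exact: (degree_nat_le 1).
rewrite tfacS; have -> : (2 ^ k.+2 - 2 = (2 ^ k.+1 - 2) + (0 + 2 ^ k.+1))%N.
  have : (0 < 2 ^ k)%N by rewrite expn_gt0.
  by rewrite !expnS; lia.
apply: degreeM_le => //; apply: degreeM_le; first exact: degree_nat_le.
by apply: degreeD_le; [exact: degree_sig|exact: degreeC_le].
Qed.

Lemma degree_vf k j : (degree (vf (mpoly.mpolyC n c) u k j) <= 2 ^ k - 1)%N.
Proof.
elim: k => [|k IH]; first exact: (degree_nat_le 1).
have k0 : (0 < 2 ^ k)%N by rewrite expn_gt0.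
rewrite vfS; case: ifP => _.
  have -> : (2 ^ k.+1 - 1 = 1 + (2 ^ k.+1 - 2))%N by rewrite !expnS; lia.
  by apply: degreeM_le; [exact: degree_coordinate_le|exact: degree_tfac].
have -> : (2 ^ k.+1 - 1 = 2 ^ k + (2 ^ k - 1))%N by rewrite !expnS; lia.
by apply: degreeM_le => //; exact: degree_sig.
Qed.

Lemma degree_field_poly i : (degree (field_poly i) <= 9 * 2 ^ l - 2)%N.
Proof.
have q0 : (0 < 2 ^ l)%N by rewrite expn_gt0.
have dsp := degree_tfac l; have dh := degree_sig l; have dvf := degree_vf l.
rewrite expnS in dsp; rewrite -/u in dsp dh dvf.
set q := (2 ^ l)%N in q0 dsp dh dvf *.
set C := mpoly.mpolyC n c in dsp dh dvf *; set X := coordinate variable.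
have dX := degree_coordinate_le; rewrite -/X in dX.
have dX2 k : (degree (X k ^+ 2) <= 2)%N.
  by rewrite expr2; apply: (@degreeM_le _ _ 1 1).
have dsq : (degree (plane_sq X) <= 2)%N by exact: degreeD_le.
have dre : (degree (plane_re X) <= 2)%N by apply: degreeD_le => //; exact: degreeN_le.
have dsc : (degree (plane_sq X - C) <= 2)%N.
  by apply: degreeD_le => //; apply: degreeN_le; exact: degreeC_le.
have dsq2 : (degree (plane_sq X ^+ 2) <= 4)%N.
  by rewrite expr2; apply: (@degreeM_le _ _ 2 2).
have dht : (degree (height C X l) <= q)%N := dh.
have dsd : (degree (speed C X l) <= 2 * q - 2)%N := dsp.
pose E := mpoly.mpolyC n eps.
have dE : (degree E <= 0)%N by exact: degreeC_le.
have d2 : (degree (2 : poly) <= 0)%N by exact: degree_nat_le.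
have drad : (degree (radial_rate E C X l) <= q + 5)%N.
  apply: degreeD_le; first by apply: degree_weaken (degreeM_le dsq dht) _; lia.
  by apply: degree_weaken (degreeM_le (degreeM_le dE dsc) dre) _; lia.
have dang : (degree (angular_rate E C X l) <= q + 5)%N.
  apply: degreeD_le; first by apply: degree_weaken (degreeM_le dsq2 dht) _; lia.
  apply: degree_weaken (degreeM_le (degreeM_le (degreeM_le (degreeM_le d2 dE) dsc) dsq) dre) _.
  lia.
have dhr : (degree (height_rate E C X l) <= q + 5)%N.
  apply: degree_weaken (degreeM_le d2 (_ : (degree _ <= q + 5)%N)) _; last by lia.
  apply: degreeD_le.
    by apply: degree_weaken (degreeM_le (degreeM_le (degreeM_le dE dsq) dht) dre) _; lia.
  by apply: degreeN_le; apply: degree_weaken (degreeM_le dsq2 dsc) _; lia.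
rewrite /field_poly -/C -/X -/E; case: i => [|[|i]]; rewrite /field_coord.
- apply: degree_weaken (degreeM_le dsd (_ : (degree _ <= 1 + (q + 5))%N)) _; last by lia.
  by apply: degreeD_le; last apply: degreeN_le; exact: degreeM_le.
- apply: degree_weaken (degreeM_le dsd (_ : (degree _ <= 1 + (q + 5))%N)) _; last by lia.
  by apply: degreeD_le; exact: degreeM_le.
- case: ifP => _; first by apply: degree_weaken (degreeM_le dhr (dvf _)) _; lia.
  apply: degreeN_le.
  by apply: degree_weaken (degreeM_le (degreeM_le (degreeM_le d2 dsq2) dsd) (dX _)) _; lia.
Qed.

Lemma field_poly_neq0 : exists o : 'I_n, field_poly o != 0.
Proof.
have n0 : (0 < n)%N by exact: leq_trans ln.
have n1 : (1 < n)%N by apply: leq_trans ln.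
have r1 : `|1 : R| <= Bd by rewrite normr1; move: Bd3; lra.
pose X := torus_pt Bd l 1 0 0 (fun=> 0) : nat -> R.
pose v (o : 'I_n) := X o.
have E i : coordinate v i = if (i < n)%N then X i else 0.
  rewrite /coordinate; case: insubP => [w io <-|/negbTE ->//]; by rewrite ltn_ord.
have vX i : (i <= l.+2)%N -> coordinate v i = X i.
  by move=> il; rewrite E (leq_ltn_trans il ln).
apply: contrapT => H.
have f0 (i : nat) (ni : (i < n)%N) : field_coord eps c (coordinate v) l i = 0.
  have F0 : field_poly (Ordinal ni) = 0.
    by apply/eqP; apply: contrapT => /negP h; apply: H; exists (Ordinal ni).
  by have := meval_field_poly v i; rewrite -[i]/(val (Ordinal ni)) F0 mpoly.meval0.
pose Y := coordinate v.
have sqE : plane_sq Y = c.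
  have -> : plane_sq Y = plane_sq X by rewrite /plane_sq /Y !vX.
  by rewrite torus_pt_sq// sin0 mulr0 add0r.
have hE : height c Y l = 1.
  have -> : height c Y l = height c X l.
    by apply: sig_ext => j jl; rewrite /Y vX.
  by rewrite torus_pt_height// cos0 mulr1.
have s1 : 1 <= speed c Y l.
  by have /andP[] : 1 <= speed c Y l <= (6 * Bd) ^+ l; [apply: tfac_bounds; rewrite // -/(height c Y l) hE|].
have := f0 0%N n0; have := f0 1%N n1; rewrite /field_coord -/Y => e1 e0.
have : speed c Y l * (plane_sq Y * radial_rate eps c Y l) = 0.
  have -> : speed c Y l * (plane_sq Y * radial_rate eps c Y l) =
    Y 0 * (speed c Y l * (Y 0 * radial_rate eps c Y l - Y 1 * angular_rate eps c Y l)) +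
    Y 1 * (speed c Y l * (Y 1 * radial_rate eps c Y l + Y 0 * angular_rate eps c Y l)).
    by rewrite /plane_sq; ring.
  by rewrite e0 e1; ring.
rewrite /radial_rate sqE hE subrr => /eqP.
have c0 : c != 0 by rewrite mulf_neq0// gt_eqF//; move: Bd3; lra.
have s0 : speed c Y l != 0 by rewrite gt_eqF//; move: s1; lra.
by rewrite mulr1 mulr0 mul0r addr0; apply/negP; exact: mulf_neq0 s0 (mulf_neq0 c0 c0).
Qed.

Lemma pad_poly_degree : mpoly.mmeasure mpoly.mdeg pad_poly = 2.
Proof.
have n0 : (0 < n)%N by exact: leq_trans ln.
pose o := Ordinal n0.
have pE : pad_poly = variable o + mpoly.mpolyC n c.
  by congr (_ + _); exact: (coordinateE _ o).
apply/eqP; rewrite eqn_leq; apply/andP; split.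
  rewrite pE; apply: leq_trans (mpoly.mmeasureD_le _ _ _) _.
  by rewrite geq_max mpoly.mmeasureX /= mpoly.mdeg1 mpoly.mmeasureC; case: (c != 0).
rewrite -[X in (X < _)%N](mpoly.mdeg1 o); apply: mpoly.mmeasure_mnm_lt.
rewrite mpoly.mcoeff_msupp pE mpoly.mcoeffD mpoly.mcoeffX eqxx mpoly.mcoeffC.
have /negbTE -> : mpoly.mnm1 o != mpoly.mnm0.
  by rewrite -mpoly.mdeg_eq0 mpoly.mdeg1.
by rewrite mulr0 addr0 oner_eq0.
Qed.

Lemma torus_poly_degree : exists jj, polyfield_degree (torus_poly jj) = (9 * 2 ^ l - 2)%N.
Proof.
have p0 : pad_poly != 0 by rewrite -mpoly.msize_poly_eq0 pad_poly_degree.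
have pE jj (o : 'I_n) : field_poly o != 0 ->
    degree (torus_poly jj o) = (jj + degree (field_poly o))%N.
  move=> o0; rewrite /torus_poly; elim: jj => [|jj IH]; first by rewrite expr0 mul1r add0n.
  have q0 : pad_poly ^+ jj * field_poly o != 0 by rewrite mulf_neq0// expf_neq0.
  rewrite exprS -mulrA addSn -IH /degree mpoly.msizeM// pad_poly_degree.
  by move: q0; rewrite -mpoly.msize_poly_eq0 -lt0n; case: (mpoly.mmeasure _ _).
have [i1 i1n] := field_poly_neq0.
have [i0 [i0n omax]] : exists i0 : 'I_n, field_poly i0 != 0 /\
    forall o : 'I_n, (degree (field_poly o) <= degree (field_poly i0))%N.
  have cn : (0 < #|'I_n|)%N by apply/card_gt0P; exists i1.
  pose F (o : 'I_n) := degree (field_poly o).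
  have [i0 omax] := bigop.eq_bigmax F cn.
  have le (o : 'I_n) : (degree (field_poly o) <= degree (field_poly i0))%N.
    by have := @bigop.leq_bigmax _ F o; rewrite omax.
  have [z|] := eqVneq (field_poly i0) 0; last by exists i0.
  exists i1; split=> // o; apply: leq_trans (le o) _.
  by rewrite z /degree mpoly.mmeasure0.
exists (9 * 2 ^ l - 2 - degree (field_poly i0))%N.
set jj := (_ - degree _)%N.
have jjE : (jj + degree (field_poly i0))%N = (9 * 2 ^ l - 2)%N.
  by rewrite subnK//; exact: degree_field_poly.
apply/eqP; rewrite eqn_leq; apply/andP; split.
  apply/bigmax_leqP => o _; rewrite -/(degree (torus_poly jj o)) -jjE.
  have [z|o_n] := eqVneq (field_poly o) 0.
    by rewrite /torus_poly z mulr0 /degree mpoly.mmeasure0.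
  by rewrite pE// leq_add2l.
rewrite -jjE -pE//.
exact: (@bigop.leq_bigmax _ (fun o : 'I_n => degree (torus_poly jj o)) i0).
Qed.

End TorusPolynomial.

(** * The invariant tori *)

Lemma two_pi_neq0 {R : realType} : 2 * pi != 0 :> R.
Proof. by rewrite mulf_neq0// gt_eqF// pi_gt0. Qed.

Section TorusFlow.
Context {R : realType} {n : nat}.
Variables (Bd eps : R) (l jj : nat) (A B : R -> R).
Hypotheses (Bd3 : 3 <= Bd) (ln : (l.+3 <= n)%N)
  (DA : forall x, has_deriv A x (eps * slow (A x) (B x) x))
  (DB : forall x, has_deriv B x (eps * (sin x * slow (A x) (B x) x)))
  (Aper : forall x, A (x + 2 * pi) = A x) (Bper : forall x, B (x + 2 * pi) = B x)
  (A1 : forall x, 1 <= A x <= Bd).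
Notation vec := 'rV[R]_l.+1.
Let at_ := torus_at Bd A B : vec -> nat -> R.
Let u := @torus_map R n Bd l A B.
Let F := polyfield (@torus_poly R n Bd eps l jj).
Let M := range u.

Definition with_phase (x : vec) (th : R) : vec :=
  \row_i if i == ord0 then th / (2 * pi) else x 0 i.

Lemma phase_with x th : phase (with_phase x th) = th.
Proof.
have E : inord 0 = ord0 :> 'I_l.+1 by apply: val_inj; rewrite /= inordK.
by rewrite /phase /angles mxE E eqxx mulrC divfK// two_pi_neq0.
Qed.

Lemma with_phase_id x : with_phase x (phase x) = x.
Proof.
apply/rowP => i; rewrite mxE; case: eqP => [->|//].
rewrite /phase /angles [2 * pi * _]mulrC mulfK ?two_pi_neq0//; congr (x 0 _).
by apply: val_inj; rewrite /= inordK.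
Qed.

Lemma torus_at_with x th i :
  at_ (with_phase x th) i = torus_pt Bd l (A th) (B th) th (angles x) i.
Proof.
rewrite /at_ /torus_at phase_with; case: i => [|[|i]] //=.
case: ifP => // il; apply: psi_ext => k /andP[k0 kl].
suff -> : angles (with_phase x th) k = angles x k by [].
rewrite /angles mxE; case: eqP => // /(congr1 val); rewrite /= inordK// => E.
by rewrite E in k0.
Qed.

Lemma with_phase_lip x x' th th' :
  `|with_phase x th - with_phase x' th'| <= `|x - x'| + `|th - th'|.
Proof.
apply: norm_le_entries => [|i]; first by rewrite addr_ge0.
rewrite !mxE; case: ifP => _.
  rewrite -mulrBl normrM; apply: le_trans (_ : `|th - th'| <= _); last by rewrite lerDr.
  have p1 : 1 <= `|2 * pi| :> R.
    by rewrite ger0_norm ?mulr_ge0 ?pi_ge0//; have := @pi_ge2 R; lra.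
  by rewrite ler_piMr// normfV invf_le1// (lt_le_trans _ p1).
have -> : x 0 i - x' 0 i = (x - x') 0 i by rewrite !mxE.
by apply: le_trans (norm_entry_le _ i) _; rewrite lerDl.
Qed.

Let ck (x : vec) := clock_at Bd l jj (at_ x).

Let ck_bounds x : 1 <= ck x <= clock_max Bd l jj.
Proof. by apply: torus_pt_clock => //; exact: amplitude_le. Qed.

Let ck_lip : exists2 K, 0 <= K & forall x y, `|ck x - ck y| <= K * `|x - y|.
Proof.
have [[[K HK] _ _] _] := regular_clock l jj Bd3 DA DB A1.
exists `|K| => // x y; apply: le_trans (HK x y) _.
by rewrite ler_wpM2r// ler_norm.
Qed.

Let ck_continuous x : continuous (fun th => ck (with_phase x th)).
Proof.
have [K K0 HK] := ck_lip; apply: (@lip_continuous _ _ K) => th th'.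
apply: le_trans (HK _ _) _; rewrite ler_wpM2l//.
by apply: le_trans (with_phase_lip _ _ _ _) _; rewrite subrr normr0 add0r.
Qed.

Lemma phase_flow_exists : exists TH : vec -> R -> R, forall x, TH x 0 = phase x /\
  forall t, has_deriv (TH x) t (ck (with_phase x (TH x t))).
Proof.
have /choice[TH HTH] (x : vec) : exists th : R -> R, th 0 = phase x /\
    forall t, has_deriv th t (ck (with_phase x (th t))).
  have [th th0 Dth] := scalar_flow (phase x) (@ck_continuous x) (fun th => ck_bounds _).
  by exists th.
by exists TH.
Qed.

Lemma coordinate_torus_map x : coordinate (u x 0) = at_ x.
Proof.
apply/funext => i; rewrite /coordinate; case: insubP => [w _ <-|].
  by rewrite mxE.
rewrite -leqNgt => ni; have : (l.+2 < i)%N by exact: leq_trans ni.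
by rewrite /at_ /torus_at; case: i {ni} => [|[|i]] //=; rewrite !ltnS => li; rewrite leqNgt li.
Qed.

Lemma torus_orbit_der x (th : R -> R) t :
  has_deriv th t (ck (with_phase x (th t))) ->
  is_derive t 1 (fun t => u (with_phase x (th t))) (F (u (with_phase x (th t)))).
Proof.
move=> Dth; apply/row_der => i; rewrite polyfieldE coordinate_torus_map.
have -> : (fun s => u (with_phase x (th s)) 0 i) =
    fun s => torus_pt Bd l (A (th s)) (B (th s)) (th s) (angles x) i.
  by apply/funext => s; rewrite mxE; exact: torus_at_with.
have E : at_ (with_phase x (th t)) =
    torus_pt Bd l (A (th t)) (B (th t)) (th t) (angles x).
  by apply/funext => j; exact: torus_at_with.
have ckE : ck (with_phase x (th t)) =
    clock_at Bd l jj (torus_pt Bd l (A (th t)) (B (th t)) (th t) (angles x)).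
  by rewrite /ck E.
have H1 : has_deriv (fun s => A (th s)) t (ck (with_phase x (th t)) *
    (eps * slow (A (th t)) (B (th t)) (th t))).
  by apply: der_eq (der_comp (DA (th t)) Dth) _; rewrite mulrC.
have H2 : has_deriv (fun s => B (th s)) t (ck (with_phase x (th t)) *
    (eps * (sin (th t) * slow (A (th t)) (B (th t)) (th t)))).
  by apply: der_eq (der_comp (DB (th t)) Dth) _; rewrite mulrC.
rewrite E; have H := (@torus_pt_der _ Bd eps l jj Bd3 (fun s => A (th s)) (fun s => B (th s))
  th (angles x) t _ (amplitude_le A1 _) ckE Dth H1 H2 i).
exact: H.
Qed.

Variable TH : vec -> R -> R.
Hypothesis HTH : forall x, TH x 0 = phase x /\
  forall t, has_deriv (TH x) t (ck (with_phase x (TH x t))).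

Lemma torus_flow_rel x t : flow_rel F t (u x) (u (with_phase x (TH x t))).
Proof.
have [t0 Dt] := HTH x.
exists (- (`|t| + 1)), (`|t| + 1), (fun t => u (with_phase x (TH x t))); split=> //.
- have := normr_ge0 t; lra.
- by have := ler_norm t; have := ler_norm (- t); rewrite normrN; lra.
- by rewrite t0 with_phase_id.
- by move=> s _; apply: torus_orbit_der.
Qed.

Lemma torus_flow x t : flow F t (u x) = u (with_phase x (TH x t)).
Proof. exact: flow_eq (@torus_field_loclip _ _ _ _ _ _) (torus_flow_rel x t). Qed.

Lemma torus_invariant : flow_invariant F M.
Proof.
move=> t p [x _ <-]; exists (u (with_phase x (TH x t))); first exact: torus_flow_rel.
by exists (with_phase x (TH x t)).
Qed.

Lemma torus_flow_lip : exists2 K, 0 <= K & forall t p p', M p -> M p' ->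
  `|flow F t p' - flow F t p| <= K * (1 + `|t|) * `|p' - p|.
Proof.
have [K1 K10 HK1] := @torus_map_lip R n Bd eps l A B Bd3 DA DB A1.
have [K2 HK2] := torus_map_colip B Bd3 ln A1.
have [K3 K30 HK3] := ck_lip.
have [CM CMb] : exists CM, forall x, 1 <= ck x <= CM by eexists; exact: ck_bounds.
have CM1 : 1 <= CM by have /andP[h1 h2] := CMb 0; exact: le_trans h2.
pose C := CM * (2 * pi + K3 * CM).
have pp : 0 <= pi :> R := pi_ge0 R.
have C0 : 0 <= C.
  by apply: mulr_ge0; [lra|apply: addr_ge0; [lra|apply: mulr_ge0 => //; lra]].
exists (K1 * (1 + C) * `|K2|); first by rewrite !mulr_ge0// addr_ge0.
move=> t p p' [x _ <-] [x0 _ <-].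
have [z zi] := HK2 x x0; rewrite -/u => Hz; pose x' := x0 - z.
have zi' : int_vec (- z) by move=> i; rewrite mxE rpredN.
have -> : u x0 = u x' by rewrite /x' /u torus_map_per.
have {}Hz : `|x' - x| <= `|K2| * `|u x' - u x|.
  have -> : u x' = u x0 by rewrite /x' /u torus_map_per.
  rewrite /x' addrAC; apply: le_trans Hz _.
  by rewrite ler_wpM2r// ler_norm.
rewrite !torus_flow; apply: le_trans (HK1 _ _) _; rewrite -!mulrA; apply: ler_wpM2l => //.
apply: le_trans (with_phase_lip _ _ _ _) _.
have [tx Dx] := HTH x; have [tx' Dx'] := HTH x'.
have H : `|TH x' t - TH x t| <= C * (1 + `|t|) * `|x' - x|.
  apply: le_trans (_ : CM * (`|TH x' 0 - TH x 0| + K3 * `|x' - x| * (CM * `|t|)) <= _).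
    apply: (@scalar_flow_lip _ (fun th => ck (with_phase x' th)) (fun th => ck (with_phase x th))).
    - exact: ck_continuous.
    - exact: ck_continuous.
    - by move=> th; exact: CMb.
    - by move=> th; exact: CMb.
    - move=> th; apply: le_trans (HK3 _ _) _; rewrite ler_wpM2l//.
      by apply: le_trans (with_phase_lip _ _ _ _) _; rewrite subrr normr0 addr0.
    - exact: Dx'.
    - exact: Dx.
  have h0 : `|TH x' 0 - TH x 0| <= 2 * pi * `|x' - x|.
    rewrite tx tx' /phase -mulrBr normrM ger0_norm; last by lra.
    apply: ler_wpM2l; first by lra.
    have -> : angles x' 0 - angles x 0 = (x' - x) 0 (inord 0) by rewrite /angles !mxE.
    exact: norm_entry_le.
  rewrite /C -[leRHS]mulrA -[leRHS]mulrA; apply: ler_wpM2l; first by lra.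
  have e1 : 0 <= 2 * pi * `|t| * `|x' - x| by apply: mulr_ge0 => //; apply: mulr_ge0 => //; lra.
  have e2 : 0 <= K3 * CM * `|x' - x| by apply: mulr_ge0 => //; apply: mulr_ge0 => //; lra.
  by move: (`|TH x' 0 - TH x 0|) (`|x' - x|) h0 e1 e2 => a d; lra.
have e0 : 0 <= `|t| by [].
have e1 : `|x' - x| + C * (1 + `|t|) * `|x' - x| <= (1 + C) * (1 + `|t|) * `|x' - x|.
  have e2 : 0 <= `|t| * `|x' - x| by exact: mulr_ge0.
  by move: (`|x' - x|) e2 => d; lra.
apply: le_trans (_ : (1 + C) * (1 + `|t|) * `|x' - x| <= _).
  by apply: le_trans e1; rewrite lerD2l.
rewrite -!mulrA; apply: ler_wpM2l; first by rewrite addr_ge0.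
rewrite mulrCA; apply: ler_wpM2l => //; by rewrite addr_ge0.
Qed.

Lemma torus_A_bound (rho : R) : 0 < rho -> exists2 KA, 1 < KA &
  forall t p v, M p -> tangent_space M p v ->
    enorm (A_op F t p v) <= KA * expR (rho * `|t|) * enorm v.
Proof.
move=> rho0; have [K K0 HK] := torus_flow_lip.
pose KA := n%:R * K * (1 + rho^-1) + 2.
have nK : 0 <= n%:R * K by rewrite mulr_ge0// ler0n.
have r0 : 0 < rho^-1 by rewrite invr_gt0.
exists KA; first by have : 0 <= n%:R * K * (1 + rho^-1); [rewrite mulr_ge0// addr_ge0// ltW|rewrite /KA; lra].
move=> t p v Mp Tv.
have Mf q s : M q -> M (flow F s q).
  by move=> [x _ <-]; rewrite torus_flow; exists (with_phase x (TH x s)).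
have kt : 0 <= K * (1 + `|- t|) by rewrite mulr_ge0// addr_ge0.
apply: le_trans (tangent_bound kt _ Mp Tv) _.
  by exists 1 => // p' Mp' _; exact: HK.
rewrite normrN; apply: ler_wpM2r; first exact: enorm_ge0.
have e1 : 1 + rho * `|t| <= expR (rho * `|t|) by exact: expR_ge1Dx.
have e2 : 0 <= expR (rho * `|t|) by exact: expR_ge0.
apply: le_trans (_ : n%:R * K * ((1 + rho^-1) * expR (rho * `|t|)) <= _).
  rewrite [leLHS]mulrA; apply: ler_wpM2l => //.
  apply: le_trans (_ : (1 + rho^-1) * (1 + rho * `|t|) <= _).
    have -> : (1 + rho^-1) * (1 + rho * `|t|) = 1 + `|t| + rho^-1 + rho * `|t|.
      by field; rewrite gt_eqF.
    by have : 0 <= rho * `|t|; [rewrite mulr_ge0// ltW|lra].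
  by apply: ler_wpM2l => //; rewrite addr_ge0// ltW.
rewrite [leLHS]mulrA; apply: ler_wpM2r => //.
by rewrite /KA lerDl.
Qed.

End TorusFlow.

(** * Attraction *)

Section NearTorus.
Context {R : realType}.
Variables (Bd eps a0 b0 eta lam : R) (l jj : nat) (A B : R -> R).
Hypotheses (Bd3 : 3 <= Bd) (eta14 : eta <= 1 / 4) (a02 : 2 < a0) (a0B : a0 + 1 <= Bd)
  (lam0 : 0 < lam) (att : slow_attractor eps a0 b0 eta lam A B).
Let c := 2 * Bd.

Lemma attractor_amplitude x : 7 / 4 <= A x <= Bd - 3 / 4.
Proof.
have [_ _ _ H _] := att; have := H x; have := normr_ge0 (B x - b0).
have := ler_norm (A x - a0); have := ler_norm (- (A x - a0)); rewrite normrN.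
by move: eta14 a02 a0B; lra.
Qed.

Lemma attractor_amplitude1 x : 1 <= A x <= Bd.
Proof. by have := attractor_amplitude x; lra. Qed.

Lemma plane_lip (k : R -> R) q q' be be' N :
  (forall x, `|k x| <= 1) -> (forall x y, `|k x - k y| <= `|x - y|) ->
  `|q| <= Bd -> `|q'| <= Bd -> `|q - q'| + `|be - be'| <= N ->
  `|Num.sqrt (q + c) * k ((be + q) / 2) - Num.sqrt (q' + c) * k ((be' + q') / 2)| <=
    (1 + Bd) * N.
Proof.
move=> k1 kl qB q'B HN.
have [_ h1 _ _] := rad_bounds Bd3 qB; have [_ h2 _ h3] := rad_bounds Bd3 q'B.
have -> : Num.sqrt (q + c) * k ((be + q) / 2) - Num.sqrt (q' + c) * k ((be' + q') / 2) =
  (Num.sqrt (q + c) - Num.sqrt (q' + c)) * k ((be + q) / 2) +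
  Num.sqrt (q' + c) * (k ((be + q) / 2) - k ((be' + q') / 2)) by ring.
have nn : 0 <= `|be - be'| by [].
have nn' : 0 <= `|q - q'| by [].
apply: le_trans (ler_normD _ _) _; rewrite [leRHS]mulrDl mul1r; apply: lerD.
  rewrite normrM; apply: le_trans (_ : `|q - q'| <= _); last by move: HN; lra.
  apply: le_trans (ler_piMr _ (k1 _)) _ => //.
  have -> : q - q' = (q + c) - (q' + c) by ring.
  by apply: sqrt_lip; [move: Bd3 h1; rewrite /c; lra|move: Bd3 h2; rewrite /c; lra].
rewrite normrM (ger0_norm (sqrtr_ge0 _)); apply: ler_pM => //.
apply: le_trans (kl _ _) _.
have -> : (be + q) / 2 - (be' + q') / 2 = (be - be') / 2 + (q - q') / 2 by field.
apply: le_trans (ler_normD _ _) _; rewrite !normrM (@ger0_norm _ 2^-1); last by lra.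
by move: HN; lra.
Qed.

Section Solution.
Variables (X : R -> nat -> R) (a b t1 th0 r0 be0 : R).
Hypotheses (aneg : a < 0) (t1_ge0 : 0 <= t1) (t1b : t1 < b)
  (HX : forall t i, a < t < b -> (i <= l.+2)%N ->
     has_deriv (X ^~ i) t (pad Bd jj (X t) * field_coord eps c (X t) l i))
  (s0 : 0 < plane_sq (X 0)) (Z0 : height c (X 0) l = r0 * cos th0)
  (Q0 : plane_sq (X 0) - c = r0 * sin th0)
  (X00 : X 0 0%N = Num.sqrt (plane_sq (X 0)) * cos ((be0 + (plane_sq (X 0) - c)) / 2))
  (X01 : X 0 1%N = Num.sqrt (plane_sq (X 0)) * sin ((be0 + (plane_sq (X 0) - c)) / 2)).
Let N0 := `|r0 - A th0| + `|be0 - B th0|.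
Hypothesis N0e : N0 <= eta / 5.

Lemma solution_contract t : 0 <= t <= t1 ->
  (exists th ph, forall i, (i <= l.+2)%N ->
     `|X t i - torus_pt Bd l (A th) (B th) th ph i| <=
       (1 + Bd) * (5 * N0 * expR (- lam * t))) /\
  1 <= clock_at Bd l jj (X t).
Proof.
move=> tt1.
have hc s : a < s < b -> {for s, continuous (fun t => pad Bd jj (X t))}.
  move=> sab; have h0 := der_continuous (HX sab (leq0n _)).
  by rewrite /pad; cat.
have [th [r [be [[th00 r00 be00] D E]]]] :=
  @slow_lift R eps c l X (fun t => pad Bd jj (X t)) a b t1 aneg t1_ge0 t1b hc HX
    th0 r0 be0 s0 Z0 Q0 X00 X01.
pose N s := `|r s - A (th s)| + `|be s - B (th s)|.
have N0E : N 0 = N0 by rewrite /N th00 r00 be00.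
have rB s : N s <= eta -> `|r s| <= Bd.
  move=> Ns; have /andP[h1 h2] := attractor_amplitude (th s).
  have h3 : 0 <= `|be s - B (th s)| by [].
  have := ler_normD (r s - A (th s)) (A (th s)); rewrite subrK.
  rewrite (@ger0_norm _ (A (th s))); last by lra.
  by move: Ns h3 h2 eta14; rewrite /N; lra.
have clk s : 0 <= s <= t1 -> N s <= eta -> 1 <= clock c l X (fun t => pad Bd jj (X t)) s.
  move=> st Ns; have [E1 E2 _ _] := E s st.
  have H1 : `|plane_sq (X s) - c| <= Bd.
    by rewrite E2; apply: osc_le; [exact: rB|exact: sin_max].
  have H2 : `|height c (X s) l| <= Bd.
    by rewrite E1; apply: osc_le; [exact: rB|exact: cos_max].
  by have /andP[] := clock_at_bounds jj Bd3 H1 H2.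
have [_ _ _ _ con] := att.
have Nt s : 0 <= s <= t1 -> N s <= 5 * N0 * expR (- lam * s).
  have D1 w (wt : 0 <= w <= t1) := let: And3 h _ _ := D w wt in h.
  have D2 w (wt : 0 <= w <= t1) := let: And3 _ h _ := D w wt in h.
  have D3 w (wt : 0 <= w <= t1) := let: And3 _ _ h := D w wt in h.
  have N0e' : N 0 <= eta / 5 by rewrite N0E.
  have := con t1 1 th r be _ t1_ge0 ltr01 D1 D2 D3 clk N0e' s.
  by rewrite mulr1 -/(N 0) N0E; apply.
have N00 : 0 <= N0 by rewrite addr_ge0.
have e1 : expR (- lam * t) <= 1.
  rewrite -expR0 ler_expR mulNr oppr_le0; apply: mulr_ge0; first exact: ltW.
  by case/andP: tt1.
have Nte : N t <= eta.
  apply: le_trans (Nt t tt1) _; apply: le_trans (_ : 5 * N0 <= _); last by move: N0e; lra.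
  by rewrite ler_piMr// mulr_ge0.
split; last exact: clk.
have [E1 E2 E3 E4] := E t tt1.
have rBt := rB t Nte.
have HB : `|sig c (fun j => X t j.+2) l| <= Bd.
  by rewrite -/(height c (X t) l) E1; apply: osc_le => //; exact: cos_max.
have [ph Hph] := psi_surj Bd3 HB; exists (th t), ph => i il.
have AB : `|A (th t)| <= Bd.
  by have /andP[h1 h2] := attractor_amplitude1 (th t); rewrite ger0_norm//; lra.
have NN : 0 <= N t by rewrite addr_ge0.
have osc (k : R) : `|k| <= 1 -> `|r t * k - A (th t) * k| <= `|r t - A (th t)|.
  by move=> k1; rewrite -mulrBl normrM ler_piMr.
apply: le_trans (_ : (1 + Bd) * N t <= _); last first.
  by apply: ler_wpM2l; [move: Bd3; lra|exact: Nt].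
have sqE : plane_sq (X t) = r t * sin (th t) + c by rewrite -E2 subrK.
have NQ : `|r t * sin (th t) - A (th t) * sin (th t)| + `|be t - B (th t)| <= N t.
  by rewrite lerD2r; apply: osc; exact: sin_max.
have QB := osc_le rBt (sin_max (th t)); have QB' := osc_le AB (sin_max (th t)).
case: i il => [|[|j]] jl.
- rewrite E3 E2 sqE /torus_pt.
  by apply: plane_lip => //; [exact: cos_max|exact: cos_lip].
- rewrite E4 E2 sqE /torus_pt.
  by apply: plane_lip => //; [exact: sin_max|exact: sin_lip].
- rewrite torus_pt_psi// Hph// -/(height c (X t) l) E1.
  have ZB := osc_le rBt (cos_max (th t)); have ZB' := osc_le AB (cos_max (th t)).
  apply: le_trans (@psi_lip _ Bd Bd3 l ph _ _ j ZB ZB') _.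
  apply: le_trans (osc _ (cos_max _)) _; apply: le_trans (_ : N t <= _).
    by rewrite /N lerDl.
  by rewrite ler_peMl//; move: Bd3; lra.
Qed.

Lemma solution_contract_rest i : (l.+2 < i)%N ->
  (forall t, a < t < b ->
     has_deriv (X ^~ i) t (pad Bd jj (X t) * field_coord eps c (X t) l i)) ->
  `|X t1 i| <= `|X 0 i| * expR (- t1).
Proof.
case: i => [|[|i]]// li Hi.
have D s : 0 <= s <= t1 -> has_deriv (fun s => X s i.+2 ^+ 2) s
    (- 2 * clock_at Bd l jj (X s) * X s i.+2 ^+ 2).
  move=> /andP[s1 s2]; have sab : a < s < b by apply/andP; split; move: aneg t1b; lra.
  have H : has_deriv (X ^~ i.+2) s (- (clock_at Bd l jj (X s) * X s i.+2)).
    apply: der_eq (Hi s sab) _; rewrite /field_coord.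
    have -> : (i <= l)%N = false by apply/negbTE; rewrite -ltnNge.
    by rewrite /clock_at -/c; ring.
  by der; ring.
have := @gronwall _ (fun s => X s i.+2 ^+ 2) 0 t1 (- 2) t1_ge0 _.
rewrite subr0 => H; rewrite -ler_sqr ?nnegrE ?mulr_ge0 ?expR_ge0//.
rewrite exprMn !real_normK ?num_real// [expR _ ^+ 2]expr2 -expRD.
have -> : - t1 + - t1 = - 2 * t1 by ring.
apply: H => s st; eexists; first exact: D.
have [_ clk] := solution_contract st.
apply: ler_wpM2r; first exact: sqr_ge0.
by move: clk; lra.
Qed.

End Solution.
Lemma attractor_lip : exists2 L, 0 <= L &
  forall x y, `|A x - A y| + `|B x - B y| <= L * `|x - y|.
Proof.
have [DA DB _ _ _] := att; have sl := slow_amplitude_le B attractor_amplitude1.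
have B0 : 0 <= Bd by move: Bd3; lra.
exists (2 * (`|eps| * Bd)); first by rewrite !mulr_ge0.
move=> x y; have h1 : `|A x - A y| <= `|eps| * Bd * `|x - y|.
  apply: (@der_lip _ A _ _ _ _ DA) => z; rewrite normrM ler_wpM2l//.
have h2 : `|B x - B y| <= `|eps| * Bd * `|x - y|.
  apply: (@der_lip _ B _ _ _ _ DB) => z; rewrite normrM ler_wpM2l// mulrC.
  by apply: osc_le; [exact: sl|exact: sin_max].
lra.
Qed.

Section NearPoint.
Context {n : nat}.
Hypothesis ln : (l.+3 <= n)%N.
Let u := @torus_map R n Bd l A B.

Lemma loclip_coordinate i : loclip (fun x : 'rV[R]_n => coordinate (x 0) i).
Proof.
rewrite /coordinate; case: insub => [w|]; [exact: loclip_coord|exact: loclip_cst].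
Qed.

Lemma loclip_square f : loclip f -> loclip (fun x : 'rV[R]_n => f x ^+ 2).
Proof. by move=> fl; under eq_fun do rewrite expr2; exact: loclip_mul. Qed.

Lemma loclip_plane_sq : loclip (fun x : 'rV[R]_n => plane_sq (coordinate (x 0))).
Proof. by apply: loclip_add; apply: loclip_square; exact: loclip_coordinate. Qed.

Lemma loclip_height k : loclip (fun x : 'rV[R]_n => height c (coordinate (x 0)) k).
Proof.
rewrite /height; elim: k => [|k IH] /=; first exact: loclip_coordinate.
apply: loclip_add; last exact: loclip_cst.
by apply: loclip_add; apply: loclip_square => //; exact: loclip_coordinate.
Qed.

Lemma torus_map_le x : `|u x| <= Bd.
Proof.
apply: norm_le_entries => [|i]; first by move: Bd3; lra.
have AB := amplitude_le attractor_amplitude1 (phase x).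
rewrite mxE; exact: torus_pt_le.
Qed.

Lemma near_torus_coords : exists K d0, [/\ 0 <= K, 0 < d0 &
  forall x0 x, `|x - u x0| <= d0 -> let X := coordinate (x 0) in
  exists th r be,
    [/\ 0 < plane_sq X, height c X l = r * cos th, plane_sq X - c = r * sin th,
        X 0%N = Num.sqrt (plane_sq X) * cos ((be + (plane_sq X - c)) / 2) /\
        X 1%N = Num.sqrt (plane_sq X) * sin ((be + (plane_sq X - c)) / 2) &
        `|r - A th| + `|be - B th| <= K * `|x - u x0|]].
Proof.
have [L L0 HL] := attractor_lip.
have [k1 H1] := loclip_plane_sq (Bd + 1); have [k2 H2] := loclip_height l (Bd + 1).
pose K1 := 1 + `|k1| + `|k2|.
have K11 : 1 <= K1 by rewrite /K1 -addrA lerDl addr_ge0.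
pose C1 : R := 2 * pi * (18 / (7 / 8)); pose C2 : R := 2 * pi * (18 / (1 / 2)).
have pp : 0 <= pi :> R := pi_ge0 R.
have C10 : 0 <= C1 by rewrite /C1; lra.
have C20 : 0 <= C2 by rewrite /C2; lra.
pose K := (3 + L * C1 + 2 * C2) * K1.
have K0 : 0 <= K.
  apply: mulr_ge0; last by lra.
  by have := mulr_ge0 L0 C10; lra.
exists K, (1 / 8 / K1); split=> //; first by rewrite divr_gt0//; lra.
move=> x0 x; set d := `|x - u x0| => dd X.
have d_0 : 0 <= d by exact: normr_ge0.
pose e := K1 * d.
have e8 : e <= 1 / 8.
  by rewrite /e mulrC -ler_pdivlMr//; lra.
have de : d <= e by rewrite /e ler_peMl.
have d1 : d <= 1 by lra.
have qB : `|u x0| <= Bd + 1 by have := torus_map_le x0; lra.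
have xB : `|x| <= Bd + 1.
  have := ler_normD (x - u x0) (u x0); rewrite subrK -/d.
  by have := torus_map_le x0; lra.
have [_ {}H1] := H1 _ _ xB qB; have [_ {}H2] := H2 _ _ xB qB.
have kle (k : R) : `|k| <= K1 -> k * d <= e.
  by move=> h; apply: ler_wpM2r => //; apply: le_trans (ler_norm k) h.
have cE : coordinate (u x0 0) = torus_at Bd A B x0 by exact: coordinate_torus_map.
have Xi i : (i < n)%N -> `|X i - torus_at Bd A B x0 i| <= e.
  move=> ni; apply: le_trans de; rewrite /X -cE -[i]/(nat_of_ord (Ordinal ni)).
  rewrite !coordinateE; have := norm_entry_le (x - u x0) (Ordinal ni).
  by rewrite [in leLHS]mxE [in leLHS]mxE.
have A1 := attractor_amplitude1; have AB := amplitude_le A1 (phase x0).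
set th0 := phase x0 in AB; set q0 := A th0 * sin th0; set z0 := A th0 * cos th0.
have q0B : `|q0| <= Bd by apply: osc_le => //; exact: sin_max.
have qE : plane_sq (torus_at Bd A B x0) = q0 + c by exact: torus_pt_sq.
have zE : height c (torus_at Bd A B x0) l = z0 by exact: torus_pt_height.
have hq : `|plane_sq X - c - q0| <= e.
  have -> : plane_sq X - c - q0 = plane_sq X - (q0 + c) by ring.
  rewrite -qE -cE; apply: le_trans H1 _; apply: kle.
  by rewrite /K1 addrAC lerDr addr_ge0.
have hz : `|height c X l - z0| <= e.
  rewrite -zE -cE; apply: le_trans H2 _; apply: kle.
  by rewrite /K1 lerDr addr_ge0.
have /andP[a74 _] := attractor_amplitude th0.
have [|||||r [th [zr qr r78 hr hth]]] :=
  @polar_near _ (A th0) (7 / 8) th0 (height c X l) (plane_sq X - c) e.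
- lra.
- by move: a74; lra.
- lra.
- exact: hz.
- exact: hq.
have [s0 _ s1 _] := rad_bounds Bd3 q0B.
set al0 := (B th0 + q0) / 2.
have n0 : (0 < n)%N by exact: leq_trans ln.
have n1 : (1 < n)%N by exact: leq_trans ln.
have [|||||r' [al [x0r x1r r'12 _ hal]]] :=
  @polar_near _ (Num.sqrt (q0 + c)) (1 / 2) al0 (X 0) (X 1) e.
- lra.
- by rewrite mulrA; move: s1; rewrite -/c; lra.
- lra.
- exact: Xi.
- exact: Xi.
have r'0 : 0 < r' by lra.
have sE : plane_sq X = r' ^+ 2.
  rewrite /plane_sq x0r x1r !exprMn -mulrDr.
  by rewrite addrC [sin _ ^+ 2]expr2 [cos _ ^+ 2]expr2 addrC cos2_sin2 mulr1.
have rE : Num.sqrt (plane_sq X) = r' by rewrite sE sqrtr_sqr gtr0_norm.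
pose be := 2 * al - (plane_sq X - c).
have beE : (be + (plane_sq X - c)) / 2 = al by rewrite /be; field.
exists th, r, be; split=> //.
- by rewrite sE exprn_gt0.
- by rewrite beE rE.
have hL := HL th0 th.
have hth' : `|th0 - th| <= C1 * e.
  by rewrite distrC; apply: le_trans hth _; rewrite /C1; lra.
have hal' : `|al - al0| <= C2 * e by apply: le_trans hal _; rewrite /C2; lra.
have hb : `|be - B th0| <= 2 * (C2 * e) + e.
  have -> : be - B th0 = 2 * (al - al0) - (plane_sq X - c - q0) by rewrite /be /al0; field.
  apply: le_trans (ler_normB _ _) _; rewrite normrM (@ger0_norm _ 2)//.
  by move: hal' hq; lra.
have hL' : L * `|th0 - th| <= L * (C1 * e) by exact: ler_wpM2l.
have h1 := ler_distD (A th0) r (A th); have h2 := ler_distD (B th0) be (B th).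
rewrite /K -mulrA -/e.
by move: hL hL' hr hb h1 h2; lra.
Qed.

End NearPoint.

End NearTorus.

Lemma flow_rel_sym {R : realType} {n : nat} (F : 'rV[R]_n -> 'rV[R]_n) t x y :
  flow_rel F t x y -> flow_rel F (- t) y x.
Proof.
move=> [a [b [g [/andP[a0 b0] /andP[at_ tb] g0 gt Dg]]]].
exists (a - t), (b - t), (fun s => g (s + t)); split.
- by apply/andP; split; lra.
- by apply/andP; split; lra.
- by rewrite add0r.
- by rewrite addNr.
- move=> s /andP[s1 s2].
  have /row_der D : is_derive (s + t) 1 g (F (g (s + t))).
    by apply: Dg; apply/andP; split; lra.
  apply/row_der => i; have H : has_deriv (fun s => s + t) s 1 by der; ring.
  by apply: der_eq (@der_comp _ (fun s => g s 0 i) (fun s => s + t) s _ _ (D i) H) _; rewrite mulr1.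
Qed.

Section NormalContraction.
Context {R : realType} {n : nat}.
Variables (Bd eps a0 b0 eta lam : R) (l jj : nat) (A B : R -> R).
Hypotheses (Bd3 : 3 <= Bd) (eta0 : 0 < eta) (eta14 : eta <= 1 / 4) (a02 : 2 < a0)
  (a0B : a0 + 1 <= Bd) (lam0 : 0 < lam)
  (att : slow_attractor eps a0 b0 eta lam A B) (ln : (l.+3 <= n)%N).
Let c := 2 * Bd.
Let u := @torus_map R n Bd l A B.
Let F := polyfield (@torus_poly R n Bd eps l jj).
Let M := range u.
Let rho := Num.min lam 1.

Lemma torus_map_pt th ph : exists2 p, M p &
  forall i : 'I_n, p 0 i = torus_pt Bd l (A th) (B th) th ph i.
Proof.
pose y : 'rV[R]_l.+1 := \row_k ph k.
exists (u (with_phase y th)); first by exists (with_phase y th).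
move=> i; rewrite mxE torus_at_with.
case: (nat_of_ord i) => [|[|j]] //=; case: ifP => // _.
apply: psi_ext => k /andP[_ kl].
by have -> : angles y k = ph k by rewrite /angles mxE inordK.
Qed.

Lemma near_contract : exists K d0, [/\ 0 <= K, 0 < d0 &
  forall q x t y, M q -> `|x - q| <= d0 -> 0 <= t -> flow_rel F t x y ->
  exists2 p, M p & `|y - p| <= K * expR (- rho * t) * `|x - q|].
Proof.
have [K [d0 [K0 d00 H]]] := near_torus_coords Bd3 eta14 a02 a0B att ln.
have K10 : 0 < K + 1 by lra.
have Bp : 0 <= 1 + Bd by move: Bd3; lra.
exists ((1 + Bd) * (5 * K) + 1), (Num.min d0 (eta / 5 / (K + 1))); split.
- by rewrite addr_ge0// !mulr_ge0.
- by rewrite lt_min d00 !divr_gt0.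
move=> q x t y [x0 _ <-]; set d := `|_ - _|; rewrite le_min => /andP[dd0 dK] t0.
move=> [a [b [g [/andP[aneg b_0] /andP[_ tb] g0 gt Dg]]]].
have [th0 [r0 [be0 [s0 Z0 Q0 [X00 X01] N0]]]] := H x0 x dd0.
have d_0 : 0 <= d by exact: normr_ge0.
have N0e : `|r0 - A th0| + `|be0 - B th0| <= eta / 5.
  apply: le_trans N0 _; move: dK; rewrite ler_pdivlMr// -/d; lra.
pose X s := coordinate (g s 0).
have HX s (i : nat) : a < s < b -> (i < n)%N ->
    has_deriv (X ^~ i) s (pad Bd jj (X s) * field_coord eps c (X s) l i).
  move=> sab ni; have /row_der/(_ (Ordinal ni)) := Dg s sab.
  rewrite polyfieldE /=; have -> : X ^~ i = fun s => g s 0 (Ordinal ni).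
    by apply/funext => w; rewrite /X -{1}[i]/(nat_of_ord (Ordinal ni)) coordinateE.
  by [].
have HX' s i : a < s < b -> (i <= l.+2)%N ->
    has_deriv (X ^~ i) s (pad Bd jj (X s) * field_coord eps c (X s) l i).
  by move=> sab il; apply: HX => //; exact: leq_trans ln.
rewrite -g0 in s0 Z0 Q0 X00 X01.
have tt : 0 <= t <= t by rewrite t0 lexx.
have [[th [ph Hp]] _] := solution_contract Bd3 eta14 a02 a0B lam0 att aneg t0 tb HX'
  s0 Z0 Q0 X00 X01 N0e tt.
have [p Mp pE] := torus_map_pt th ph; exists p => //.
have e0 : 0 <= expR (- rho * t) by exact: expR_ge0.
have el : expR (- lam * t) <= expR (- rho * t).
  by rewrite ler_expR !mulNr lerN2 ler_wpM2r// ge_min lexx.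
have e1 : expR (- t) <= expR (- rho * t).
  by rewrite ler_expR mulNr lerN2 ler_piMl// ge_min lexx orbT.
have ed : 0 <= expR (- rho * t) * d by exact: mulr_ge0.
have K5 : 0 <= (1 + Bd) * (5 * K) by rewrite !mulr_ge0.
apply: norm_le_entries => [|i]; first by rewrite !mulr_ge0// addr_ge0.
have yE : y 0 i = X t i by rewrite /X gt coordinateE.
rewrite !mxE yE pE; rewrite -[leRHS]mulrA [leRHS]mulrDl mul1r.
have [il|li] := leqP i l.+2.
  apply: le_trans (Hp i il) _; apply: le_trans (_ : (1 + Bd) * (5 * K) * (expR (- rho * t) * d) <= _).
    rewrite -[leRHS]mulrA; apply: ler_wpM2l => //.
    have h := ler_pM (_ : 0 <= `|r0 - A th0| + `|be0 - B th0|) (expR_ge0 (- lam * t)) N0 el.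
    by have := h (addr_ge0 (normr_ge0 _) (normr_ge0 _)); rewrite -/d; lra.
  by rewrite lerDl.
have -> : torus_pt Bd l (A th) (B th) th ph i = 0.
  case: (nat_of_ord i) li => [|[|j]] //=; rewrite !ltnS => lj.
  by rewrite leqNgt lj.
rewrite subr0; apply: le_trans (_ : expR (- rho * t) * d <= _); last by rewrite lerDr mulr_ge0.
have hr := solution_contract_rest Bd3 eta14 a02 a0B lam0 att aneg t0 tb HX'
  s0 Z0 Q0 X00 X01 N0e li (fun s sab => HX s i sab (ltn_ord i)).
apply: le_trans hr _; rewrite mulrC; apply: ler_pM => //.
rewrite /X g0 coordinateE.
have -> : x 0 i = (x - u x0) 0 i.
  rewrite !mxE; have -> : torus_at Bd A B x0 i = 0; last by rewrite subr0.
  rewrite /torus_at; case: (nat_of_ord i) li => [|[|j]] //=; rewrite !ltnS => lj.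
  by rewrite leqNgt lj.
exact: norm_entry_le.
Qed.

Lemma torus_map_neq0 p : M p -> 0 < `|p|.
Proof.
move=> [x _ <-]; rewrite normr_gt0; apply/eqP => u0.
have A1 := attractor_amplitude1 eta14 a02 a0B att.
have AB := amplitude_le A1 (phase x).
have E : coordinate (u x 0) = torus_at Bd A B x by exact: coordinate_torus_map.
rewrite u0 in E.
have z i : coordinate ((0 : 'rV[R]_n) 0) i = 0.
  by rewrite /coordinate; case: insub => [w|//]; rewrite mxE.
have := @torus_pt_sq _ Bd l Bd3 (A (phase x)) (B (phase x)) (phase x) (angles x) AB.
have -> : torus_pt Bd l (A (phase x)) (B (phase x)) (phase x) (angles x) =
  torus_at Bd A B x by apply/funext.
rewrite -E /plane_sq !z expr0n addr0 => E2.
have [+ _ _ _] := rad_bounds Bd3 (osc_le AB (sin_max (phase x))).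
by rewrite -E2 ltxx.
Qed.

Lemma torus_flow_data : (forall q s, M q -> M (flow F s q)) /\
  (forall q s, M q -> flow_rel F s q (flow F s q)).
Proof.
have [DA DB [Aper Bper] _ _] := att.
have A1 := attractor_amplitude1 eta14 a02 a0B att.
have [TH HTH] := phase_flow_exists l jj Bd3 DA DB A1.
split=> q s [x _ <-].
  rewrite (torus_flow Bd3 ln DA DB A1 HTH); by exists (with_phase x (TH x s)).
rewrite (torus_flow Bd3 ln DA DB A1 HTH); exact: torus_flow_rel.
Qed.

Lemma torus_B_bound : exists2 KB, 1 < KB & forall t p v, 0 <= t -> M p ->
  enorm (B_op F M t p v) <= KB * expR (- rho * t) * enorm v.
Proof.
have [DA DB [Aper Bper] _ _] := att.
have A1 := attractor_amplitude1 eta14 a02 a0B att.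
have [K [d0 [K0 d00 H]]] := near_contract.
have [Mf Mr] := torus_flow_data.
have uC := torus_map_C1 (n := n) l Bd3 DA DB A1.
have uper x z : int_vec z -> u (x + z) = u x by exact: (torus_map_per Bd Aper Bper).
have [Kc colip] := torus_map_colip B Bd3 ln A1.
have nK : 0 <= n%:R * K by rewrite mulr_ge0// ler0n.
exists (n%:R * K + 2); first lra.
move=> t p v t0 Mp; rewrite /B_op; set q := flow F (- t) p.
have Mq : M q by exact: Mf.
have qp : flow_rel F t q p by have := flow_rel_sym (Mr p (- t) Mp); rewrite opprK.
have FL : loclip_field F by exact: torus_field_loclip.
have fq : flow F t q = p by exact: flow_eq FL qp.
have ev : 0 <= expR (- rho * t) * enorm v by rewrite mulr_ge0 ?expR_ge0// enorm_ge0.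
have [df|/diff_junk ->] := pselect (differentiable (flow F t) q); last first.
  have := @normal_bound _ _ _ u Kc uC uper colip (fun=> p) p 0 0 (lexx 0) erefl _ Mp _.
  rewrite mulr0 => h; apply: le_trans (h _ _) _.
  - by exists 1 => // s _; exists p => //; rewrite subrr normr0 mul0r.
  - by rewrite -mulrA mulr_ge0// addr_ge0.
pose h s := flow F t (s *: v + q).
have Dh : is_derive (0 : R) 1 h ('d (flow F t) q v) by exact: line_derive.
have h0 : h 0 = p by rewrite /h scale0r add0r.
have k0 : 0 <= K * expR (- rho * t) * `|v| by rewrite !mulr_ge0// expR_ge0.
have hc : {for (0 : R), continuous h}.
  by apply: differentiable_continuous; apply/derivable1_diffP; case: Dh.
have p0 := torus_map_neq0 Mp.
have /nbhs_ballP[d1 /= d10 H1] : \forall s \near (0 : R), `|h 0 - h s| < `|p|.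
  by move/cvgrPdist_lt : hc => /(_ _ p0).
have v1 : 0 < `|v| + 1 by rewrite ltr_wpDl.
have := @normal_bound _ _ _ u Kc uC uper colip h p _ _ k0 h0 Dh Mp _.
move=> hb; apply: le_trans (hb _) _.
  exists (Num.min d1 (d0 / (`|v| + 1))); first by rewrite lt_min d10 divr_gt0.
  move=> s /andP[s0]; rewrite lt_min => /andP[sd1 sd0].
  have xq : `|s *: v + q - q| = s * `|v| by rewrite addrK normrZ gtr0_norm.
  have xd : `|s *: v + q - q| <= d0.
    rewrite xq; move: sd0; rewrite ltr_pdivlMr//; lra.
  have rel : flow_rel F t (s *: v + q) (h s).
    have [ex|nex] := pselect (exists y, flow_rel F t (s *: v + q) y).
      exact: xgetPex.
    exfalso; have hs0 : h s = 0 by apply: xgetPN => y ry; apply: nex; exists y.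
    have := H1 s; rewrite /ball /= sub0r normrN gtr0_norm// => /(_ sd1).
    by rewrite h0 hs0 subr0 ltxx.
  have [p' Mp' hp'] := H q _ t _ Mq xd t0 rel; exists p' => //.
  by apply: le_trans hp' _; rewrite xq; lra.
apply: le_trans (_ : n%:R * K * (expR (- rho * t) * enorm v) <= _).
  rewrite -!mulrA; do 2 (apply: ler_wpM2l; first by rewrite ?ler0n).
  by apply: ler_wpM2l; [exact: expR_ge0|exact: norm_le_enorm].
by rewrite -[leRHS]mulrA; apply: ler_wpM2r => //; rewrite lerDl.
Qed.

Lemma torus_attracting k : (n - k = l.+1)%N -> attracting_NH_invariant_torus k F M.
Proof.
move=> nk; have [DA DB [Aper Bper] _ _] := att.
have A1 := attractor_amplitude1 eta14 a02 a0B att.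
have [TH HTH] := phase_flow_exists l jj Bd3 DA DB A1.
split.
- by rewrite nk; exists u => //; exact: torus_map_embedding.
- exact: torus_invariant HTH.
- have rho0 : 0 < rho by rewrite lt_min lam0 ltr01.
  have [KB KB1 HB] := torus_B_bound.
  have [|KA KA1 HA] := torus_A_bound Bd3 ln DA DB Aper Bper A1 HTH (rho := rho / 2).
    by rewrite divr_gt0.
  exists 1%N => //; exists KA, KB, (rho / 2), rho; split=> //.
  + by split=> //; rewrite divr_gt0.
  + by move=> t p v t0 Mp _; exact: HB.
  + by rewrite mul1r; lra.
Qed.

End NormalContraction.

Lemma torus_amplitude {R : realType} {n : nat} (Bd : R) (l : nat) (A B : R -> R)
    (x : 'rV[R]_l.+1) (p : 'rV[R]_n) :
  3 <= Bd -> (l.+3 <= n)%N -> (forall x, 1 <= A x <= Bd) -> torus_map Bd A B x = p ->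
  height (2 * Bd) (coordinate (p 0)) l ^+ 2 +
    (plane_sq (coordinate (p 0)) - 2 * Bd) ^+ 2 = A (phase x) ^+ 2.
Proof.
move=> Bd3 ln A1 <-; have AB := amplitude_le A1 (phase x).
have -> : coordinate (torus_map Bd A B x 0 : 'I_n -> R) =
    torus_pt Bd l (A (phase x)) (B (phase x)) (phase x) (angles x).
  exact: coordinate_torus_map.
rewrite torus_pt_height// torus_pt_sq// addrK !exprMn -mulrDr.
by rewrite !expr2 cos2_sin2 mulr1.
Qed.

Theorem corollary1 (R : realType) (n k : nat) (hk : (2 <= k)%N) (hkn : (k < n)%N)
    (L : R) (hL : 0 < L) :
  exists P : 'I_n -> mpoly.mpoly n R,
    polyfield_degree P = (9 * 2 ^ (n - k - 1) - 2)%N /\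
    exists N : nat, L < N%:R /\
      `I_N #<= [set M | attracting_NH_invariant_torus k (polyfield P) M].
Proof.
set l := (n - k - 1)%N.
have nk : (n - k = l.+1)%N by rewrite /l; lia.
have ln : (l.+3 <= n)%N by lia.
pose N := (Num.truncn L).+1.
have LN : L < N%:R by exact: truncnS_gt.
have [eps [a0 [b0 [eta [lam [A [B [_ a02 aS eta4 att]]]]]]]] := @slow_attractor_family R N.
have amono i j : (i < j)%N -> a0 i + 1 <= a0 j.
  elim: j => [//|j IH]; rewrite ltnS leq_eqVlt => /predU1P[->|/IH h].
    exact/ltW/aS.
  by have := aS j; lra.
pose Bd := a0 N + 1.
have Bd3 : 3 <= Bd by have := a02 N; rewrite /Bd; lra.
have aB i : (i < N)%N -> a0 i + 1 <= Bd by move=> /amono; rewrite /Bd; lra.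
have [jj Pdeg] := torus_poly_degree eps Bd3 ln.
exists (@torus_poly R n Bd eps l jj); split=> //.
exists N; split=> //.
pose T i := range (@torus_map R n Bd l (A i) (B i)).
have A1 i : (i < N)%N -> forall x, 1 <= A i x <= Bd.
  move=> iN; have [_ h] := att i iN; have /andP[_ e4] := eta4 i.
  exact: attractor_amplitude1 e4 (a02 i) (aB i iN) h.
have Tlt i j : (i < j)%N -> (j < N)%N -> T i <> T j.
  move=> ij jN; have iN := ltn_trans ij jN => E.
  have : T j (torus_map Bd (A i) (B i) (0 : 'rV[R]_l.+1)) by rewrite -E; exact: imageT.
  move=> [y _ yE].
  have := torus_amplitude Bd3 ln (A1 i iN) (esym yE).
  rewrite (torus_amplitude Bd3 ln (A1 j jN) erefl).
  have /andP[p1 _] := A1 i iN (phase (0 : 'rV[R]_l.+1)); have /andP[p2 _] := A1 j jN (phase y).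
  have [_ [_ _ _ hi _]] := att i iN; have [_ [_ _ _ hj _]] := att j jN.
  have := hi (phase (0 : 'rV[R]_l.+1)); have := hj (phase y).
  have /andP[_ e4i] := eta4 i; have /andP[_ e4j] := eta4 j; have := amono i j ij.
  move: (A i _) (A j _) (B i _) (B j _) p1 p2 => x z w w' p1 p2 h1 h2 h3 /eqP.
  rewrite eqrXn2 //; [move=> /eqP h4|lra|lra].
  have := ler_norm (- (z - a0 j)); have := ler_norm (x - a0 i); rewrite normrN.
  have := normr_ge0 (w - b0 i); have := normr_ge0 (w' - b0 j).
  by move: h1 h2 h3 e4i e4j; rewrite h4; lra.
have Tinj : set_inj `I_N T.
  move=> i j; rewrite !inE /= => iN jN E.
  have [lij|lji|//] := ltngtP i j; first by have := Tlt i j lij jN.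
  by have := Tlt j i lji iN; rewrite E.
have sub : T @` `I_N `<=` [set M | attracting_NH_invariant_torus k
    (polyfield (@torus_poly R n Bd eps l jj)) M].
  move=> _ [i /= iN <-]; have [l0 h] := att i iN; have /andP[e0 e4] := eta4 i.
  exact: torus_attracting e0 e4 (a02 i) (aB i iN) l0 h ln _ nk.
apply: card_le_trans (subset_card_le sub).
by have /card_eqPle[] := inj_card_eq Tinj.
Qed.
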